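(* Let $(X,\mathsf{d},\mathfrak{m})$ be an $\mathsf{RCD}(K,N)$-space with $K\in\mathbb{R}$ and $N\in[1,+\infty)$, and let $p\in[1,+\infty)$. Then $(W^{2,p}_\ast(X),\|\cdot\|_{W^{2,p}_\ast(X)})$ is a Banach space.
   Context: A metric measure space $(X,\mathsf{d},\mathfrak{m})$ consists of a complete separable metric space $(X,\mathsf d)$ and a nonzero nonnegative Borel measure $\mathfrak m$, finite on bounded sets, with $\mathfrak m(B_r(x))>0$ for every open ball. Write $L^p(X)=L^p(X;\mathfrak m)$. Test plans. $C([0,1],X)$ is the space of continuous curves with the sup distance, and $\mathsf e_t(\gamma)=\gamma_t$. For $q\in(1,+\infty]$, $AC^q([0,1],X)$ is the set of curves $\gamma$ for which there is $g\in L^q([0,1])$ with $\mathsf d(\gamma_t,\gamma_s)\le\int_s^t g\,dr$ for $s<t$; its metric speed is $|\dot\gamma_t|=\lim_{h\downarrow0}\mathsf d(\gamma_{t+h},\gamma_t)/h$ (and $+\infty$ when the limit does not exist). A Borel probability measure $\boldsymbol\pi$ on $C([0,1],X)$ is a $q$-test plan if there is $C>0$ with $(\mathsf e_t)_\sharp\boldsymbol\pi\le C\mathfrak m$ for all $t\in[0,1]$, and: if $q<\infty$, $\int \mathsf{Ke}_q(\gamma)\,\boldsymbol\pi(d\gamma)<\infty$ where $\mathsf{Ke}_q(\gamma)=\int_0^1|\dot\gamma_t|^q\,dt$ if $\gamma\in AC^q$ and $+\infty$ otherwise; if $q=\infty$, the Lipschitz constant $\mathrm{Lip}(\gamma)$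 belongs to $L^\infty(\boldsymbol\pi)$. Weak upper gradients and Sobolev spaces. Let $p\in[1,+\infty)$, with conjugate exponent $q=p/(p-1)$ ($q=\infty$ if $p=1$). For a Borel function $f$ on $X$, a nonnegative Borel function $G$ is a $p$-weak upper gradient of $f$, written $G\in\mathcal{UG}^p(f)$, if $$\int|f(\gamma_1)-f(\gamma_0)|\,\boldsymbol\pi(d\gamma)\le\int\int_0^1G(\gamma_t)|\dot\gamma_t|\,dt\,\boldsymbol\pi(d\gamma)$$ for every $q$-test plan $\boldsymbol\pi$. $S^p(X)$ is the set of $f$ with $\mathcal{UG}^p(f)\cap L^p(X)\neq\emptyset$; for $f\in S^p(X)$, $|Df|=|Df|_p$ denotes the $\mathfrak m$-a.e. minimal element of $\mathcal{UG}^p(f)\cap L^p(X)$. $W^{1,p}(X)=L^p(X)\cap S^p(X)$ with norm $\|f\|_{W^{1,p}(X)}=(\|f\|_{L^p(X)}^p+\||Df|\|_{L^p(X)}^p)^{1/p}$. Modified second order Sobolev space. $W^{2,p}_\ast(X)=\{f\in W^{1,p}(X): \mathcal{UG}^p(f)\cap W^{1,p}(X)\neq\emptyset\}$, with $$\|f\|_{W^{2,p}_\ast(X)}=\Big(\|f\|_{L^p(X)}^p+\inf_{G\in\mathcal{UG}^p(f)\cap W^{1,p}(X)}\|G\|_{W^{1,p}(X)}^p\Big)^{1/p}.$$ Functions are identified when equal $\mathfrak m$-a.e. RCD spaces. $(X,\mathsf d,\mathfrak m)$ is infinitesimally Hilbertian if $W^{1,2}(X)$ is a Hilbert space; then $\langle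 Df,Dg\rangle=\frac14|D(f+g)|^2-\frac14|D(f-g)|^2$, $\mathscr E(f,g)=\int\langle Df,Dg\rangle\,d\mathfrak m$ on $W^{1,2}(X)$, and $\Delta$ is the $L^2$-Laplacian: $u\in D(\Delta)$ with $\Delta u=w\in L^2(X)$ iff $u\in W^{1,2}(X)$ and $\mathscr E(u,v)=-\int wv\,d\mathfrak m$ for all $v\in W^{1,2}(X)$. $(X,\mathsf d,\mathfrak m)$ is an $\mathsf{RCD}(K,\infty)$-space if (i) it is infinitesimally Hilbertian; (ii) $\mathfrak m(B_r(x_0))\le Ce^{cr^2}$ for some $x_0\in X$, $c,C>0$ (all $r>0$); (iii) every $f\in W^{1,2}(X)$ with $|Df|\le1$ $\mathfrak m$-a.e. has a $1$-Lipschitz representative; (iv) $\frac12\int|Df|^2\Delta g\,d\mathfrak m-\int\langle Df,D\Delta f\rangle g\,d\mathfrak m\ge K\int|Df|^2g\,d\mathfrak m$ for all $f\in D(\Delta)$ with $\Delta f\in W^{1,2}(X)$ and all $g\in D(\Delta)\cap L^\infty(X)$ with $g\ge0$, $\Delta g\in L^\infty(X)$. It is an $\mathsf{RCD}(K,N)$-space, $N\in[1,+\infty)$ (equivalently $\mathsf{RCD}^*(K,N)$), if moreover (iv) holds with the additional term $\frac1N\int(\Delta f)^2g\,d\mathfrak m$ on the right-hand side. *)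

(* Defs.v *)
From HB Require Import structures.
From mathcomp Require Import all_boot all_order all_algebra.
From mathcomp Require Import lra.
From mathcomp Require Import all_classical all_reals all_analysis.

Set Implicit Arguments.
Unset Strict Implicit.
Unset Printing Implicit Defensive.

Import Order.TTheory GRing.Theory Num.Theory.
Import numFieldNormedType.Exports.

Local Open Scope classical_set_scope.
Local Open Scope ring_scope.

#[short(type="completeMetricType")]
HB.structure Definition CompleteMetric (K : numDomainType) :=
  {M of Metric K M & Complete M}.

Notation borel T := (g_sigma_algebraType (@open T)).

Definition unit_itv (R : realType) : set R := `[0, 1]%classic.
Arguments unit_itv : clear implicits.

Section curves.
Context {R : realType} (X : completeMetricType R).

Fact clamp01_subproof (t : R) :
  Num.max 0 (Num.min t 1) \in unit_itv R.
Proof.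
rewrite inE /unit_itv /= in_itv /= le_max lexx /= ge_max ler01 /=.
by rewrite ge_min lexx orbT.
Qed.

(* Continuous retraction of the line onto [0, 1]; curves are evaluated at real
   times through it, i.e. extended by constants outside [0, 1]. *)
Definition clamp01 (t : R) : unit_itv R := SigSub (clamp01_subproof t).

Lemma clamp01_val (t : unit_itv R) : clamp01 (set_val t) = t.
Proof.
apply: val_inj => /=.
case: t => t /=; rewrite set_valE/= inE /unit_itv /= in_itv /= => /andP[t0 t1].
by rewrite min_l // max_r.
Qed.

Definition curve : Type := continuousType (unit_itv R) X.
HB.instance Definition _ := Choice.on curve.

Definition curve_fun (g : curve) : unit_itv R -> X := g.
Coercion curve_fun : curve >-> Funclass.

Definition curve_at (t : R) (g : curve) : X := g (clamp01 t).

Definition sup_dist (g h : curve) : R :=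
  sup (range (fun t => mdist (g t) (h t))).

Lemma curve_cont (g : curve) : continuous g.
Proof. exact: (@cts_fun _ _ g). Qed.

Let dcont (g h : curve) : continuous (fun t => mdist (g t) (h t)).
Proof.
move=> t; apply/(@cvgrPdist_lt _ _ _ (nbhs t) (nbhs_filter t)) => e e0.
have e2 : 0 < e / 2 by rewrite divr_gt0.
near=> s.
have gs : mdist (g t) (g s) < e / 2.
  near: s; exact: (metricType_numDomainType.cvgr_dist_lt (@curve_cont g t) e2).
have hs : mdist (h t) (h s) < e / 2.
  near: s; exact: (metricType_numDomainType.cvgr_dist_lt (@curve_cont h t) e2).
rewrite [e]splitr ltr_norml.
have := metric_triangle (g t) (g s) (h t).
have := metric_triangle (g s) (h s) (h t).
have := metric_triangle (g s) (g t) (h s).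
have := metric_triangle (g t) (h t) (h s).
rewrite (metric_sym (g s) (g t)) (metric_sym (h s) (h t)).
by clear -gs hs; move: (mdist _ _) (mdist _ _) (mdist _ _) (mdist _ _) gs hs;
  move=> *; lra.
Unshelve. all: by end_near. Qed.

Lemma sup_dist_has_ubound (g h : curve) :
  has_ubound (range (fun t => mdist (g t) (h t))).
Proof.
pose d (t : unit_itv R) := mdist (g t) (h t).
have dc : continuous d := @dcont g h.
have dE : sigL (unit_itv R) (fun t => d (clamp01 t)) = d.
  by apply/funext => t; rewrite /sigL /= clamp01_val.
have : {within unit_itv R, continuous (fun t => d (clamp01 t))}.
  by apply/subspace_sigL_continuousP; rewrite dE.
move=> /(EVT_max ler01)[c _ cmax].
exists (d (clamp01 c)) => _ [t _ <-].
rewrite -[t]clamp01_val; apply: cmax.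
by case: t => t t01 /=; rewrite set_valE /=; exact: set_mem t01.
Qed.

Let sup_dist_ub (g h : curve) t : mdist (g t) (h t) <= sup_dist g h.
Proof. by apply: ub_le_sup; [exact: sup_dist_has_ubound|exists t]. Qed.

Let sup_dist_le (g h : curve) e :
  (forall t, mdist (g t) (h t) <= e) -> sup_dist g h <= e.
Proof.
move=> H; apply: ge_sup; last by move=> _ [t _ <-].
by exists (mdist (g (clamp01 0)) (h (clamp01 0))), (clamp01 0).
Qed.

Let sup_distxx (g : curve) : sup_dist g g = 0.
Proof.
apply/eqP; rewrite eq_le sup_dist_le /=; last by move=> t; rewrite mdistxx.
by rewrite -[leLHS](mdistxx (g (clamp01 0))) sup_dist_ub.
Qed.

Let sup_dist_positivity (g h : curve) : sup_dist g h = 0 -> g = h.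
Proof.
move=> gh0; apply/continuousEP => t; apply: mdist_positivity.
have := @sup_dist_ub g h t; rewrite gh0 => le0.
by apply: le_anti; rewrite le0 mdist_ge0.
Qed.

Let sup_dist_sym (g h : curve) : sup_dist g h = sup_dist h g.
Proof.
rewrite /sup_dist.
by have -> : (fun t => mdist (g t) (h t)) = (fun t => mdist (h t) (g t))
  by apply/funext => t; exact: metric_sym.
Qed.

Let sup_dist_triangle (h g k : curve) :
  sup_dist g k <= sup_dist g h + sup_dist h k.
Proof.
apply: sup_dist_le => t; apply: (@le_trans _ _ (mdist (g t) (h t) + mdist (h t) (k t))).
  exact: metric_triangle.
by apply: lerD; exact: sup_dist_ub.
Qed.

HB.instance Definition _ := @isMetric.Build R curve sup_dist
  sup_distxx sup_dist_positivity sup_dist_sym sup_dist_triangle.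

Let cst_curve : curve :=
  [the continuousType _ _ of mkcts (@cst_continuous (unit_itv R) X point)].

HB.instance Definition _ := isPointed.Build curve cst_curve.

End curves.

Section sobolev.
Context {R : realType} {X : completeMetricType R}.

Lemma measurable_unit_itv : measurable (unit_itv R).
Proof. exact: measurable_itv. Qed.

Definition leb01 : {measure set (measurableTypeR R) -> \bar R} :=
  mrestr lebesgue_measure measurable_unit_itv.

Definition ac_curve (q : \bar R) (g : curve X) : Prop :=
  exists2 v : R -> R, v \in Lfun leb01 q &
    forall s t, 0 <= s -> s < t -> t <= 1 ->
      mdist (curve_at t g) (curve_at s g) <= \int[leb01]_(r in `[s, t]) v r.

(* A limit equal to +oo counts as non-existent, consistently with the default
   value.  At t = 1, where h > 0 leaves [0, 1], the clamping gives 0; this point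
   is negligible. *)
Definition metric_speed (g : curve X) (t : R) : \bar R :=
  let dq h := (mdist (curve_at (t + h) g) (curve_at t g) / h)%:E in
  if `[< cvg (dq h @[h --> 0^'+]) >] then lim (dq h @[h --> 0^'+]) else +oo%E.

Definition kinetic_energy (q : R) (g : curve X) : \bar R :=
  if `[< ac_curve q%:E g >] then (\int[leb01]_t (metric_speed g t `^ q))%E
  else +oo%E.

Definition lip_const (g : curve X) : \bar R :=
  ereal_sup [set (mdist (g st.1) (g st.2) / `|val st.1 - val st.2|)%:E
    | st in [set st : unit_itv R * unit_itv R | st.1 != st.2]].

Variable m : {measure set (borel X) -> \bar R}.

Definition metric_measure_space : Prop :=
  [/\ exists2 D : set X, countable D & dense D,
      m setT != 0%E,
      forall (A : set (borel X)) (x : X) (r : R),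
        measurable A -> A `<=` ball x r -> (m A < +oo)%E
    & forall (x : X) (r : R), 0 < r -> (0 < m (ball x r))%E].

Definition test_plan (q : \bar R) (P : probability (borel (curve X)) R) : Prop :=
  (exists2 C : R, 0 < C & forall (t : unit_itv R) (A : set (borel X)),
      measurable A ->
      (pushforward P (fun g : borel (curve X) => (g : curve X) t : borel X) A
        <= C%:E * m A)%E)
  /\ match q with
     | q'%:E => (\int[P]_g kinetic_energy q' g < +oo)%E
     | +oo%E => ('N[P]_+oo[lip_const] < +oo)%E
     | -oo%E => False
     end.

Definition upper_gradient (p : R) (f : borel X -> R) : set (borel X -> R) :=
  [set G : borel X -> R | [/\ measurable_fun setT G, forall x, 0 <= G x
    & forall P, test_plan (hoelder_conjugate p%:E) P ->
      (\int[P]_g `|f (curve_at 1 g) - f (curve_at 0 g)|%:E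
       <= \int[P]_g \int[leb01]_t ((G (curve_at t g))%:E * metric_speed g t))%E]].

Definition Lp_upper_gradient (p : R) (f : borel X -> R) : set (borel X -> R) :=
  upper_gradient p f `&` [set G | G \in Lfun m p%:E].

Definition Sp (p : R) : set (borel X -> R) :=
  [set f | measurable_fun setT f /\ Lp_upper_gradient p f !=set0].

(* The function |Df|_p, unique up to m-negligible sets; the default value 0 is
   only taken if there is no a.e. minimal element. *)
Definition min_upper_gradient (p : R) (f : borel X -> R) : borel X -> R :=
  xget (cst 0) [set G | Lp_upper_gradient p f G /\
    forall H, Lp_upper_gradient p f H -> {ae m, forall x, G x <= H x}].

(* The Sobolev spaces are given as sets of Borel functions; the identification of
   functions that are equal a.e. is carried out in banach_mod_ae. *)
Definition W1 (p : R) : set (borel X -> R) :=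
  [set f | f \in Lfun m p%:E] `&` Sp p.

Definition W1_norm (p : R) (f : borel X -> R) : \bar R :=
  (('N[m]_(p%:E)[EFin \o f] `^ p
    + 'N[m]_(p%:E)[EFin \o min_upper_gradient p f] `^ p) `^ p^-1)%E.

Definition W2 (p : R) : set (borel X -> R) :=
  [set f | W1 p f /\ upper_gradient p f `&` W1 p !=set0].

Definition W2_norm (p : R) (f : borel X -> R) : \bar R :=
  (('N[m]_(p%:E)[EFin \o f] `^ p
    + ereal_inf [set W1_norm p G `^ p | G in upper_gradient p f `&` W1 p])
     `^ p^-1)%E.

(* S is a vector space of functions, and its quotient S / (= a.e.), normed by N,
   is a Banach space: cl is the quotient map onto B.  In particular N is finite
   on S and only depends on the a.e. class. *)
Definition banach_mod_ae (S : set (borel X -> R)) (N : (borel X -> R) -> \bar R)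
    : Prop :=
  [/\ S 0,
      forall (a : R) f g, S f -> S g -> S (a *: f + g)
    & exists (B : completeNormedModType R) (cl : (borel X -> R) -> B),
      [/\ forall (a : R) f g, S f -> S g -> cl (a *: f + g) = a *: cl f + cl g,
          forall f g, S f -> S g -> cl f = cl g <-> f = g %[ae m],
          forall b, exists2 f, S f & cl f = b
        & forall f, S f -> N f = `|cl f|%:E]].

Definition hilbert_mod_ae (S : set (borel X -> R)) (N : (borel X -> R) -> \bar R)
    : Prop :=
  banach_mod_ae S N /\
  exists ip : (borel X -> R) -> (borel X -> R) -> R,
    [/\ forall f g, S f -> S g -> ip f g = ip g f,
        forall (a : R) f g h, S f -> S g -> S h ->
          ip (a *: f + g) h = a * ip f h + ip g h
      & forall f, S f -> (ip f f)%:E = (N f * N f)%E].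

Definition infinitesimally_hilbertian : Prop := hilbert_mod_ae (W1 2) (W1_norm 2).

Definition grad_prod (f g : borel X -> R) : borel X -> R := fun x =>
  4^-1 * min_upper_gradient 2 (f + g) x ^+ 2
  - 4^-1 * min_upper_gradient 2 (f - g) x ^+ 2.

Definition is_laplacian (u w : borel X -> R) : Prop :=
  [/\ W1 2 u, w \in Lfun m 2%:E
    & forall v, W1 2 v -> \int[m]_x grad_prod u v x = - \int[m]_x (w x * v x)].

(* c is the inverse of the dimension bound (0 in the infinite dimensional case).
   Lf and Lg stand for the Laplacians of f and g; all the integrands are
   integrable, so that real-valued integrals are meaningful. *)
Definition bochner (K c : R) : Prop :=
  forall f Lf g Lg : borel X -> R,
    is_laplacian f Lf -> W1 2 Lf ->
    is_laplacian g Lg -> g \in Lfun m +oo%E -> {ae m, forall x, 0 <= g x} ->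
    Lg \in Lfun m +oo%E ->
    K * (\int[m]_x (min_upper_gradient 2 f x ^+ 2 * g x))
    + c * (\int[m]_x (Lf x ^+ 2 * g x))
    <= 2^-1 * (\int[m]_x (min_upper_gradient 2 f x ^+ 2 * Lg x))
       - \int[m]_x (grad_prod f Lf x * g x).

Definition RCD_infty (K : R) : Prop :=
  [/\ infinitesimally_hilbertian,
      exists (x0 : X) (c C : R), [/\ 0 < c, 0 < C
        & forall r, 0 < r -> (m (ball x0 r) <= (C * expR (c * r ^+ 2))%:E)%E],
      forall f, W1 2 f -> {ae m, forall x, min_upper_gradient 2 f x <= 1} ->
        exists2 h : borel X -> R, f = h %[ae m]
          & forall x y : X, `|h x - h y| <= mdist x y
    & bochner K 0].

Definition RCD (K N : R) : Prop := RCD_infty K /\ bochner K N^-1.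

End sobolev.

(* Main.v *)
(* The space is the quotient of a seminormed space in which every rapidly convergent
   series has a sum, and upper gradients are stable under everything needed: if G_n
   is an upper gradient of u_n, then |a| G_0 + G_1 is one of a u_0 + u_1, and
   sum_n G_n is one of sum_n u_n by monotone convergence. For a series of functions
   of W^{2,p} with norms summable at a geometric rate, choose nearly optimal upper
   gradients G_n of u_n in W^{1,p}; their sum G is an upper gradient of the sum, and
   G is in W^{1,p} by the same argument applied to the minimal upper gradients of
   the G_n. These exist since upper gradients in L^p are closed under minima and
   decreasing limits. The minimum of two upper gradients is an upper gradient because
   a test plan can be restricted to a set of curves and to a time interval; the
   curves outside of the set are replaced by constants, so that the result is again
   a probability measure. *)

From HB Require Import structures.
Require Import Defs.
From mathcomp Require Import all_boot all_order all_algebra.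
From mathcomp Require Import ring lra.
From mathcomp Require Import all_classical all_reals all_analysis.
From mathcomp Require Import measurable_realfun ess_sup_inf.

Import Order.TTheory GRing.Theory Num.Theory.
Import numFieldNormedType.Exports.

Set Implicit Arguments.
Unset Strict Implicit.
Unset Printing Implicit Defensive.

Local Open Scope classical_set_scope.
Local Open Scope ring_scope.

(** * Complete quotients of seminormed spaces *)

(** No weak compactness enters: minimal gradients and completeness both rest on monotone and
    dominated convergence, which treats p = 1 and p > 1 alike. Two obstacles shape the proof. The
    metric speed is +oo where its limit does not exist, so dominated convergence along a test plan
    needs the speed to be measurable jointly in the curve and the time, and the integral of G times
    the speed to be finite. Measurability comes from the upper and lower right derivatives, which
    are limits of semicontinuous functions. Finiteness is Young's inequality if p > 1; if p = 1 only
    the Lipschitz constants are controlled, and one needs that a Lipschitz curve in a metric space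
    has a metric derivative at almost every time. Secondly, the second order norm is an infimum
    whose attainment is not established: gradients are chosen with a slack, and the bounds on the
    terms of a series are strict. At first order the minimal gradient attains the norm. *)

Section seminorm_quotient.
Local Open Scope quotient_scope.

(** The space is a subset of an ambient vector space, so that the quotient map is total on [V].
    Completeness is asked for series with a geometric rate, as a bound on the tails; the strict
    bound on the terms leaves room for nearly optimal choices when the norm is an infimum. *)
Record seminormed_space (R : realType) (V : lmodType R) := SeminormedSpace {
  ss_set : set V;
  ss_norm : V -> R;
  ss_0 : ss_set 0;
  ss_lin : forall (a : R) f g, ss_set f -> ss_set g -> ss_set (a *: f + g);
  ss_normD : forall f g, ss_set f -> ss_set g ->
    ss_norm (f + g) <= ss_norm f + ss_norm g;
  ss_normZ : forall (a : R) f, ss_set f -> ss_norm (a *: f) = `|a| * ss_norm f;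
  ss_complete : exists2 M : R, 0 < M & forall u : nat -> V,
    (forall n, ss_set (u n) /\ ss_norm (u n) < 2^-1 ^+ n) ->
    exists2 f, ss_set f &
      forall k, ss_norm (f - \sum_(i < k) u i) <= M * 2^-1 ^+ k }.

Context (R : realType) (V : lmodType R) (E : seminormed_space V).
Local Notation S := (ss_set E).
Local Notation N := (ss_norm E).

Let SZ (a : R) f : S f -> S (a *: f).
Proof. by move=> Sf; rewrite -[_ *: _]addr0; apply: ss_lin => //; exact: ss_0. Qed.

Let SD f g : S f -> S g -> S (f + g).
Proof. by move=> Sf Sg; rewrite -[f]scale1r; exact: ss_lin. Qed.

Let SN f : S f -> S (- f).
Proof. by move=> Sf; rewrite -scaleN1r; exact: SZ. Qed.

Let SB f g : S f -> S g -> S (f - g).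
Proof. by move=> Sf Sg; apply: SD => //; exact: SN. Qed.

Let S_sum (u : nat -> V) k : (forall n, S (u n)) -> S (\sum_(i < k) u i).
Proof.
move=> Su; elim: k => [|k IH]; first by rewrite big_ord0; exact: ss_0.
by rewrite big_ord_recr; exact: SD.
Qed.

Let N0 : N 0 = 0.
Proof. by rewrite -[X in N X](scale0r 0) ss_normZ ?normr0 ?mul0r//; exact: ss_0. Qed.

Let NN f : S f -> N (- f) = N f.
Proof. by move=> Sf; rewrite -scaleN1r ss_normZ// normrN1 mul1r. Qed.

Let N_ge0 f : S f -> 0 <= N f.
Proof.
move=> Sf; have := ss_normD Sf (SN Sf); rewrite subrr N0 NN//.
by rewrite -mulr2n pmulrn_lge0.
Qed.

Let NB f g : S f -> S g -> N (f - g) = 0 -> N f = N g.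
Proof.
move=> Sf Sg fg0; apply/eqP; rewrite eq_le.
have := ss_normD (SB Sf Sg) Sg; rewrite fg0 subrK add0r => ->/=.
have := ss_normD (SB Sg Sf) Sf; rewrite subrK.
by rewrite -opprB NN ?fg0 ?add0r//; exact: SB.
Qed.

(** Sending everything outside of [S] to 0 makes [ss_rel] an equivalence relation on the whole of
    [V]. *)
Let P f := if `[< S f >] then f else 0.

Let SP f : S (P f).
Proof. by rewrite /P; case: asboolP => // _; exact: ss_0. Qed.

Let PE f : S f -> P f = f.
Proof. by rewrite /P => /asboolT ->. Qed.

Definition ss_rel : rel V := fun f g => N (P f - P g) == 0.

Fact ss_rel_equiv : equiv_class_of ss_rel.
Proof.
split=> [f|f g|f g h]; rewrite /ss_rel.
- by rewrite subrr N0.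
- by rewrite -opprB NN//; apply: SB.
- move=> /eqP gf /eqP fh; apply/eqP/le_anti; rewrite N_ge0 ?andbT; last exact: SB.
  rewrite -(subrK (P f) (P g)) -addrA.
  by rewrite (le_trans (ss_normD _ _))// ?gf ?fh ?addr0//; apply: SB.
Qed.

Canonical ss_equiv := EquivRelPack ss_rel_equiv.

Definition ss_quot : Type := {eq_quot ss_rel}.
HB.instance Definition _ := EqQuotient.on ss_quot.
HB.instance Definition _ := Choice.on ss_quot.

Definition ss_cl (f : V) : ss_quot := \pi f.
Definition ss_repr (x : ss_quot) : V := P (repr x).

Let S_repr x : S (ss_repr x).
Proof. exact: SP. Qed.

Let PP f : P (P f) = P f.
Proof. by rewrite PE. Qed.

Let ss_reprK x : ss_cl (ss_repr x) = x.
Proof.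
rewrite -[RHS]reprK; apply/eqquotP.
by rewrite /= /ss_rel PP subrr N0.
Qed.

Lemma ss_cl_eq f g : S f -> S g -> ss_cl f = ss_cl g <-> N (f - g) = 0.
Proof.
move=> Sf Sg; split=> [/eqquotP|fg0].
  by rewrite /= /ss_rel !PE// => /eqP.
by apply/eqquotP; rewrite /= /ss_rel !PE// fg0.
Qed.

Let N_cl f : S f -> N (f - ss_repr (ss_cl f)) = 0.
Proof. by move=> Sf; apply/ss_cl_eq => //; rewrite ss_reprK. Qed.

Let N_clV f : S f -> N (ss_repr (ss_cl f) - f) = 0.
Proof. by move=> Sf; apply/ss_cl_eq => //; rewrite ss_reprK. Qed.

Let ss_add x y := ss_cl (ss_repr x + ss_repr y).
Let ss_opp x := ss_cl (- ss_repr x).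
Let ss_scale (a : R) x := ss_cl (a *: ss_repr x).

Let ss_addE f g : S f -> S g -> ss_add (ss_cl f) (ss_cl g) = ss_cl (f + g).
Proof.
move=> Sf Sg; apply/ss_cl_eq; [exact: SD|exact: SD|].
apply/le_anti; rewrite N_ge0 ?andbT; last by apply: SB; exact: SD.
rewrite opprD addrACA (le_trans (ss_normD _ _))//; [exact: SB|exact: SB|].
by rewrite !N_clV ?addr0.
Qed.

Let ss_oppE f : S f -> ss_opp (ss_cl f) = ss_cl (- f).
Proof.
move=> Sf; apply/ss_cl_eq; [exact: SN|exact: SN|].
rewrite -opprD NN; last by apply: SD => //; exact: SN.
exact: N_clV.
Qed.

Let ss_scaleE a f : S f -> ss_scale a (ss_cl f) = ss_cl (a *: f).
Proof.
move=> Sf; apply/ss_cl_eq; [exact: SZ|exact: SZ|].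
rewrite -scalerBr ss_normZ; last exact: SB.
by rewrite N_clV ?mulr0.
Qed.

Let clP x : exists2 f, S f & x = ss_cl f.
Proof. by exists (ss_repr x). Qed.

Let addA : associative ss_add.
Proof.
move=> x y z; case: (clP x) (clP y) (clP z) => [f ? ->] [g ? ->] [h ? ->].
by rewrite !ss_addE ?addrA//; exact: SD.
Qed.

Let addC : commutative ss_add.
Proof.
move=> x y; case: (clP x) (clP y) => [f ? ->] [g ? ->].
by rewrite !ss_addE ?[f + g]addrC.
Qed.

Let add0 : left_id (ss_cl 0) ss_add.
Proof.
move=> x; case: (clP x) => [f ? ->].
by rewrite !ss_addE ?add0r//; exact: ss_0.
Qed.

Let addN : left_inverse (ss_cl 0) ss_opp ss_add.
Proof.
move=> x; case: (clP x) => [f ? ->].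
by rewrite ss_oppE// !ss_addE ?addNr//; exact: SN.
Qed.

HB.instance Definition _ := GRing.isZmodule.Build ss_quot addA addC add0 addN.

Let scaleA a b x : ss_scale a (ss_scale b x) = ss_scale (a * b) x.
Proof.
by case: (clP x) => [f ? ->]; rewrite !ss_scaleE ?scalerA//; exact: SZ.
Qed.

Let scale1 : left_id 1 ss_scale.
Proof. by move=> x; case: (clP x) => [f ? ->]; rewrite ss_scaleE ?scale1r. Qed.

Let scaleDr : right_distributive ss_scale ss_add.
Proof.
move=> a x y; case: (clP x) (clP y) => [f ? ->] [g ? ->].
by rewrite ss_addE// !ss_scaleE ?ss_addE ?scalerDr//; [exact: SZ|exact: SZ|exact: SD].
Qed.

Let scaleDl x : {morph ss_scale^~ x : a b / a + b >-> ss_add a b}.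
Proof.
move=> a b; case: (clP x) => [f ? ->].
by rewrite !ss_scaleE ?ss_addE ?scalerDl//; exact: SZ.
Qed.

HB.instance Definition _ := GRing.Zmodule_isLmodule.Build R ss_quot
  scaleA scale1 scaleDr scaleDl.

Let ss_nm (x : ss_quot) : R := N (ss_repr x).

Let ss_nmE f : S f -> ss_nm (ss_cl f) = N f.
Proof. by move=> Sf; apply/esym/NB => //; exact: N_cl. Qed.

Let nmD x y : ss_nm (x + y) <= ss_nm x + ss_nm y.
Proof.
case: (clP x) (clP y) => [f ? ->] [g ? ->].
rewrite [_ + _]ss_addE// !ss_nmE//; first exact: ss_normD.
exact: SD.
Qed.

Let nmZ (a : R) x : ss_nm (a *: x) = `|a| * ss_nm x.
Proof.
case: (clP x) => [f ? ->].
by rewrite [_ *: _]ss_scaleE// !ss_nmE ?ss_normZ//; exact: SZ.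
Qed.

Let nm0 x : ss_nm x = 0 -> x = 0.
Proof.
case: (clP x) => [f ? ->]; rewrite ss_nmE// => Nf0.
by apply/ss_cl_eq; rewrite ?subr0//; exact: ss_0.
Qed.

HB.instance Definition _ := Lmodule_isNormed.Build R ss_quot nmD nmZ nm0.

Lemma ss_cl_norm f : S f -> `|ss_cl f| = N f.
Proof. exact: ss_nmE. Qed.

Lemma ss_cl_lin (a : R) f g : S f -> S g ->
  ss_cl (a *: f + g) = a *: ss_cl f + ss_cl g.
Proof.
move=> Sf Sg; rewrite -[RHS]/(ss_add (ss_scale a (ss_cl f)) (ss_cl g)).
by rewrite ss_scaleE// ss_addE//; exact: SZ.
Qed.

Let cl_sum (u : nat -> V) k : (forall n, S (u n)) ->
  ss_cl (\sum_(i < k) u i) = \sum_(i < k) ss_cl (u i).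
Proof.
move=> Su; elim: k => [|k IH]; first by rewrite !big_ord0.
rewrite !big_ord_recr/= -IH -[\sum_(i < k) u i]scale1r ss_cl_lin ?scale1r//.
exact: S_sum.
Qed.

(** Centres [x n] of balls in the filter have differences below [2^-1 ^+ n]. Representatives of
    these differences form a series to which [ss_complete] applies, and its tail bound controls the
    distance from the limit to [x k]. *)
Let complete (F : set_system ss_quot) : ProperFilter F -> cauchy F -> cvg F.
Proof.
move=> FF /cauchyP Fc; have [M M0 HM] := ss_complete E.
(* Two consecutive radii add up to 3/8 of [2^-1 ^+ n]. *)
pose d n : R := 2^-1 ^+ n.+2.
have d0 n : 0 < d n by rewrite exprn_gt0.
have /choice[x Fx] : forall n, exists x, F (ball x (d n)).
  by move=> n; exact: Fc.
have xx n : `|x n.+1 - x n| < 2^-1 ^+ n.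
  have [z [zn zn1]] := @filter_ex _ _ FF _ (filterI (Fx n) (Fx n.+1)).
  rewrite -(subrK z (x n.+1)) -addrA (le_lt_trans (ler_normD _ _))//.
  rewrite -ball_normE /= in zn; rewrite -ball_normE /= in zn1.
  rewrite distrC in zn; apply: (lt_trans (ltrD zn1 zn)).
  rewrite /d !exprS; have : 0 < 2^-1 ^+ n :> R by rewrite exprn_gt0.
  by move: (2^-1 ^+ n) => t t0; lra.
pose u n := ss_repr (x n.+1 - x n).
have Su n : S (u n) by exact: S_repr.
have [|f Sf Hf] := HM u.
  by move=> n; split => //; rewrite -ss_cl_norm// ss_reprK.
apply/cvg_ex; exists (x 0 + ss_cl f); apply/cvgrPdist_lt => e e0.
have lx k : `|x 0 + ss_cl f - x k| <= M * 2^-1 ^+ k.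
  have -> : x 0 + ss_cl f - x k = ss_cl (f - \sum_(i < k) u i).
    rewrite [in RHS]addrC -scaleN1r ss_cl_lin//; last exact: S_sum.
    rewrite scaleN1r cl_sum//; under eq_bigr do rewrite /u ss_reprK.
    rewrite -(big_mkord xpredT (fun i => x i.+1 - x i)) telescope_sumr//.
    by rewrite opprB addrAC.
  by rewrite ss_cl_norm ?Hf//; apply: SB => //; exact: S_sum.
(* [M] accounts for the tail of the series and 1 for the radius of the ball around [x k]. *)
have [k kM] : exists k, (M + 1) * 2^-1 ^+ k < e.
  exists (Num.Def.truncn ((M + 1) / e)).+1; set k := _.+1.
  rewrite exprVn ltr_pdivrMr ?exprn_gt0// mulrC -ltr_pdivrMr//.
  have := truncnS_gt ((M + 1) / e); rewrite -/k => /lt_trans; apply.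
  by rewrite -natrX ltr_nat ltn_expl.
apply: filterS (Fx k) => y; rewrite -ball_normE /= => xy.
rewrite -(subrK (x k) (x 0 + _)) -addrA (le_lt_trans (ler_normD _ _))//.
apply: (lt_trans _ kM); apply: (le_lt_trans (lerD (lx k) (lexx _))).
rewrite mulrDl mul1r ltrD2l (lt_le_trans xy)//.
rewrite /d !exprS; have : 0 < 2^-1 ^+ k :> R by rewrite exprn_gt0.
by move: (2^-1 ^+ k) => t t0; lra.
Qed.

HB.instance Definition _ := Uniform_isComplete.Build ss_quot complete.

Lemma seminorm_quotient_complete :
  exists (B : completeNormedModType R) (cl : V -> B),
    [/\ forall (a : R) f g, S f -> S g -> cl (a *: f + g) = a *: cl f + cl g,
        forall f g, S f -> S g -> cl f = cl g <-> N (f - g) = 0,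
        forall b, exists2 f, S f & cl f = b
      & forall f, S f -> `|cl f| = N f].
Proof.
exists (ss_quot : completeNormedModType R), ss_cl; split.
- exact: ss_cl_lin.
- exact: ss_cl_eq.
- by move=> b; exists (ss_repr b).
- exact: ss_cl_norm.
Qed.

End seminorm_quotient.

(** * Measurability of the metric speed *)

Section borel_measurability.
Context {R : realType}.

Lemma open_borel (T : ptopologicalType) (A : set T) :
  open A -> measurable (A : set (borel T)).
Proof. exact: sub_sigma_algebra. Qed.

Lemma measurable_fun_borel d (T : measurableType d) (Y : ptopologicalType)
    (f : T -> Y) : (forall U, open U -> measurable (f @^-1` U)) ->
  measurable_fun setT (f : T -> borel Y).
Proof.
move=> fU; apply: (@measurability _ _ _ (borel Y) _ _ (@open Y)) => //.
by move=> _ [U oU <-]; rewrite setTI; exact: fU.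
Qed.

(* The sigma-algebra of the product with the line contains all open sets even if
   T is not second countable. *)
Lemma open_measurable_prodR (T : ptopologicalType) (W : set (T * R)) :
  open W -> measurable (W : set (borel T * measurableTypeR R)%type).
Proof.
move=> oW.
pose I (q : rat) (k : nat) : set R := ball (ratr q : R) k.+1%:R^-1.
(* Only the intervals have to range over a countable family: for each of them, [A] collects all open
   sets whose product with it lies in [W], and such an arbitrary union is still open. *)
pose A q k : set T := \bigcup_(V in [set V | open V /\
  forall x t, V x -> I q k t -> W (x, t)]) V.
have -> : W = \bigcup_(q : rat) \bigcup_(k : nat) (A q k `*` I q k).
  apply/seteqP; split=> [[x t] Wxt|[x t] [q _ [k _ [/= [V [oV VW] Vx] It]]]];
    last exact: VW.
  have := oW; rewrite openE => /(_ _ Wxt)[[U1 U2] /= [U1x U2t] U12].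
  move: U1x; rewrite nbhsE => -[V [oV Vx] VU1].
  move: U2t => /nbhs_ballP[e /= e0 etU2].
  pose k := Num.Def.truncn (2 / e).
  have ke : k.+1%:R^-1 < e / 2.
    by rewrite -[e / 2]invrK ltf_pV2 ?posrE ?invr_gt0 ?divr_gt0// invf_div truncnS_gt.
  clearbody k.
  have [q] := @rat_in_itvoo R t (t + k.+1%:R^-1) (ltac:(by rewrite ltrDl)).
  rewrite in_itv /= => /andP[tq qt].
  have Itq : I q k t.
    rewrite /I /ball /= ltr_norml; apply/andP.
    by move: tq qt; move: (ratr q : R) (k.+1%:R^-1) => a b; split; lra.
  exists q => //; exists k => //; split => //.
  exists V => //; split => // y s Vy Is; apply: U12 => /=; split; first exact: VU1.
  apply: etU2; move: Itq Is ke; rewrite /I /ball /= !ltr_norml.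
  move: (ratr q : R) (k.+1%:R^-1) => a b /andP[? ?] /andP[? ?] ?.
  by apply/andP; split; lra.
apply: bigcupT_measurable_rat => q; apply: bigcupT_measurable => k.
apply: measurableX.
- by apply: open_borel; apply: bigcup_open => V [].
- exact: measurable_ball.
Qed.

Lemma lsc_measurable_prodR (T : ptopologicalType) (f : T * R -> \bar R) :
  (forall a : R, open [set z | (a%:E < f z)%E]) ->
  measurable_fun setT (f : borel T * measurableTypeR R -> \bar R).
Proof.
move=> fo; apply: (measurability _ (ErealGenOInfty.measurableE R)).
move=> _ [_ [a ->] <-]; rewrite setTI; apply: open_measurable_prodR.
rewrite (_ : _ @^-1` _ = [set z | (a%:E < f z)%E])//.
by apply/seteqP; split => z /=; rewrite in_itv/= andbT.
Qed.

Lemma usc_measurable_prodR (T : ptopologicalType) (f : T * R -> \bar R) :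
  (forall a : R, open [set z | (f z < a%:E)%E]) ->
  measurable_fun setT (f : borel T * measurableTypeR R -> \bar R).
Proof.
move=> fo; rewrite (_ : f = \- (\- f)%E)%E; last first.
  by apply/funext => z; rewrite oppeK.
apply: measurableT_comp => //; apply: lsc_measurable_prodR => a.
rewrite (_ : [set _ | _] = [set z | (f z < (- a)%:E)%E])//.
by apply/seteqP; split => z /=; rewrite EFinN lteNr.
Qed.

Lemma continuous_prodR_measurable (T Y : ptopologicalType) (f : T * R -> Y) :
  continuous f ->
  measurable_fun setT (f : borel T * measurableTypeR R -> borel Y).
Proof.
move=> cf; apply: measurable_fun_borel => U oU.
by apply: open_measurable_prodR; move/continuousP : cf; exact.
Qed.

End borel_measurability.

(** * One-sided limits at 0 through monotone envelopes *)

Section right_limit.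
Context {R : realType}.
Local Open Scope ereal_scope.
Implicit Types (f : R -> \bar R) (r : R).

(** The envelopes at scale [r]; the interval is closed at [r] so that [f r] lies between them. *)
Definition esup_right f r := ereal_sup [set f h | h in `]0%R, r]].
Definition einf_right f r := ereal_inf [set f h | h in `]0%R, r]].

Lemma esup_right_cvg f :
  esup_right f h @[h --> 0^'+] --> ereal_inf [set esup_right f h | h in `]0%R, +oo[].
Proof.
apply: nondecreasing_at_right_cvge => // x y _ _ xy.
rewrite /esup_right; apply: ereal_sup_le => y0 [h /=]; rewrite in_itv/= => /andP[h0 hx] <-.
by exists h => //=; rewrite in_itv/= h0 (le_trans hx).
Qed.

Lemma einf_right_cvg f :
  einf_right f h @[h --> 0^'+] --> ereal_sup [set einf_right f h | h in `]0%R, +oo[].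
Proof.
apply: nonincreasing_at_right_cvge => // x y _ _ xy.
rewrite /einf_right; apply: ereal_inf_le_tmp => y0 [h /=]; rewrite in_itv/= => /andP[h0 hx] <-.
by exists h => //=; rewrite in_itv/= h0 (le_trans hx).
Qed.

Let L f := ereal_inf [set esup_right f h | h in `]0%R, +oo[].
Let l f := ereal_sup [set einf_right f h | h in `]0%R, +oo[].

(** The limits superior [L] and inferior [l] always exist, as monotone limits of the envelopes, and
    [f] converges exactly if [L f <= l f]. The test on a filter thus becomes a comparison of two
    functions, which is suited to measurability. *)
Lemma right_limitE f :
  (if `[< cvg (f h @[h --> 0^'+]) >] then lim (f h @[h --> 0^'+]) else +oo) =
  (if L f <= l f then L f else +oo).
Proof.
have bnd : \forall h \near 0^'+, einf_right f h <= f h <= esup_right f h.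
  near=> h; have h0 : (0 < h)%R by [].
  by apply/andP; split; [apply: ereal_inf_lbound|apply: ereal_sup_ubound];
    exists h => //=; rewrite in_itv/= h0 lexx.
have lL : l f <= L f.
  apply: (lee_cvg_to (@einf_right_cvg f) (@esup_right_cvg f)).
  by apply: filterS bnd => h /andP[]; exact: le_trans.
case: (boolP (L f <= l f)) => [Ll|].
  have fL : f h @[h --> 0^'+] --> L f.
    apply: (squeeze_cvge bnd); last exact: esup_right_cvg.
    have -> : L f = l f by apply/le_anti; rewrite Ll lL.
    exact: einf_right_cvg.
  case: asboolP => [_|[]]; first exact/cvg_lim.
  by apply/cvg_ex; exists (L f).
rewrite -ltNge => ltlL.
case: asboolP => // /cvg_ex[c fc]; exfalso; move: ltlL; apply/negP; rewrite -leNgt.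
apply: (@le_trans _ _ c).
  have fb (b : R) : c < b%:E -> L f <= b%:E.
    move=> cb; have [r /= r0 fr] : \forall h \near 0^'+, f h < b%:E.
      apply: (fc [set y | y < b%:E]); apply: open_nbhs_nbhs.
      by split => //; exact: open_ereal_lt_ereal.
    apply: (@le_trans _ _ (esup_right f (r / 2))).
      by apply: ereal_inf_lbound; exists (r / 2)%R => //=; rewrite in_itv/= divr_gt0.
    apply: ge_ereal_sup => y0 [h /=]; rewrite in_itv/= => /andP[h0 hr] <-.
    apply: ltW; apply: fr => //=; rewrite sub0r normrN gtr0_norm//.
    by rewrite (le_lt_trans hr)// ltr_pdivrMr// ltr_pMr// ltr1n.
  case: c fc fb => [c|_ _|_ fb]; [move=> _ fb|exact: leey|].
    by apply/lee_addgt0Pr => e e0; apply: fb; rewrite lte_fin ltrDl.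
  case: (L f) fb => [s|/(_ 0%R (ltNyr _))|_]//= /(_ (s - 1)%R (ltNyr _)).
  by rewrite lee_fin lerBrDr gerDl ler10.
have fb (b : R) : b%:E < c -> b%:E <= l f.
  move=> cb; have [r /= r0 fr] : \forall h \near 0^'+, b%:E < f h.
    apply: (fc [set y | b%:E < y]); apply: open_nbhs_nbhs.
    by split => //; exact: open_ereal_gt_ereal.
  apply: (@le_trans _ _ (einf_right f (r / 2))); last first.
    by apply: ereal_sup_ubound; exists (r / 2)%R => //=; rewrite in_itv/= divr_gt0.
  apply: le_ereal_inf_tmp => y0 [h /=]; rewrite in_itv/= => /andP[h0 hr] <-.
  apply: ltW; apply: fr => //=; rewrite sub0r normrN gtr0_norm//.
  by rewrite (le_lt_trans hr)// ltr_pdivrMr// ltr_pMr// ltr1n.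
case: c fc fb => [c|_ fb|_ _]; [move=> _ fb|idtac|exact: leNye].
  by apply/lee_subgt0Pr => e e0; apply: fb; rewrite lte_fin ltrBlDr ltrDl.
by rewrite leye_eq; apply/eqP/eqyP => b _; apply: fb; rewrite ltry.
Unshelve. all: by end_near. Qed.

End right_limit.

(** * Continuity of the evaluation of curves *)

Section curve_continuity.
Context {R : realType} {X : completeMetricType R}.
Import metricType_numDomainType.
Implicit Types g h : curve X.

Lemma mdist_cvg (T : Type) (F : set_system T) (FF : Filter F) (f g : T -> X) a b :
  f x @[x --> F] --> a -> g x @[x --> F] --> b ->
  mdist (f x) (g x) @[x --> F] --> mdist a b.
Proof.
move=> /cvgrPdist_lt fa /cvgrPdist_lt gb.
apply/pseudometric_normed_Zmodule.cvgrPdist_lt => e e0.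
have e2 : 0 < e / 2 by rewrite divr_gt0.
near=> t.
have ft : mdist a (f t) < e / 2 by near: t; exact: fa.
have gt : mdist b (g t) < e / 2 by near: t; exact: gb.
have := metric_triangle a (f t) b; have := metric_triangle (f t) (g t) b.
have := metric_triangle (f t) a (g t); have := metric_triangle a b (g t).
rewrite (metric_sym (f t) a) (metric_sym (g t) b) ltr_norml.
move: (mdist _ _) (mdist _ _) (mdist _ _) (mdist _ _) ft gt => *.
lra.
Unshelve. all: by end_near. Qed.

Lemma clamp01_continuous : continuous (@clamp01 R).
Proof.
apply: continuous_comp_initial => t.
have -> : set_val \o clamp01 = (cst 0 \max (id \min cst 1)) :> (R -> R).
  by apply/funext => s /=; rewrite set_valE.
apply: continuous_max; first exact: cst_continuous.
by apply: continuous_min; [exact: cvg_id|exact: cst_continuous].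
Qed.

Lemma curve_at_mdist t g h : mdist (curve_at t g) (curve_at t h) <= mdist g h.
Proof. by apply: ub_le_sup; [exact: sup_dist_has_ubound|exists (clamp01 t)]. Qed.

Lemma curve_at_continuous1 g : continuous (fun t => curve_at t g).
Proof.
move=> t; apply: (@continuous_comp _ _ _ (@clamp01 R) g).
  exact: clamp01_continuous.
exact: curve_cont.
Qed.

(** The sup distance controls all times at once, so that continuity in time is used for the one
    curve [g] only. *)
Lemma curve_at_continuous :
  continuous (fun z : curve X * R => curve_at z.2 z.1).
Proof.
move=> [g t]; apply/cvgrPdist_lt => e e0 /=.
have e2 : 0 < e / 2 by rewrite divr_gt0.
have [d /= d0 gd] : \forall s \near t, mdist (curve_at t g) (curve_at s g) < e / 2.
  exact: (cvgr_dist_lt (@curve_at_continuous1 g t) e2).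
exists (ball g (e / 2), ball t d) => /=.
  by split; exact: nbhsx_ballx.
move=> [h s] /= [gh ts]; rewrite ballEmdist/= in gh.
rewrite (le_lt_trans (metric_triangle _ (curve_at s g) _))//.
rewrite [e]splitr ltrD//; first exact: gd.
by rewrite (le_lt_trans (curve_at_mdist _ _ _)).
Qed.

End curve_continuity.

(** Measurability passes to limits of sequences; this replaces the one-sided limit by one. *)
Lemma cvg_at_right_harmonic (R : realType) (T : topologicalType) (u : R -> T) (l : T) :
  u h @[h --> 0^'+] --> l -> u n.+1%:R^-1 @[n --> \oo] --> l.
Proof.
move=> ul; apply: (@cvg_comp _ _ _ (fun n : nat => n.+1%:R^-1) u _ _ _ _ ul).
move=> A [e /= e0 eA]; near=> n; apply: eA => /=; last by rewrite invr_gt0.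
rewrite sub0r normrN gtr0_norm ?invr_gt0//.
by near: n; exact: near_infty_natSinv_lt (PosNum e0).
Unshelve. all: by end_near. Qed.

Section metric_speed_measurability.
Context {R : realType} {X : completeMetricType R}.
Implicit Types g : curve X.

Definition speed_ratio g t h : \bar R :=
  (mdist (curve_at (t + h) g) (curve_at t g) / h)%:E.

Definition upper_speed g t : \bar R :=
  ereal_inf [set esup_right (speed_ratio g t) h | h in `]0%R, +oo[].

Definition lower_speed g t : \bar R :=
  ereal_sup [set einf_right (speed_ratio g t) h | h in `]0%R, +oo[].

Lemma metric_speedE g t : metric_speed g t =
  if (upper_speed g t <= lower_speed g t)%E then upper_speed g t else +oo%E.
Proof. by rewrite -right_limitE. Qed.

Let f (z : curve X * R) := speed_ratio z.1 z.2.

Let f_continuous h :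
  continuous (fun z : curve X * R => mdist (curve_at (z.2 + h) z.1) (curve_at z.2 z.1) / h).
Proof.
move=> z; apply: cvgM; last exact: cvg_cst.
apply: mdist_cvg; last exact: curve_at_continuous.
apply: (@continuous_comp _ _ _ (fun z : curve X * R => (z.1, z.2 + h))
  (fun z => curve_at z.2 z.1)); last exact: curve_at_continuous.
have c1 : (fun y : curve X * R => y.1) @ z --> z.1 by exact: cvg_fst.
have c2 : (fun y : curve X * R => y.2 + h) @ z --> z.2 + h.
  by apply: cvgD; [exact: cvg_snd|exact: cvg_cst].
exact: (cvg_pair c1 c2).
Qed.

(** An uncountable supremum of continuous functions is lower semicontinuous, hence measurable;
    dually, the infimum below is upper semicontinuous. *)
Let measurable_esup r : measurable_fun setT
  ((fun z => esup_right (f z) r) : borel (curve X) * measurableTypeR R -> \bar R).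
Proof.
apply: lsc_measurable_prodR => a.
rewrite (_ : [set _ | _] = \bigcup_(h in `]0, r]) [set z | (a%:E < f z h)%E]).
  apply: bigcup_open => h _.
  exact: (open_comp (fun z _ => @f_continuous h z) (@open_gt R a)).
apply/seteqP; split=> [z /= /ereal_sup_gt[_ [h hr <-] ah]|z [h hr ah]].
  by exists h.
by apply: (lt_le_trans ah); apply: ereal_sup_ubound; exists h.
Qed.

Let measurable_einf r : measurable_fun setT
  ((fun z => einf_right (f z) r) : borel (curve X) * measurableTypeR R -> \bar R).
Proof.
apply: usc_measurable_prodR => a.
rewrite (_ : [set _ | _] = \bigcup_(h in `]0, r]) [set z | (f z h < a%:E)%E]).
  apply: bigcup_open => h _.
  exact: (open_comp (fun z _ => @f_continuous h z) (@open_lt R a)).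
apply/seteqP; split=> [z /= /ereal_inf_lt[_ [h hr <-] ah]|z [h hr ah]].
  by exists h.
by apply: le_lt_trans ah; apply: ereal_inf_lbound; exists h.
Qed.

Lemma measurable_upper_speed : measurable_fun setT
  (fun z : borel (curve X) * measurableTypeR R => upper_speed (z.1 : curve X) z.2).
Proof.
apply: (emeasurable_fun_cvg (fun n (z : borel (curve X) * measurableTypeR R) =>
    esup_right (f z) n.+1%:R^-1)).
  by move=> n; exact: measurable_esup.
by move=> z _; apply: cvg_at_right_harmonic; exact: esup_right_cvg.
Qed.

Lemma measurable_lower_speed : measurable_fun setT
  (fun z : borel (curve X) * measurableTypeR R => lower_speed (z.1 : curve X) z.2).
Proof.
apply: (emeasurable_fun_cvg (fun n (z : borel (curve X) * measurableTypeR R) =>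
    einf_right (f z) n.+1%:R^-1)).
  by move=> n; exact: measurable_einf.
by move=> z _; apply: cvg_at_right_harmonic; exact: einf_right_cvg.
Qed.

Lemma measurable_metric_speed : measurable_fun setT
  (fun z : borel (curve X) * measurableTypeR R => metric_speed (z.1 : curve X) z.2).
Proof.
under eq_fun do rewrite metric_speedE.
apply: measurable_fun_ifT => //; last exact: measurable_upper_speed.
by apply: measurable_fun_lee; [exact: measurable_upper_speed|
  exact: measurable_lower_speed].
Qed.

Lemma metric_speed_near g g' t :
  (\forall h \near 0^'+, mdist (curve_at (t + h) g) (curve_at t g) =
     mdist (curve_at (t + h) g') (curve_at t g')) ->
  metric_speed g t = metric_speed g' t.
Proof.
move=> gg'; pose F g : set_system \bar R :=
  (mdist (curve_at (t + h) g) (curve_at t g) / h)%:E @[h --> 0^'+].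
rewrite /metric_speed -/(F g) -/(F g'); suff -> : F g = F g' by [].
by apply/seteqP; split => A; apply: filterS2 gg' => h /= ->.
Qed.

Lemma metric_speed_ge0 g t : (0 <= metric_speed g t)%E.
Proof.
rewrite /metric_speed; case: asboolP => [cg|_]; last exact: leey.
apply: lime_ge => //; near=> h; rewrite lee_fin divr_ge0// mdist_ge0//.
Unshelve. all: by end_near. Qed.

End metric_speed_measurability.

(** * Metric speed of Lipschitz curves *)

Section metric_derivative.
Context {R : realType}.
Import metricType_numDomainType.

Lemma derivable_right_quotient (F : R -> R) x : derivable F x 1 ->
  (F (x + h) - F x) / h @[h --> 0^'+] --> F^`()%classic x.
Proof.
move=> dF.
have -> : (fun h => (F (x + h) - F x) / h) =
    (fun h => h^-1 *: ((F \o shift x) (h *: 1) - F x)).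
  by apply/funext => h; rewrite /= [_ *: 1]mulr1 [_ *: _]mulrC [h + x]addrC.
by apply: cvg_dnbhs_at_right; rewrite derive1E; exact: dF.
Qed.

(** Real induction: the set [A] of points reached with the bound contains its supremum, by
    continuity of [c] and monotonicity of [G], and [step] would lead beyond a supremum smaller than
    [e]. *)
Lemma mdist_le_induction (X : metricType R) (c : R -> X) (G : R -> R) (s e : R) :
  s <= e -> continuous c -> (forall x y, s <= x -> x <= y -> G x <= G y) ->
  (forall x, s <= x -> x < e ->
    exists y, [/\ x < y, y <= e & mdist (c x) (c y) <= G y - G x]) ->
  mdist (c s) (c e) <= G e - G s.
Proof.
move=> se cc Gnd step.
pose A := [set x | [/\ s <= x, x <= e & mdist (c s) (c x) <= G x - G s]].
have As : A s by split=> //; rewrite mdistxx subrr.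
have Aub : ubound A e by move=> x [].
have Asup : has_sup A by split; [exists s|exists e].
have ss : s <= sup A by exact: ub_le_sup Asup.2 _ As.
have sue : sup A <= e by apply: ge_sup => //; exists s.
have AS : A (sup A).
  split => //; apply/ler_addgt0Pl => r r0.
  have [d /= d0 cd] : \forall x \near sup A, mdist (c (sup A)) (c x) < r.
    exact: (cvgr_dist_lt (cc (sup A)) r0).
  have [x [sx xe cx] dx] := sup_adherent d0 Asup.
  have xS : x <= sup A by exact: ub_le_sup Asup.2 _ (And3 sx xe cx).
  rewrite (le_trans (metric_triangle _ (c x) _))// addrC lerD//.
    rewrite metric_sym ltW//; apply: cd => /=.
    by rewrite ger0_norm ?subr_ge0// ltrBlDr -ltrBlDl.
  by rewrite (le_trans cx)// lerD2r Gnd.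
have [Se|eS] := ltP (sup A) e; last first.
  by have -> : e = sup A by [apply/le_anti; rewrite sue eS]; case: AS.
have [y [Sy ye cy]] := step _ ss Se.
have Ay : A y.
  split=> //; first by rewrite (le_trans ss)// ltW.
  case: AS => _ _ cS; rewrite (le_trans (metric_triangle _ (c (sup A)) _))//.
  by rewrite (le_trans (lerD cS cy))// addrC subrKA.
by have := ub_le_sup Asup.2 Ay; rewrite leNgt Sy.
Qed.

End metric_derivative.

Section lipschitz_speed.
Context {R : realType} {X : completeMetricType R} (g : curve X) (c : R).
Hypothesis lip : forall s t, mdist (curve_at s g) (curve_at t g) <= c * `|s - t|.

Local Notation mu := (@lebesgue_measure R).

Let c0 : 0 <= c.
Proof. by have := le_trans (mdist_ge0 _ _) (lip 1 0); rewrite subr0 normr1 mulr1. Qed.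

Let ratio_le t h : 0 < h -> (speed_ratio g t h <= c%:E)%E.
Proof.
move=> h0; rewrite lee_fin ler_pdivrMr// (le_trans (lip _ _))//.
by rewrite addrAC subrr add0r gtr0_norm.
Qed.

Let lower_ge0 t : (0 <= lower_speed g t)%E.
Proof.
apply: (@le_trans _ _ (einf_right (speed_ratio g t) 1)); last first.
  by apply: ereal_sup_ubound; exists 1 => //=; rewrite in_itv/= ltr01.
apply: le_ereal_inf_tmp => y [h /=]; rewrite in_itv/= => /andP[h0 _] <-.
by rewrite lee_fin divr_ge0 ?mdist_ge0// ltW.
Qed.

Let lower_le t : (lower_speed g t <= c%:E)%E.
Proof.
apply: ge_ereal_sup => y [h /=]; rewrite in_itv/= andbT => h0 <-.
apply: (@le_trans _ _ (speed_ratio g t h)); last exact: ratio_le.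
by apply: ereal_inf_lbound; exists h => //=; rewrite in_itv/= h0 lexx.
Qed.

(** The lower speed exists at all times and lies between 0 and [c]. Once distances along the curve
    are bounded by its integral [F], differentiating [F] bounds the upper speed by [m] almost
    everywhere, so that the two speeds agree there. *)
Let m t := fine (lower_speed g t).

Let mE t : (m t)%:E = lower_speed g t.
Proof. by rewrite fineK// ge0_fin_numE// (le_lt_trans (lower_le t))// ltry. Qed.

Let m_ge0 t : 0 <= m t. Proof. exact: fine_ge0. Qed.

Let m_le t : m t <= c. Proof. by rewrite -lee_fin mE. Qed.

Let mm : measurable_fun setT (m : measurableTypeR R -> R).
Proof.
apply: measurableT_comp => //.
exact: (measurableT_comp measurable_lower_speed (pair1_measurable (g : borel (curve X)))).
Qed.

Let m_bounded A : [bounded m x | x in A].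
Proof.
by exists c; split; rewrite ?num_real// => r cr x _ /=; rewrite ger0_norm// (le_trans (m_le x))// ltW.
Qed.

Let m_int (A : set R) : measurable A -> (mu A < +oo)%E -> mu.-integrable A (EFin \o m).
Proof.
move=> mA Aoo; apply: measurable_bounded_integrable => //.
exact: measurable_funS mm.
Qed.

(** The lower bound -1 puts all times [x >= 0], including 0, strictly to the right of the start of
    the integral, where the fundamental theorem of calculus is available. *)
Let F x := \int[mu]_(t in `[- 1, x]) m t.

Let F_FTC : {ae mu, forall x, 0 <= x -> derivable F x 1 /\ F^`()%classic x = m x}.
Proof.
have i1 y : mu.-integrable [set` Interval (BLeft (- 1)) (BRight y)] (EFin \o m).
  by apply: m_int => //; rewrite lebesgue_measure_itv/=; case: ifPn; rewrite ltry.
have i2 : locally_integrable [set: R] m.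
  split; [exact: mm|exact: openT|move=> K _ cK].
  have mK := compact_measurable cK.
  have /integrableP[_] := m_int mK (compact_finite_measure cK).
  by rewrite /=.
have := @FTC1 R m (BLeft (- 1)) i1 i2.
apply: filterS; first exact: (ae_filter_ringOfSetsType mu).
by move=> x + x0; apply; rewrite lte_fin (lt_le_trans _ x0)// ltrN10.
Qed.

Let F_nd x y : 0 <= x -> x <= y -> F x <= F y.
Proof.
move=> x0 xy; rewrite /F /Rintegral fine_le//.
- apply: integrable_fin_num => //; apply: m_int => //.
  by rewrite lebesgue_measure_itv/=; case: ifPn; rewrite ltry.
- apply: integrable_fin_num => //; apply: m_int => //.
  by rewrite lebesgue_measure_itv/=; case: ifPn; rewrite ltry.
apply: ge0_subset_integral => //=.
- by apply/measurable_EFinP; exact: measurable_funS mm.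
- by move=> z _; rewrite lee_fin.
- by apply: subset_itvl; rewrite bnd_simp.
Qed.

(* F has derivative m outside of a null set N, where F grows at least as fast as
   the curve along a sequence of times. On N the Lipschitz bound is used instead,
   and its contribution is bounded by the measure V of a small open set U around N. *)
Let mdist_le_F s e : 0 <= s -> s <= e ->
  mdist (curve_at s g) (curve_at e g) <= F e - F s.
Proof.
move=> s0 se; apply/ler_addgt0Pr => r r0.
(* The total error will be at most [2 * d * (e - s) + c * d]; the summand 1 keeps the denominator
   positive. *)
pose d := r / (2 * (e - s) + c + 1).
have k0 : 0 < 2 * (e - s) + c + 1.
  by rewrite ltr_pwDr// addr_ge0// mulr_ge0// subr_ge0.
have d0 : 0 < d by rewrite divr_gt0.
have [N [mN N0 NF]] := F_FTC.
have N0y : (mu N < +oo)%E by rewrite N0.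
have [U [oU NU UNd]] := lebesgue_regularity_outer mN N0y d0.
have mU : measurable (U : set (measurableTypeR R)) by exact: open_measurable.
have Ud : (mu U <= d%:E)%E.
  rewrite (le_trans _ (ltW UNd))// -[leRHS]adde0 -[X in (_ <= _ + X)%E]N0.
  apply: (@le_trans _ _ (mu ((U `\` N) `|` N))).
    rewrite le_measure ?inE//; first by apply: measurableU => //; exact: measurableD.
    by move=> x Ux; have [Nx|Nx] := pselect (N x); [right|left].
  by apply: measureU2 => //; exact: measurableD.
pose W x : set (measurableTypeR R) := U `&` `[0, x]%classic.
pose V x := fine (mu (W x)).
have mV x : measurable (W x) by exact: measurableI.
have Vd x : (mu (W x) <= d%:E)%E.
  by rewrite (le_trans _ Ud)// le_measure ?inE//; exact: subIsetl.
have VE x : (V x)%:E = mu (W x).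
  by rewrite fineK// ge0_fin_numE// (le_lt_trans (Vd x))// ltry.
have Vnd x y : x <= y -> V x <= V y.
  move=> xy; rewrite -lee_fin !VE le_measure ?inE//; apply: setIS.
  by apply: subset_itvl; rewrite bnd_simp.
(* The slope [2 * d] pays for two approximations by [m x], that of the quotient of the curve and
   that of the quotient of [F]; the last term pays for the steps inside [U]. *)
pose G x := F x + 2 * d * x + c * V x.
have : mdist (curve_at s g) (curve_at e g) <= G e - G s.
  apply: (@mdist_le_induction _ _ (fun t => curve_at t g)) => //.
  - exact: curve_at_continuous1.
  - move=> x y sx xy; rewrite /G !lerD//.
    + by rewrite F_nd// (le_trans s0).
    + by rewrite ler_pM2l// mulr_gt0.
    + by rewrite ler_wpM2l// Vnd.
  - move=> x sx xe; have x0 := le_trans s0 sx.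
  have [Nx|Nx] := pselect (N x).
    have [y [xy ye xyU]] : exists y, [/\ x < y, y <= e & `]x, y]%classic `<=` U].
      have [q /= q0 qU] : \forall y \near x, U y.
        by apply: open_nbhs_nbhs; split => //; exact: NU.
      exists (Num.min e (x + q / 2)); split.
      - by rewrite lt_min xe ltrDl divr_gt0.
      - by rewrite ge_min lexx.
      - move=> y /=; rewrite in_itv/= le_min => /andP[xy /andP[_ yq]].
        apply: qU => /=; rewrite distrC gtr0_norm ?subr_gt0//.
        by rewrite ltrBlDl (le_lt_trans yq)// ltrD2l ltr_pdivrMr// ltr_pMr// ltr1n.
    exists y; split => //.
    (* All times after [x] up to [y] lie in [U], so that [V] grows by the full length of the step,
       which covers the Lipschitz bound. *)
    have VV : V x + (y - x) <= V y.
      rewrite -lee_fin EFinD !VE.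
      have -> : (y - x)%:E = mu `]x, y] by rewrite lebesgue_measure_itv/= lte_fin xy.
      rewrite -measureU//; last first.
        apply/seteqP; split => z //=; rewrite !in_itv/= => -[[_ /andP[_ zx]]].
        by rewrite bnd_simp in zx; rewrite ltNge zx.
      rewrite le_measure ?inE//; first exact: measurableU.
      move=> z /= [[Uz]|xyz].
        rewrite /W /= !in_itv/= => /andP[z0 zx]; split=> //.
        by rewrite z0 (le_trans zx)// ltW.
      split; first exact: xyU.
      move: xyz; rewrite /= !in_itv/= => /andP[xz ->].
      by rewrite (le_trans x0)// ltW.
    rewrite (le_trans (lip _ _))// distrC gtr0_norm ?subr_gt0//.
    have Fxy := F_nd x0 (ltW xy).
    have cV := ler_wpM2l c0 VV.
    have dxy : 2 * d * x <= 2 * d * y by rewrite ler_wpM2l ?(ltW xy)// mulr_ge0// ltW.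
    rewrite /G; move: Fxy cV dxy; rewrite mulrDr.
    by move: (c * (y - x)) (c * V x) (c * V y) (2 * d * x) (2 * d * y) (F x) (F y) => *; lra.
  have [dF F'] : derivable F x 1 /\ F^`()%classic x = m x.
    by apply: contrapT => H; apply: Nx; apply: NF => /= /(_ x0).
  have Fr := derivable_right_quotient dF.
  have [q /= q0 qF] : \forall h \near 0^'+, `|F^`()%classic x - (F (x + h) - F x) / h| < d.
    by move/cvgrPdist_lt : Fr; apply.
  pose r1 := Num.min (q / 2) (e - x).
  have r10 : 0 < r1 by rewrite lt_min divr_gt0//= subr_gt0.
  (* As [m x] is a supremum of lower envelopes, some time within [r1] has a difference quotient
     below [m x + d]; [r1] keeps it in the range of [qF] and the step below [e]. *)
  have : (einf_right (speed_ratio g x) r1 < (m x + d)%:E)%E.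
    apply: (@le_lt_trans _ _ (m x)%:E); last by rewrite lte_fin ltrDl.
    by rewrite mE; apply: ereal_sup_ubound; exists r1 => //=; rewrite in_itv/= r10.
  move=> /ereal_inf_lt[z [h /=]]; rewrite in_itv/= => /andP[h0 hr] <-.
  rewrite lte_fin ltr_pdivrMr// => hd.
  move: hr; rewrite le_min => /andP[hq he].
  exists (x + h); split; [by rewrite ltrDl|by rewrite -lerBrDl|].
  have /qF : `|0 - h| < q.
    rewrite sub0r normrN gtr0_norm//.
    by rewrite (le_lt_trans hq)// ltr_pdivrMr// ltr_pMr// ltr1n.
  move=> /(_ h0); rewrite F' ltr_distlC => /andP[+ _].
  rewrite ltr_pdivlMr// => Fh.
  have cV : c * V x <= c * V (x + h) by rewrite ler_wpM2l// Vnd// lerDl ltW.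
  rewrite metric_sym /G mulrDr; move: cV hd Fh; rewrite mulrDl mulrBl.
  move: (mdist _ _) (m x * h) (c * V x) (c * V (x + h)) (2 * d * x) (F x) (F (x + h)).
  by move=> *; lra.
move=> /le_trans; apply.
have -> : r = d * (2 * (e - s) + c + 1) by rewrite divfK// gt_eqF.
have : c * V e <= c * d by rewrite ler_wpM2l// -lee_fin VE.
have : 0 <= c * V s by rewrite mulr_ge0// fine_ge0.
rewrite /G; move: (c * V e) (c * V s) => ? ?; nra.
Qed.

(* This includes the existence of the limit, since the metric speed is +oo where
   the difference quotient diverges. *)
Lemma lipschitz_metric_speed_le :
  {ae mu, forall t, 0 <= t -> (metric_speed g t <= c%:E)%E}.
Proof.
have := F_FTC; apply: filterS; first exact: (ae_filter_ringOfSetsType mu).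
move=> t H t0; have [dF F't] := H t0; rewrite metric_speedE.
suff ut : (upper_speed g t <= lower_speed g t)%E.
  by rewrite ut (le_trans ut).
have Fr := derivable_right_quotient dF.
rewrite -mE; apply/lee_addgt0Pr => r r0.
have [q /= q0 qF] : \forall h \near 0^'+, `|F^`()%classic t - (F (t + h) - F t) / h| < r.
  by move/cvgrPdist_lt : Fr; apply.
(* By [mdist_le_F], each difference quotient of the curve is at most that of [F], which is below
   [m t + r] at this scale. *)
apply: (@le_trans _ _ (esup_right (speed_ratio g t) (q / 2))).
  by apply: ereal_inf_lbound; exists (q / 2) => //=; rewrite in_itv/= divr_gt0.
apply: ge_ereal_sup => y [h /=]; rewrite in_itv/= => /andP[h0 hq] <-.
have /qF : `|0 - h| < q.
  rewrite sub0r normrN gtr0_norm//.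
  by rewrite (le_lt_trans hq)// ltr_pdivrMr// ltr_pMr// ltr1n.
move=> /(_ h0); rewrite F't ltr_distlC => /andP[_ Fr'].
rewrite lee_fin (le_trans _ (ltW Fr'))// ler_wpM2r ?invr_ge0 ?(ltW h0)//.
by rewrite metric_sym mdist_le_F// lerDl ltW.
Qed.

End lipschitz_speed.

(** * Restriction of test plans *)

Section lower_integral.
Import HBNNSimple.
Local Open Scope ereal_scope.

(* The integral of a nonnegative function is a supremum over simple functions, so
   that these bounds do not need any measurability. *)
Lemma ge0_le_integralT d (T : measurableType d) (R : realType)
    (mu : {measure set T -> \bar R}) (f g : T -> \bar R) :
  (forall x, 0 <= f x) -> (forall x, f x <= g x) ->
  \int[mu]_x f x <= \int[mu]_x g x.
Proof.
move=> f0 fg; have g0 x : 0 <= g x by exact: le_trans (fg x).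
rewrite !ge0_integralTE//; apply: ereal_sup_le => _ [h hf <-].
by exists h => // x; exact: le_trans (fg x).
Qed.

(** A simple function below [f] pulls back to one below the composite, whereas a simple function
    below the composite need not factor through [X]. This is used for the kinetic energy, whose
    measurability is not established. *)
Lemma le_integral_distribution d d' (T : measurableType d)
    (T' : measurableType d') (R : realType) (P : probability T R)
    (X : {mfun T >-> T'}) (f : T' -> \bar R) : (forall x, 0 <= f x) ->
  \int[distribution P X]_x f x <= \int[P]_x f (X x).
Proof.
move=> f0; rewrite [leLHS]ge0_integralTE//; apply: ge_ereal_sup => _ [h hf <-].
rewrite -integralT_nnsfun ge0_integral_distribution//; last 2 first.
- exact/measurable_EFinP.
- by move=> x; rewrite lee_fin.
by apply: ge0_le_integralT => x /=; [rewrite lee_fin|exact: hf].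
Qed.

End lower_integral.

Section unit_interval.
Context {R : realType}.

Let leb01_fin : fin_num_fun (@leb01 R).
Proof.
move=> A mA; rewrite ge0_fin_numE//.
apply: (@le_lt_trans _ _ (lebesgue_measure (unit_itv R))).
  have mI := @measurable_unit_itv R.
  by apply: le_measure; rewrite ?inE//=; exact: measurableI.
by rewrite lebesgue_measure_itv/=; case: ifPn; rewrite ltry.
Qed.

(** A named copy to carry the structure of a finite measure, through which the Fubini-Tonelli
    theorem and the product measure are applied. *)
Definition leb01_finite : set (measurableTypeR R) -> \bar R := @leb01 R.
HB.instance Definition _ := Measure.copy leb01_finite (@leb01 R).
HB.instance Definition _ := Measure_isFinite.Build _ _ _ leb01_finite leb01_fin.

End unit_interval.

(** * Curves stopped outside of a time interval *)

Section stop_curve.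
Context {R : realType} {X : completeMetricType R}.
Implicit Types (g h : curve X) (s t r : R).

Definition stop_time s t r := Num.max s (Num.min r t).

Lemma stop_time_continuous s t : continuous (stop_time s t).
Proof.
move=> r; apply: (@continuous_max _ _ (cst s) (id \min cst t)); first exact: cst_continuous.
by apply: continuous_min; [exact: cvg_id|exact: cst_continuous].
Qed.

Let stop_fun s t g (r : unit_itv R) : X := curve_at (stop_time s t (set_val r)) g.

Let stop_fun_continuous s t g : continuous (stop_fun s t g).
Proof.
move=> r; apply: (@continuous_comp _ _ _ (fun r : unit_itv R => stop_time s t (set_val r))
  (fun u => curve_at u g)); last exact: curve_at_continuous1.
apply: (@continuous_comp _ _ _ (set_val : unit_itv R -> R)); last exact: stop_time_continuous.
exact: initial_continuous.
Qed.

Definition stop_curve s t g : curve X :=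
  [the continuousType _ _ of mkcts (@stop_fun_continuous s t g)].

Lemma curve_at_stop s t r g : 0 <= s -> s <= t -> t <= 1 ->
  curve_at r (stop_curve s t g) = curve_at (stop_time s t r) g.
Proof.
move=> s0 st t1; rewrite {1}/curve_at /= /stop_fun; congr (curve_at _ g).
rewrite set_valE /= /stop_time.
have [r0|r0] := leP r 0.
  rewrite (min_l (le_trans r0 ler01)) (max_l r0) (min_l (le_trans s0 st)) (max_l s0).
  by rewrite (min_l (le_trans r0 (le_trans s0 st))) (max_l (le_trans r0 s0)).
have [r1|r1] := leP r 1; first by rewrite (max_r (ltW r0)).
by rewrite (max_r ler01) (min_r t1) (min_r (le_trans t1 (ltW r1))).
Qed.

Lemma mdist_stop_curve s t g h :
  mdist (stop_curve s t g) (stop_curve s t h) <= mdist g h.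
Proof.
apply: ge_sup; last by move=> _ [r _ <-]; exact: curve_at_mdist.
by exists (mdist (stop_curve s t g (clamp01 0)) (stop_curve s t h (clamp01 0))), (clamp01 0).
Qed.

Lemma stop_curve_continuous s t : continuous (stop_curve s t).
Proof.
move=> g.
apply/(@metricType_numDomainType.cvgrPdist_lt _ _ _ (nbhs g) (nbhs_filter g)) => e e0.
near=> h; rewrite (le_lt_trans (mdist_stop_curve _ _ _ _))//.
near: h; have := nbhsx_ballx g e e0.
by rewrite ballEmdist.
Unshelve. all: by end_near. Qed.

Lemma metric_speed_near0 g r :
  (\forall h \near 0^'+, curve_at (r + h) g = curve_at r g) ->
  metric_speed g r = 0%E.
Proof.
move=> gr.
have dq0 : (mdist (curve_at (r + h) g) (curve_at r g) / h)%:E @[h --> 0^'+] --> 0%E.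
  by apply: cvg_near_cst; near=> h; rewrite (near gr) ?mdistxx ?mul0r.
rewrite /metric_speed; case: asboolP => [_|[]]; first exact/cvg_lim.
by apply/cvg_ex; exists 0%E.
Unshelve. all: by end_near. Qed.

(** The interval is half-open because the speed is a right derivative: at [s] the stopped curve is
    already moving, at [t] it is constant to the right. *)
Lemma metric_speed_stop s t r g : 0 <= s -> s <= t -> t <= 1 ->
  metric_speed (stop_curve s t g) r =
  if r \in `[s, t[ then metric_speed g r else 0%E.
Proof.
move=> s0 st t1; case: ifPn; rewrite in_itv/=.
  move=> /andP[sr rt]; apply: metric_speed_near; near=> h.
  rewrite !curve_at_stop// /stop_time; rewrite (min_l (ltW rt)) (max_r sr).
  have rht : r + h <= t.
    rewrite -lerBrDl; near: h; apply: nbhs_right_le; by rewrite subr_gt0.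
  by rewrite (min_l rht) max_r// (le_trans sr)// lerDl.
rewrite negb_and -!ltNge -leNgt => /orP[rs|tr]; apply: metric_speed_near0; near=> h.
  have rhs : r + h <= s.
    by rewrite -lerBrDl; near: h; apply: nbhs_right_le; rewrite subr_gt0.
  rewrite !curve_at_stop// /stop_time (min_l (le_trans rhs st)) (max_l rhs).
  by rewrite (min_l (le_trans (ltW rs) st)) (max_l (ltW rs)).
rewrite !curve_at_stop// /stop_time (min_r tr) min_r//.
by rewrite (le_trans tr)// lerDl ltW.
Unshelve. all: by end_near. Qed.

Lemma metric_speed_stop_le s t r g : 0 <= s -> s <= t -> t <= 1 ->
  (metric_speed (stop_curve s t g) r <= metric_speed g r)%E.
Proof.
move=> s0 st t1; rewrite metric_speed_stop//.
by case: ifP => // _; exact: metric_speed_ge0.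
Qed.

Lemma stop_time_homo s t a b : s <= t -> a <= b ->
  [/\ s <= stop_time s t a, stop_time s t a <= stop_time s t b &
    stop_time s t b <= t].
Proof.
move=> st ab; rewrite /stop_time; split; first by rewrite le_max lexx.
  by case: (leP a t) => ?; case: (leP b t) => ?; case: (leP s a) => ?;
    case: (leP s b) => ?; case: (leP s t) => ?; lra.
by rewrite ge_max st ge_min lexx orbT.
Qed.

Lemma stop_time_dist s t a b : s <= t ->
  `|stop_time s t a - stop_time s t b| <= `|a - b|.
Proof.
move=> st; wlog ab : a b / a <= b => [H|].
  have [|/ltW] := leP a b; first exact: H.
  by rewrite distrC (distrC a); exact: H.
rewrite ler0_norm ?subr_le0; last by case: (stop_time_homo st ab).
rewrite ler0_norm ?subr_le0// /stop_time.
by case: (leP a t) => ?; case: (leP b t) => ?; case: (leP s a) => ?;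
    case: (leP s b) => ?; case: (leP s t) => ?; lra.
Qed.

(** The density [v] may be negative, so its integral need not grow with the interval; its absolute
    value is a density for the stopped curve. *)
Lemma ac_curve_stop (q : R) s t g : 1 < q -> 0 <= s -> s <= t -> t <= 1 ->
  ac_curve q%:E g -> ac_curve q%:E (stop_curve s t g).
Proof.
move=> q1 s0 st t1 [v vq gv].
pose w r := `|v r|.
have wq : w \in Lfun leb01 q%:E.
  move: vq; rewrite !inE => /andP[/[!inE]/= mv fv]; apply/andP; split; rewrite inE/=.
    exact: measurableT_comp.
  by move: fv; rewrite /finite_norm -Lnorm_abse.
have wi : leb01.-integrable setT (EFin \o w).
  apply/Lfun1_integrable; apply: (@Lfun_subset _ _ _ leb01 1 q%:E) => //.
  - by rewrite lee_fin ltW.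
  - exact: (fin_num_measure leb01_finite).
  - by rewrite lee_fin ltW.
have vi : leb01.-integrable setT (EFin \o v).
  move: vq; rewrite inE => /andP[/[!inE]/= mv _].
  by apply: le_integrable wi => //; [exact/measurable_EFinP|move=> x _/=; rewrite normr_id].
exists w => // a b a0 ab b1; rewrite !curve_at_stop//.
have [sa ab' bt] := stop_time_homo st (ltW ab).
have wi' (A : set (measurableTypeR R)) : measurable A ->
    leb01.-integrable A (EFin \o w).
  by move=> mA; exact: integrableS wi.
move: ab'; rewrite le_eqVlt => /predU1P[->|ab'].
  rewrite mdistxx; apply: fine_ge0; apply: integral_ge0 => x _.
  by rewrite lee_fin normr_ge0.
have aa : a <= stop_time s t a.
  have := lt_le_trans ab' bt; rewrite /stop_time gt_max => /andP[_].
  by case: (leP a t) => [_ _|]; rewrite ?le_max ?lexx ?orbT// ltxx.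
have bb : stop_time s t b <= b.
  have := le_lt_trans sa ab'; rewrite /stop_time lt_max ltxx/= => sb.
  by rewrite (max_r (ltW sb)) ge_min lexx.
rewrite (le_trans (gv _ _ _ ab' _))//; [by rewrite (le_trans s0)|by rewrite (le_trans bt)|].
have sub : `[stop_time s t a, stop_time s t b] `<=` `[a, b].
  by apply: subset_itv; rewrite bnd_simp.
apply: (@le_trans _ _ (\int[leb01]_(r in `[stop_time s t a, stop_time s t b]) w r)).
  apply: le_Rintegral => //; [exact: integrableS vi|exact: wi'|].
  by move=> r _; exact: ler_norm.
rewrite /Rintegral fine_le//.
- by apply: integrable_fin_num => //; exact: wi'.
- by apply: integrable_fin_num => //; exact: wi'.
- apply: ge0_subset_integral => //=.
  + by have /integrableP[] := wi' `[a, b]%classic (measurable_itv _).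
  + by move=> x _; rewrite lee_fin normr_ge0.
Qed.

Lemma kinetic_energy_ge0 (q : R) g : (0 <= kinetic_energy q g)%E.
Proof.
rewrite /kinetic_energy; case: ifP => _; last exact: leey.
by apply: integral_ge0 => r _; exact: poweR_ge0.
Qed.

Lemma kinetic_energy_stop (q : R) s t g : 1 < q -> 0 <= s -> s <= t -> t <= 1 ->
  (kinetic_energy q (stop_curve s t g) <= kinetic_energy q g)%E.
Proof.
move=> q1 s0 st t1; rewrite /kinetic_energy.
case: (asboolP (ac_curve q%:E g)) => [ag|_]; last exact: leey.
rewrite asboolT; last exact: ac_curve_stop.
apply: ge0_le_integralT => r; first exact: poweR_ge0.
apply: gt0_ler_poweR; rewrite ?in_itv/= ?metric_speed_ge0 ?leey//.
  by rewrite (le_trans _ (ltW q1)).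
exact: metric_speed_stop_le.
Qed.

End stop_curve.

(** * Lipschitz constants of curves *)

Section lip_const.
Context {R : realType} {X : completeMetricType R}.
Implicit Types (g h : curve X) (s t r : R).

Lemma lip_const_ge0 g : (0 <= lip_const g)%E.
Proof.
have n01 : clamp01 0 != clamp01 1 :> unit_itv R.
  apply/eqP => /(congr1 val); rewrite /= (min_l ler01) maxxx minxx (max_r ler01).
  by move/eqP; rewrite eq_sym oner_eq0.
apply: (@le_trans _ _ (mdist (g (clamp01 0)) (g (clamp01 1)) /
    `|val (clamp01 0) - val (clamp01 1)|)%:E).
  by rewrite lee_fin divr_ge0 ?mdist_ge0.
by apply: ereal_sup_ubound; exists (clamp01 0, clamp01 1).
Qed.

Lemma lip_const_curve_at (c : R) g : (lip_const g <= c%:E)%E ->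
  forall s t, mdist (curve_at s g) (curve_at t g) <= c * `|s - t|.
Proof.
move=> gc s t; have c0 : 0 <= c by rewrite -lee_fin (le_trans (lip_const_ge0 g)).
have [st|st] := eqVneq (clamp01 s) (clamp01 t).
  by rewrite /curve_at st mdistxx mulr_ge0.
apply: (@le_trans _ _ (c * `|val (clamp01 s) - val (clamp01 t)|)); last first.
  by rewrite ler_wpM2l// (@stop_time_dist R 0 1 s t)// ler01.
rewrite -ler_pdivrMr; last first.
  by rewrite normr_gt0 subr_eq0; apply: contra st => /eqP st; exact/eqP/val_inj.
rewrite -lee_fin (le_trans _ gc)//; apply: ereal_sup_ubound.
by exists (clamp01 s, clamp01 t).
Qed.

Lemma lip_const_stop s t g : 0 <= s -> s <= t -> t <= 1 ->
  (lip_const (stop_curve s t g) <= lip_const g)%E.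
Proof.
move=> s0 st t1; have := lip_const_ge0 g.
case E : (lip_const g) => [c| |]//= c0; last exact: leey.
apply: ge_ereal_sup => z [[a b] /= ab <-].
rewrite lee_fin ler_pdivrMr; last first.
  by rewrite normr_gt0 subr_eq0; apply: contra ab => /eqP ab; exact/eqP/val_inj.
have gc : (lip_const g <= c%:E)%E by rewrite E.
rewrite (le_trans (lip_const_curve_at gc _ _))// ler_wpM2l ?stop_time_dist//.
Qed.

Lemma Lnorm_lip_const (P : probability (borel (curve X)) R) :
  ('N[P]_+oo[@lip_const R X] = ess_sup P (@lip_const R X))%E.
Proof.
rewrite unlock /Lnorm ifT; last first.
  apply: (@lt_le_trans _ _ 1%E); first exact: lte01.
  by rewrite -(probability_setT P).
by congr ess_sup; apply/funext => g /=; rewrite gee0_abs// lip_const_ge0.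
Qed.

Lemma curve_eval_continuous (u : unit_itv R) : continuous (fun g : curve X => g u).
Proof.
move=> g; have := nbhsx_ballx g.
rewrite -[u]clamp01_val => gB.
apply/(@metricType_numDomainType.cvgrPdist_lt _ _ _ (nbhs g) (nbhs_filter g)) => e e0.
near=> h; rewrite (le_lt_trans (curve_at_mdist _ _ _))//.
by near: h; have := gB e e0; rewrite ballEmdist.
Unshelve. all: by end_near. Qed.

Lemma open_lip_const_gt (c : \bar R) : open [set g : curve X | (c < lip_const g)%E].
Proof.
rewrite (_ : [set _ | _] = \bigcup_(st in [set st : unit_itv R * unit_itv R | st.1 != st.2])
  [set g : curve X | (c < (mdist (g st.1) (g st.2) / `|val st.1 - val st.2|)%:E)%E]).
  apply: bigcup_open => -[a b] /= _.
  have cont : continuous (fun g : curve X => mdist (g a) (g b) / `|val a - val b|).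
    move=> h; have hab := mdist_cvg (nbhs_filter h) (@curve_eval_continuous a h)
      (@curve_eval_continuous b h).
    exact: (cvgM hab (cvg_cst _)).
  have oc : open [set x : R | (c < x%:E)%E].
    case: c {cont} => [c| |].
    - exact: open_gt.
    - rewrite (_ : [set _ | _] = set0); first exact: open0.
      by apply/seteqP; split => x //=; rewrite ltNge leey.
    - rewrite (_ : [set _ | _] = setT); first exact: openT.
      by apply/seteqP; split => x //= _; rewrite ltNyr.
  exact: (open_comp (fun g _ => @cont g) oc).
apply/seteqP; split=> [g /= /ereal_sup_gt[_ [st stn <-] cst]|g [st stn cst]].
  by exists st.
by apply: (lt_le_trans cst); apply: ereal_sup_ubound; exists st.
Qed.

End lip_const.

Section splice.
Context {R : realType} {X : completeMetricType R}.
Variables (B : set (borel (curve X))) (s t : R).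
Hypotheses (mB : measurable B) (s0 : 0 <= s) (st : s <= t) (t1 : t <= 1).

(* Restricts a plan to B and to the time interval [s, t] at once: outside of B the
   curve is replaced by a constant, so that no renormalization is needed. *)
Definition splice (g : borel (curve X)) : borel (curve X) :=
  if g \in B then stop_curve s t g else stop_curve s s g.

Lemma measurable_stop_curve a b : measurable_fun setT
  (fun g : borel (curve X) => stop_curve a b g : borel (curve X)).
Proof.
apply: measurable_fun_borel => U oU; apply: open_borel.
exact: (open_comp (fun g _ => @stop_curve_continuous _ _ a b g) oU).
Qed.

Lemma measurable_splice : measurable_fun setT splice.
Proof.
apply: measurable_fun_ifT; [|exact: measurable_stop_curve..].
apply: (measurable_fun_bool true) => //.
by rewrite setTI (_ : _ @^-1` _ = B)//; apply/seteqP; split=> g /=;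
  [exact: set_mem|exact: mem_set].
Qed.

Definition splice_mfun : {mfun borel (curve X) >-> borel (curve X)} :=
  mfun_Sub (mem_set measurable_splice).

Let ss : s <= s := lexx s.
Let s1 : s <= 1 := le_trans st t1.

Lemma lip_const_splice g : (lip_const (splice g : curve X) <= lip_const (g : curve X))%E.
Proof. by rewrite /splice; case: ifP => _; exact: lip_const_stop. Qed.

Lemma kinetic_energy_splice (q : R) g : 1 < q ->
  (kinetic_energy q (splice g : curve X) <= kinetic_energy q (g : curve X))%E.
Proof. by move=> q1; rewrite /splice; case: ifP => _; exact: kinetic_energy_stop. Qed.

Lemma test_plan_splice (m : {measure set (borel X) -> \bar R}) (q : \bar R)
    (P : probability (borel (curve X)) R) : (1 < q)%E ->
  test_plan m q P -> test_plan m q (distribution P splice_mfun).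
Proof.
move=> q1 [[C C0 PC] Pq]; split.
  (* At time [r] a spliced curve is where the original one is at time [a] or at time [s], so each of
     the two costs one [C]. *)
  exists (C + C); rewrite ?addr_gt0// => r A mA.
  have ev a : measurable_fun setT (fun g : borel (curve X) => curve_at a g : borel X).
    apply: measurable_fun_borel => U oU; apply: open_borel.
    exact: (open_comp (fun g _ => @curve_eval_continuous _ _ (clamp01 a) g) oU).
  have mev a : measurable [set g : borel (curve X) | A (curve_at a g)].
    by rewrite -[X in measurable X]setTI; exact: ev.
  pose a := stop_time s t (set_val r).
  rewrite EFinD ge0_muleDl ?lee_fin ?(ltW C0)//.
  apply: (@le_trans _ _ (P [set g | A (curve_at a g)] + P [set g | A (curve_at s g)])%E).
    apply: (@le_trans _ _ (P ([set g : borel (curve X) | A (curve_at a g)] `|`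
        [set g : borel (curve X) | A (curve_at s g)]))); last exact: measureU2.
    rewrite -[leLHS]/(P [set g | A ((splice g : curve X) r)]).
    apply: le_measure; rewrite ?inE.
    - have := measurable_splice measurableT (mev (set_val r)); rewrite setTI.
      by congr (measurable _); apply/funext => g; rewrite /= /curve_at clamp01_val.
    - exact: measurableU.
    - move=> g /=.
      have -> : (splice g : curve X) r = curve_at (set_val r) (splice g : curve X).
        by rewrite /curve_at clamp01_val.
      rewrite /splice; case: ifP => _; rewrite curve_at_stop//; first by left.
      right; move: H; congr (A (curve_at _ g)).
      by rewrite /stop_time max_l// ge_min lexx orbT.
  by rewrite leeD//; exact: PC.
case: q q1 Pq => [q| |]// q1 Pq.
  apply: le_lt_trans Pq.
  apply: (le_trans (le_integral_distribution _ _ _)).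
    by move=> g; exact: kinetic_energy_ge0.
  apply: ge0_le_integralT => g; first exact: kinetic_energy_ge0.
  by apply: kinetic_energy_splice; rewrite -lte_fin.
move: Pq; rewrite !Lnorm_lip_const; apply: le_lt_trans; apply/ess_supP.
set c := ess_sup _ _.
have mc : measurable ([set g | (c < lip_const g)%E] : set (borel (curve X))).
  by apply: open_borel; exact: open_lip_const_gt.
(* Where the spliced curve has a constant above [c], so does the original one, and this is a null
   set. *)
exists [set g : borel (curve X) | (c < lip_const (g : curve X))%E]; split => //.
  have := ess_sup_ge P (@lip_const R X).
  rewrite -/c => /negligibleP; rewrite (_ : ~` _ = [set g | (c < lip_const g)%E]).
    move=> /(_ mc) P0; apply/eqP; rewrite eq_le measure_ge0 andbT -P0.
    rewrite -[leLHS]/(P [set g | (c < lip_const (splice g : curve X))%E]).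
    apply: le_measure; rewrite ?inE//.
      by have := measurable_splice measurableT mc; rewrite setTI.
    by move=> g /= /lt_le_trans; apply; exact: lip_const_splice.
  by apply/seteqP; split => g /=; rewrite ltNge => /negP.
by move=> g /= /negP; rewrite -ltNge.
Qed.

End splice.

(** * Integrals along test plans *)

Section plan_integrals.
Context {R : realType} {X : completeMetricType R}.
Local Notation CX := (borel (curve X)).
Local Notation RR := (measurableTypeR R).
Local Open Scope ereal_scope.
Implicit Types (G : borel X -> R).

Definition plan_density G (z : CX * RR) : \bar R :=
  (G (curve_at z.2 (z.1 : curve X)))%:E * metric_speed (z.1 : curve X) z.2.

Lemma measurable_curve_at2 :
  measurable_fun setT (fun z : CX * RR => curve_at z.2 (z.1 : curve X) : borel X).
Proof. apply: continuous_prodR_measurable; exact: curve_at_continuous. Qed.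

Lemma measurable_curve_at t :
  measurable_fun setT (fun g : CX => curve_at t (g : curve X) : borel X).
Proof.
exact: (measurableT_comp measurable_curve_at2 (pair2_measurable (t : RR))).
Qed.

Lemma measurable_plan_density G : measurable_fun setT G ->
  measurable_fun setT (plan_density G).
Proof.
move=> mG; apply: emeasurable_funM; last exact: measurable_metric_speed.
by apply/measurable_EFinP; apply: measurableT_comp mG measurable_curve_at2.
Qed.

Lemma plan_density_ge0 G z : (forall x, (0 <= G x)%R) -> 0 <= plan_density G z.
Proof. by move=> G0; rewrite mule_ge0// ?lee_fin ?metric_speed_ge0. Qed.

Lemma measurable_integral_leb01 (F : CX * RR -> \bar R) :
  measurable_fun setT F -> (forall z, 0 <= F z) ->
  measurable_fun setT (fun g => \int[leb01]_t F (g, t)).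
Proof. exact: (@measurable_fun_fubini_tonelli_F _ _ _ _ _ leb01_finite). Qed.

Lemma plan_fubini (P : probability CX R) (F : CX * RR -> \bar R) :
  measurable_fun setT F -> (forall z, 0 <= F z) ->
  \int[P]_g \int[leb01]_t F (g, t) = \int[leb01]_t \int[P]_g F (g, t).
Proof. exact: (@fubini_tonelli _ _ _ _ _ P leb01_finite). Qed.

Lemma leb01T : @leb01 R setT = 1.
Proof.
by rewrite /leb01/= /mrestr setTI lebesgue_measure_itv/= lte01 oppr0 adde0.
Qed.

Definition compressed (m : {measure set (borel X) -> \bar R}) (C : R)
    (P : probability CX R) :=
  forall (t : unit_itv R) (A : set (borel X)), measurable A ->
    pushforward P (fun g : CX => (g : curve X) t : borel X) A <= C%:E * m A.

Section compression.
Variables (m : {measure set (borel X) -> \bar R}) (C : R) (P : probability CX R).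
Hypotheses (C0 : (0 < C)%R) (PC : compressed m C P).

Lemma integral_curve_at_le (F : borel X -> \bar R) t :
  measurable_fun setT F -> (forall x, 0 <= F x) ->
  \int[P]_g F (curve_at t (g : curve X)) <= C%:E * \int[m]_x F x.
Proof.
move=> mF F0.
rewrite -[leLHS]/(\int[P]_(g in (fun g : CX => curve_at t (g : curve X) : borel X) @^-1` setT)
   (F \o (fun g : CX => curve_at t (g : curve X) : borel X)) g).
rewrite -(ge0_integral_pushforward (measurable_curve_at t))//.
have C0' : (0 <= C)%R := ltW C0.
rewrite -[C]/((NngNum C0')%:num) -ge0_integral_mscale//.
apply: ge0_le_measure_integral => //; first exact: measurable_curve_at.
by move=> ? A mA; exact: PC.
Qed.

Lemma integral2_curve_at_le (F : borel X -> \bar R) :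
  measurable_fun setT F -> (forall x, 0 <= F x) ->
  \int[P]_g \int[leb01]_t F (curve_at t (g : curve X)) <= C%:E * \int[m]_x F x.
Proof.
move=> mF F0.
rewrite (@plan_fubini P (fun z => F (curve_at z.2 (z.1 : curve X))))//; last first.
  exact: measurableT_comp mF measurable_curve_at2.
rewrite -[leRHS]mule1 -leb01T -integral_cst//.
apply: ge0_le_integral => //.
- by move=> t _; apply: integral_ge0.
- apply: (@measurable_fun_fubini_tonelli_G _ _ _ _ _ P (fun z => F (curve_at z.2 (z.1 : curve X)))) => //.
  exact: measurableT_comp mF measurable_curve_at2.
- by move=> t _; exact: integral_curve_at_le.
Qed.

Lemma ae_curve_at (N : set (borel X)) t : m.-negligible N ->
  {ae P, forall g : CX, ~ N (curve_at t (g : curve X))}.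
Proof.
move=> [A [mA A0 NA]].
exists [set g : CX | A (curve_at t (g : curve X))]; split.
- by rewrite -[X in measurable X]setTI; exact: measurable_curve_at.
- apply/eqP; rewrite eq_le measure_ge0 andbT.
  by have := PC (clamp01 t) mA; rewrite A0 mule0.
- by move=> g /= /contrapT; exact: NA.
Qed.

(** The integral over curves is taken inside: at each fixed time almost every curve avoids a given
    [m]-null set, so the comparison of [G] and [G'] holds for almost all curves at that time. *)
Lemma ae_plan_density (G G' : borel X -> R) : measurable_fun setT G ->
  measurable_fun setT G' -> (forall x, (0 <= G x)%R) -> (forall x, (0 <= G' x)%R) ->
  {ae m, forall x, (G x <= G' x)%R} ->
  \int[P]_g \int[leb01]_t plan_density G (g, t) <=
  \int[P]_g \int[leb01]_t plan_density G' (g, t).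
Proof.
move=> mG mG' G0 G'0 GG'.
have mdG := measurable_plan_density mG; have mdG' := measurable_plan_density mG'.
have dG0 z := plan_density_ge0 z G0; have dG'0 z := plan_density_ge0 z G'0.
rewrite (plan_fubini P mdG dG0) (plan_fubini P mdG' dG'0).
apply: ge0_le_integral => //.
- by move=> t _; apply: integral_ge0.
- exact: (@measurable_fun_fubini_tonelli_G _ _ _ _ _ P (plan_density G)).
- exact: (@measurable_fun_fubini_tonelli_G _ _ _ _ _ P (plan_density G')).
move=> t _; apply: ae_ge0_le_integral => //.
- exact: (measurableT_comp mdG (pair2_measurable (t : RR))).
- exact: (measurableT_comp mdG' (pair2_measurable (t : RR))).
have := ae_curve_at t GG'; apply: filterS => g /= /contrapT GG _.
by rewrite /plan_density lee_wpmul2r ?metric_speed_ge0// lee_fin.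
Qed.

End compression.

End plan_integrals.

(** * Finiteness of integrals along test plans *)

Section plan_finiteness.
Context {R : realType} {X : completeMetricType R}.
Local Notation CX := (borel (curve X)).
Local Notation RR := (measurableTypeR R).
Local Open Scope ereal_scope.
Variables (m : {measure set (borel X) -> \bar R}).
Implicit Types (G : borel X -> R).

Lemma ae_leb01 (A : set RR) : {ae @lebesgue_measure R, forall t, (0 <= t)%R -> A t} ->
  {ae leb01, forall t, A t}.
Proof.
move=> [N [mN N0 NA]]; exists (N `|` ~` (unit_itv R)).
have mI := @measurable_unit_itv R; have mIC := measurableC mI.
split; [exact: measurableU| |].
  apply/eqP; rewrite eq_le measure_ge0 andbT -N0 /leb01/= /mrestr.
  apply: le_measure; rewrite ?inE//.
    by apply: measurableI => //; exact: measurableU.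
  by move=> t [[|]].
move=> t /= At; have [It|] := pselect (unit_itv R t); last by right.
left; apply: NA => /= H; apply: At; apply: H.
by move: It; rewrite /unit_itv /= in_itv/= => /andP[].
Qed.

Lemma plan_integral_fin (p : R) G (P : probability CX R) : (1 <= p)%R ->
  (forall x, (0 <= G x)%R) -> G \in Lfun m p%:E ->
  test_plan m (hoelder_conjugate p%:E) P ->
  \int[P]_g \int[leb01]_t plan_density G (g, t) < +oo.
Proof.
move=> p1 G0 Gp [[C C0 PC] Pq].
have mG : measurable_fun setT G by move: Gp; rewrite inE => /andP[/[!inE]].
have p0 : (0 < p)%R by exact: lt_le_trans p1.
have Gpi : \int[m]_x (G x `^ p)%:E < +oo.
  have /integrableP[_] := Lfun_integrable p1 Gp.
  by under eq_integral do rewrite gee0_abs ?lee_fin ?powR_ge0// ger0_norm//.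
have mGp : measurable_fun setT (fun x => (G x `^ p)%:E).
  apply/measurable_EFinP.
  exact: (measurableT_comp (measurable_powR p) mG).
have Gp0 x : 0 <= (G x `^ p)%:E by rewrite lee_fin powR_ge0.
have mdG := measurable_plan_density mG.
have CG := integral2_curve_at_le C0 PC mGp Gp0.
have CGoo : C%:E * \int[m]_x (G x `^ p)%:E < +oo.
  by rewrite lte_mul_pinfty ?lee_fin ?(ltW C0).
move: p1; rewrite le_eqVlt => /predU1P[p1|p1].
  move: Pq; rewrite -p1 hoelder_conjugate1.
  rewrite Lnorm_lip_const => Poo.
  have Pge := ess_sup_ge P (@lip_const R X).
  have e0 : 0 <= ess_sup P (@lip_const R X).
    apply: ess_sup_gee; first by rewrite (lt_le_trans (lte01 : 0 < 1))// -(probability_setT P).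
    by apply: nearW => g; exact: lip_const_ge0.
  set c := fine (ess_sup P (@lip_const R X)).
  have {}Pge : {ae P, forall g : CX, lip_const (g : curve X) <= c%:E}.
    by rewrite /c fineK// ge0_fin_numE.
  have c0 : (0 <= c)%R by exact: fine_ge0.
  pose F (z : CX * RR) := c%:E * (G (curve_at z.2 (z.1 : curve X)))%:E.
  have mG1 : measurable_fun setT (fun x => (G x)%:E) by exact/measurable_EFinP.
  have mF1 : measurable_fun setT (fun z : CX * RR => (G (curve_at z.2 (z.1 : curve X)))%:E).
    exact: measurableT_comp mG1 measurable_curve_at2.
  have mF : measurable_fun setT F by exact: measurable_funeM.
  have F0 z : 0 <= F z by rewrite mule_ge0// lee_fin.
  apply: (@le_lt_trans _ _ (\int[P]_g \int[leb01]_t F (g, t))).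
    apply: ae_ge0_le_integral => //.
    - by move=> g _; apply: integral_ge0 => t _; exact: plan_density_ge0.
    - by apply: measurable_integral_leb01 => // z; exact: plan_density_ge0.
    - by move=> g _; apply: integral_ge0.
    - exact: measurable_integral_leb01.
    apply: filterS Pge => g gc _; apply: ae_ge0_le_integral => //.
    - by move=> t _; exact: plan_density_ge0.
    - exact: (measurableT_comp mdG (pair1_measurable (g : CX))).
    - exact: (measurableT_comp mF (pair1_measurable (g : CX))).
    (* The existence of the metric derivative enters here: at times without one the speed would be
       +oo. *)
    have := ae_leb01 (lipschitz_metric_speed_le (lip_const_curve_at gc)).
    apply: filterS; first exact: (ae_filter_ringOfSetsType leb01).
    by move=> t gt _; rewrite /plan_density /F muleC lee_wpmul2r ?lee_fin.
  have mF1g (g : CX) : measurable_fun setT (fun t : RR => (G (curve_at t (g : curve X)))%:E).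
    exact: (measurableT_comp mF1 (pair1_measurable g)).
  have Fg (g : CX) : \int[leb01]_t F (g, t) =
      c%:E * \int[leb01]_t (G (curve_at t (g : curve X)))%:E.
    apply: (ge0_integralZl _ measurableT (mF1g g)); last by rewrite lee_fin.
    by move=> t _; rewrite lee_fin.
  under eq_integral do rewrite Fg.
  have F10 z : 0 <= (G (curve_at z.2 (z.1 : curve X)))%:E by rewrite lee_fin.
  rewrite (ge0_integralZl _ measurableT (measurable_integral_leb01 mF1 F10)); last 2 first.
  - by move=> g _; apply: integral_ge0 => t _; rewrite lee_fin.
  - by rewrite lee_fin.
  rewrite lte_mul_pinfty ?lee_fin//.
  apply: le_lt_trans (integral2_curve_at_le C0 PC mG1 _) _ => //.
  rewrite lte_mul_pinfty ?lee_fin ?(ltW C0)//.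
  by move: Gpi; rewrite -p1; under eq_integral do rewrite powRr1//.
have qE : hoelder_conjugate p%:E = (p / (p - 1))%:E.
  rewrite /hoelder_conjugate/= eqe gt_eqF// -EFinB inver subr_eq0 gt_eqF//.
move: Pq; rewrite qE; set q := (p / (p - 1))%R => Pq.
have q0 : (0 < q)%R by rewrite divr_gt0// subr_gt0.
have pq : (p^-1 + q^-1 = 1)%R.
  rewrite /q invf_div -[X in (X + _)%R]mul1r -mulrDl addrC subrK divff// gt_eqF//.
(* The factors 1/p and 1/q are dropped, being at most 1, and an infinite speed is allowed. *)
have young a b : (0 <= a)%R -> 0 <= b -> a%:E * b <= (a `^ p)%:E + b `^ q.
  move=> a0; case: b => [b| |]// b0; last first.
    by rewrite poweRyr ?gt_eqF// addey ?leey.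
  rewrite -EFinM poweR_EFin -EFinD lee_fin.
  rewrite (le_trans (conjugate_powR a0 b0 p0 q0 pq))// lerD//.
    by rewrite ler_pdivrMr// ler_peMr ?powR_ge0// ltW.
  rewrite ler_pdivrMr// ler_peMr ?powR_ge0//.
  by rewrite -[leLHS]invr1 -[leRHS]invrK lef_pV2 ?posrE ?invr_gt0// -pq lerDr invr_ge0 ltW.
pose F1 (z : CX * RR) := (G (curve_at z.2 (z.1 : curve X)) `^ p)%:E.
pose F2 (z : CX * RR) := metric_speed (z.1 : curve X) z.2 `^ q.
have mF1 : measurable_fun setT F1 by exact: measurableT_comp mGp measurable_curve_at2.
have mF2 : measurable_fun setT F2.
  exact: (measurableT_comp (measurable_poweR q) measurable_metric_speed).
have F10 z : 0 <= F1 z by rewrite lee_fin powR_ge0.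
have F20 z : 0 <= F2 z by exact: poweR_ge0.
apply: (@le_lt_trans _ _ (\int[P]_g (\int[leb01]_t F1 (g, t) + \int[leb01]_t F2 (g, t)))).
  apply: ge0_le_integralT => g.
    by apply: integral_ge0 => t _; exact: plan_density_ge0.
  rewrite -ge0_integralD//; last 2 first.
  - exact: (measurableT_comp mF1 (pair1_measurable (g : CX))).
  - exact: (measurableT_comp mF2 (pair1_measurable (g : CX))).
  apply: ge0_le_integralT => t; first exact: plan_density_ge0.
  by apply: young; [exact: G0|exact: metric_speed_ge0].
rewrite ge0_integralD//; last 4 first.
- by move=> g _; exact: integral_ge0.
- exact: measurable_integral_leb01.
- by move=> g _; exact: integral_ge0.
- exact: measurable_integral_leb01.
rewrite lte_add_pinfty//; first exact: le_lt_trans CG CGoo.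
apply: le_lt_trans Pq; apply: ge0_le_integralT => g; first exact: integral_ge0.
by rewrite /kinetic_energy; case: ifP => // _; exact: leey.
Qed.

End plan_finiteness.

(** * Localization of the upper gradient inequality *)

Section local_upper_gradient.
Context {R : realType} {X : completeMetricType R}.
Local Notation CX := (borel (curve X)).
Local Open Scope ereal_scope.
Variables (m : {measure set (borel X) -> \bar R}) (p : R).
Hypothesis p1 : (1 <= p)%R.

Lemma hoelder_conjugate_gt1 : 1 < hoelder_conjugate p%:E.
Proof.
move: p1; rewrite le_eqVlt => /predU1P[<-|p1'].
  by rewrite hoelder_conjugate1 ltry.
have p0 : (0 < p)%R by exact: lt_trans p1'.
rewrite /hoelder_conjugate/= eqe gt_eqF// -EFinB inver subr_eq0 gt_eqF//.
by rewrite -EFinM lte_fin ltr_pdivlMr ?subr_gt0// mul1r ltrBlDr ltrDl.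
Qed.

Lemma plan_density_stop (G : borel X -> R) a b r (g : curve X) :
  (0 <= a)%R -> (a <= b)%R -> (b <= 1)%R ->
  plan_density G (stop_curve a b g : CX, r) =
  if r \in `[a, b[ then plan_density G (g : CX, r) else 0.
Proof.
move=> a0 ab b1.
rewrite -[LHS]/((G (curve_at r (stop_curve a b g)))%:E *
  metric_speed (stop_curve a b g) r) metric_speed_stop//.
case: ifP => [rab|_]; last by rewrite mule0.
rewrite curve_at_stop// /stop_time; move: rab; rewrite in_itv/= => /andP[ar rb].
by rewrite (min_l (ltW rb)) (max_r ar).
Qed.

(** This is the inequality for the spliced plan read back on [P]: a constant curve contributes zero
    to both sides, and a stopped curve has the positions at [s] and [t] as its ends and no speed
    outside of [[s, t[]. *)
Lemma upper_gradient_local (f G : borel X -> R) (P : probability CX R)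
    (B : set CX) (s t : R) : measurable_fun setT f -> upper_gradient m p f G ->
  test_plan m (hoelder_conjugate p%:E) P -> measurable B ->
  (0 <= s)%R -> (s <= t)%R -> (t <= 1)%R ->
  \int[P]_(g in B) `|f (curve_at t (g : curve X)) - f (curve_at s (g : curve X))|%:E
  <= \int[P]_(g in B) \int[leb01]_(r in `[s, t[) plan_density G (g, r).
Proof.
move=> mf [mG G0 fG] HP mB s0 st t1.
have s1 := le_trans st t1.
have := fG _ (test_plan_splice mB s0 st t1 hoelder_conjugate_gt1 HP).
have mfc a : measurable_fun setT (fun g : CX => f (curve_at a (g : curve X))).
  exact: measurableT_comp mf (measurable_curve_at a).
have mdG := measurable_plan_density mG; have dG0 z := plan_density_ge0 z G0.
rewrite ge0_integral_distribution//; last first.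
  by do 2 apply: measurableT_comp => //; exact: measurable_funB.
rewrite (ge0_integral_distribution _ (measurable_integral_leb01 mdG dG0)); last first.
  by move=> g; exact: integral_ge0.
rewrite [X in _ -> X <= _]integral_mkcond [X in _ -> _ <= X]integral_mkcond.
congr (_ <= _); apply: eq_integral => g _; rewrite /= patchE /splice.
  case: ifP => _; rewrite !curve_at_stop// /stop_time.
    by rewrite (min_r t1) (max_r st) (min_l (le_trans s0 st)) (max_l s0).
  by rewrite (min_r (le_trans st t1)) maxxx (min_l s0) (max_l s0) subrr normr0.
case: ifP => gB.
  rewrite [RHS]integral_mkcond; apply: eq_integral => r _.
  by rewrite patchE mem_setE plan_density_stop.
rewrite integral0_eq// => r _; rewrite plan_density_stop//.
case: ifP => //; rewrite in_itv/= => /andP[sr /(le_lt_trans sr)].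
by rewrite ltxx.
Qed.

End local_upper_gradient.

(** * Minimum of two upper gradients *)

Section partition_min.
Context {R : realType}.
Local Notation RR := (measurableTypeR R).
Local Open Scope ereal_scope.

Definition part (n k : nat) : set RR := `[(k%:R / n%:R)%R, (k.+1%:R / n%:R)%R[%classic.

Lemma measurable_part n k : measurable (part n k). Proof. exact: measurable_itv. Qed.

Lemma part_trivIset n (A : set nat) : trivIset A (part n).
Proof.
(* For [n] equal to 0 the inverse is 0 and every part is the empty interval from 0 to 0. *)
case: n => [|n] i j _ _ [t []].
  by rewrite /part /= !in_itv/= !invr0 !mulr0 => /andP[/le_lt_trans/[apply]]; rewrite ltxx.
rewrite /part /= !in_itv/= => /andP[it ti] /andP[jt tj].
have := le_lt_trans it tj; have := le_lt_trans jt ti.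
rewrite !ltr_pM2r ?invr_gt0 ?ltr0Sn// !ltr_nat !ltnS => ji ij.
by apply/eqP; rewrite eqn_leq ij ji.
Qed.

Lemma bigsetU_part n m : (0 < n)%N ->
  \big[setU/set0]_(k <- iota 0 m) part n k = `[0%R, (m%:R / n%:R)%R[%classic.
Proof.
move=> n0; elim: m => [|m IH]; first (rewrite big_nil mul0r; apply/esym/seteqP; split=> t //=).
  by rewrite in_itv/= => /andP[/le_lt_trans/[apply]]; rewrite ltxx.
rewrite -addn1 iotaD big_cat/= IH big_seq1 add0n /part.
rewrite addn1 -itv_bndbnd_setU// bnd_simp ?divr_ge0//.
by rewrite ler_pM2r ?invr_gt0 ?ltr0n// ler_nat.
Qed.

Lemma ge0_integral_part n (f : RR -> \bar R) : (0 < n)%N ->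
  measurable_fun setT f -> (forall t, 0 <= f t) ->
  \int[leb01]_t f t = \sum_(k <- iota 0 n) \int[leb01]_(t in part n k) f t.
Proof.
move=> n0 mf f0; rewrite -ge0_integral_bigsetU ?iota_uniq//; last 3 first.
- by move=> k; exact: measurable_part.
- exact: part_trivIset.
- exact: measurable_funS mf.
rewrite bigsetU_part// divff ?pnatr_eq0 -?lt0n//.
have mI : measurable (`[0%R, 1%R[%classic : set RR) by exact: measurable_itv.
(* The parts leave out the time 1, which is negligible. *)
have N0 : @leb01 R (~` `[0%R, 1%R[%classic) = 0.
  apply/eqP; rewrite eq_le measure_ge0 andbT /leb01/= /mrestr.
  rewrite -(@lebesgue_measure_set1 R 1%R); apply: le_measure; rewrite ?inE//.
    by apply: measurableI; [exact: measurableC|exact: measurable_unit_itv].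
  move=> t [/= + It]; move: It; rewrite /unit_itv /= !in_itv/= => /andP[-> t1]/= /negP.
  by rewrite -leNgt => t1'; apply/le_anti; rewrite t1 t1'.
rewrite (ge0_negligible_integral (measurableC mI) measurableT mf _ N0)//.
by rewrite setTD setCK.
Qed.

Lemma mine_integral_part_ge n (f g : RR -> \bar R) : (0 < n)%N ->
  measurable_fun setT f -> (forall t, 0 <= f t) ->
  measurable_fun setT g -> (forall t, 0 <= g t) ->
  \int[leb01]_t mine (f t) (g t) <=
  \sum_(k <- iota 0 n) mine (\int[leb01]_(t in part n k) f t)
                            (\int[leb01]_(t in part n k) g t).
Proof.
move=> n0 mf f0 mg g0.
have mfg : measurable_fun setT (fun t => mine (f t) (g t)) by exact: measurable_mine.
have fg0 t : 0 <= mine (f t) (g t) by rewrite le_min f0 g0.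
rewrite (ge0_integral_part n0)//; apply: lee_sum => k _.
rewrite le_min; apply/andP; split; apply: ge0_le_integral => //.
- exact: measurable_part.
- exact: measurable_funS mfg.
- exact: measurable_funS mf.
- by move=> t _; rewrite ge_min lexx.
- exact: measurable_part.
- exact: measurable_funS mfg.
- exact: measurable_funS mg.
- by move=> t _; rewrite ge_min lexx orbT.
Qed.

End partition_min.

(** * Minima of integrals over fine partitions *)

Section partition_limit.
Context {R : realType}.
Local Notation RR := (measurableTypeR R).

Lemma uniform_continuous01 (c : R -> R) (e : R) : continuous c -> 0 < e ->
  \forall n \near \oo, forall x, x \in `[0, 1] ->
    forall y, `|y - x| <= n.+1%:R^-1 -> `|c y - c x| <= e.
Proof.
move=> cc e0; have := @segment_compact R 0 1; rewrite compact_near_coveringP => H.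
have {}H := H nat \oo (fun n x => forall y, `|y - x| <= n.+1%:R^-1 -> `|c y - c x| <= e) _ _.
have : \forall n \near \oo, `[0, 1]%classic `<=`
    (fun x => forall y, `|y - x| <= n.+1%:R^-1 -> `|c y - c x| <= e).
  apply: H => x _.
  have e2 : 0 < e / 2 by rewrite divr_gt0.
  have [d /= d0 cd] : \forall y \near x, `|c x - c y| < e / 2.
    by move/cvgrPdist_lt : (cc x); apply.
  have d2 : 0 < d / 2 by rewrite divr_gt0.
  near=> x' n => y yx.
  have xx' : `|x - x'| < d / 2 by near: x'; exact: (nbhsx_ballx x _ d2).
  have n1 : n.+1%:R^-1 < d / 2 :> R by near: n; exact: near_infty_natSinv_lt (PosNum d2).
  have cx' : `|c x - c x'| < e / 2.
    by apply: cd => /=; rewrite (lt_trans xx')// ltr_pdivrMr// ltr_pMr// ltr1n.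
  have cy : `|c x - c y| < e / 2.
    apply: cd => /=; rewrite -(subrK x' x) -addrA (le_lt_trans (ler_normD _ _))//.
    by rewrite [d]splitr ltrD// distrC (le_lt_trans yx).
  rewrite -(subrK (c x) (c y)) -addrA (le_trans (ler_normD _ _))//.
  by rewrite [e]splitr lerD// ltW// distrC.
by apply: filterS => n Hn x /Hn.
Unshelve. all: by end_near. Qed.

Local Open Scope ereal_scope.

Lemma ge0_integral_leb01E (f : RR -> \bar R) : measurable_fun setT f ->
  (forall t, 0 <= f t) ->
  \int[leb01]_t f t = \int[lebesgue_measure]_(t in unit_itv R) f t.
Proof.
move=> mf f0; have mI : measurable (unit_itv R : set RR) by exact: measurable_unit_itv.
have N0 : @leb01 R (~` unit_itv R) = 0 by rewrite /leb01/= /mrestr setICl measure0.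
rewrite (ge0_negligible_integral (measurableC mI) measurableT mf _ N0)//.
rewrite setTD setCK; apply: eq_measure_integral => A mA AI.
by rewrite /leb01/= /mrestr setIidl.
Qed.

(** Density of continuous functions in L^1, applied to [fine \o f], which agrees with [f] almost
    everywhere on the interval. *)
Lemma integrable_approx (f : RR -> \bar R) (e : R) : measurable_fun setT f ->
  (forall t, 0 <= f t) -> \int[leb01]_t f t < +oo -> (0 < e)%R ->
  exists2 c : R -> R, continuous c & \int[leb01]_t `|f t - (c t)%:E| <= e%:E.
Proof.
move=> mf f0 foo e0; have mI : measurable (unit_itv R : set RR) by exact: measurable_unit_itv.
pose u := fine \o f.
have mu_ : measurable_fun setT (u : RR -> R) by exact: measurableT_comp.
have fi : lebesgue_measure.-integrable (unit_itv R) f.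
  apply/integrableP; split; first exact: measurable_funS mf.
  by under eq_integral do rewrite gee0_abs//; rewrite -ge0_integral_leb01E.
have ffin := integrable_ae mI fi.
have ui : lebesgue_measure.-integrable (unit_itv R) (EFin \o u).
  apply: le_integrable fi => //; first by apply/measurable_EFinP; exact: measurable_funS mu_.
  by move=> t _; rewrite /u/=; case: (f t) (f0 t) => [r| |]//= _; rewrite leey.
have Ioo : lebesgue_measure (unit_itv R) < +oo.
  by rewrite lebesgue_measure_itv/=; case: ifPn; rewrite ltry.
have [g [gc gi]] := approximation_continuous_integrable mI Ioo ui.
move=> /fine_cvgP[gfin /cvgrPdist_lt/(_ _ e0) ge].
have [n [nfin ne]] := filter_ex (filterI gfin ge).
exists (g n) => //.
have mg : measurable_fun setT (EFin \o g n : RR -> _).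
  by apply/measurable_EFinP; exact: continuous_measurable_fun.
rewrite ge0_integral_leb01E//; last first.
  by apply: measurableT_comp => //; exact: emeasurable_funB.
rewrite (@ae_eq_integral _ _ _ _ _ (fun t => `|(u t - g n t)%:E|))//.
- by rewrite -[leLHS](@fineK _)// lee_fin ltW// (le_lt_trans (ler_norm _))// -normrN -sub0r.
- apply: (@measurable_funS _ _ _ _ setT) => //; apply: measurableT_comp => //.
  exact: emeasurable_funB.
- apply: (@measurable_funS _ _ _ _ setT) => //; apply: measurableT_comp => //.
  by apply/measurable_EFinP; apply: measurable_funB => //; exact/measurable_EFinP.
apply: filterS ffin => t tfin It; have := tfin It => ft.
by rewrite -{1}(fineK ft) -EFinB.
Qed.

(** Here [a] and [b] are the values of two functions at some time, [v1] and [v2] those of their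
    continuous approximations at that time, [u1] and [u2] those at the left end of the part. The
    choice between [a] and [b] made at the left end is nearly the minimum. *)
Let min_approx (a b u1 u2 v1 v2 d : R) :
  (`|v1 - u1| <= d -> `|v2 - u2| <= d -> (if u1 <= u2 then a else b) <=
    Num.min a b + (2 * `|a - v1| + 2 * `|b - v2| + 2 * d))%R.
Proof.
rewrite !ler_norml => /andP[? ?] /andP[? ?].
have A1 := ler_norm (a - v1); have A2 := ler_norm (v1 - a).
have B1 := ler_norm (b - v2); have B2 := ler_norm (v2 - b).
rewrite (distrC v1 a) in A2; rewrite (distrC v2 b) in B2.
have va : (0 <= `|a - v1|)%R by []; have wb : (0 <= `|b - v2|)%R by [].
move: `|a - v1|%R `|b - v2|%R A1 A2 B1 B2 va wb => v w ? ? ? ? ? ?.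
by case: (leP u1 u2) => ?; case: (leP a b) => ?; lra.
Qed.

(** On a short interval one of the two functions is selected by comparing continuous approximations
    at the left end. Its integral bounds the minimum of the two integrals, and pointwise it exceeds
    the minimum of the functions by at most the approximation error [H]. *)
Lemma mine_integral_part_le (f g : RR -> \bar R) (e : R) :
  measurable_fun setT f -> (forall t, 0 <= f t) -> \int[leb01]_t f t < +oo ->
  measurable_fun setT g -> (forall t, 0 <= g t) -> \int[leb01]_t g t < +oo ->
  (0 < e)%R -> \forall n \near \oo,
  \sum_(k <- iota 0 n.+1) mine (\int[leb01]_(t in part n.+1 k) f t)
                              (\int[leb01]_(t in part n.+1 k) g t) <=
  \int[leb01]_t mine (f t) (g t) + e%:E.
Proof.
move=> mf f0 foo mg g0 goo e0.
(* Each of the three terms of [H] below has integral at most [2 * d]. *)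
pose d := (e / 6)%R; have d0 : (0 < d)%R by rewrite divr_gt0.
have [c1 cc1 fc1] := integrable_approx mf f0 foo d0.
have [c2 cc2 gc2] := integrable_approx mg g0 goo d0.
near=> n.
have u1 : forall x, x \in `[0%R, 1%R] -> forall y, (`|y - x| <= n.+1%:R^-1)%R -> (`|c1 y - c1 x| <= d)%R.
  by near: n; exact: uniform_continuous01.
have u2 : forall x, x \in `[0%R, 1%R] -> forall y, (`|y - x| <= n.+1%:R^-1)%R -> (`|c2 y - c2 x| <= d)%R.
  by near: n; exact: uniform_continuous01.
pose h1 t := `|f t - (c1 t)%:E|; pose h2 t := `|g t - (c2 t)%:E|.
have mc (c : R -> R) : continuous c -> measurable_fun setT (EFin \o c : RR -> \bar R).
  by move=> cc; apply/measurable_EFinP; exact: continuous_measurable_fun.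
have mh1 : measurable_fun setT (h1 : RR -> _).
  by apply: measurableT_comp => //; apply: emeasurable_funB => //; exact: mc.
have mh2 : measurable_fun setT (h2 : RR -> _).
  by apply: measurableT_comp => //; apply: emeasurable_funB => //; exact: mc.
pose H t := 2%:E * h1 t + 2%:E * h2 t + (2 * d)%:E.
have mH : measurable_fun setT (H : RR -> _).
  apply: emeasurable_funD => //.
  by apply: emeasurable_funD; exact: measurable_funeM.
have H0 t : 0 <= H t.
  by rewrite !adde_ge0// ?mule_ge0// ?abse_ge0// lee_fin mulr_ge0// ltW.
have mfg : measurable_fun setT (fun t => mine (f t) (g t)) by exact: measurable_mine.
have fg0 t : 0 <= mine (f t) (g t) by rewrite le_min f0 g0.
pose F t := mine (f t) (g t) + H t.
have mF : measurable_fun setT (F : RR -> _) by exact: emeasurable_funD.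
have F0 t : 0 <= F t by rewrite adde_ge0.
(* Where [f] or [g] is infinite the bound [F] is infinite too, so that the pointwise comparison only
   concerns real values. *)
have yF t : (h1 t == +oo) || (h2 t == +oo) -> F t = +oo.
  have h10 : 0 <= 2%:E * h1 t by rewrite mule_ge0// abse_ge0.
  have h20 : 0 <= 2%:E * h2 t by rewrite mule_ge0// abse_ge0.
  have mfgN : mine (f t) (g t) != -oo by rewrite gt_eqF// (lt_le_trans ltNy0).
  move=> h12; rewrite /F; suff -> : H t = +oo by rewrite addey.
  rewrite /H; case/orP: h12 => /eqP ->; rewrite mulry gtr0_sg// mul1e.
    by rewrite !addye// gt_eqF// (lt_le_trans ltNy0).
  by rewrite addey ?addye// gt_eqF// (lt_le_trans ltNy0).
have HI : \int[leb01]_t H t <= e%:E.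
  rewrite /H ge0_integralD//; last 3 first.
  - by move=> t _; rewrite adde_ge0// mule_ge0// abse_ge0.
  - by apply: emeasurable_funD; exact: measurable_funeM.
  - by move=> t _; rewrite lee_fin mulr_ge0// ltW.
  rewrite ge0_integralD//; last 4 first.
  - by move=> t _; rewrite mule_ge0// abse_ge0.
  - exact: measurable_funeM.
  - by move=> t _; rewrite mule_ge0// abse_ge0.
  - exact: measurable_funeM.
  rewrite !ge0_integralZl//; last 2 first.
  - by move=> t _; exact: abse_ge0.
  - by move=> t _; exact: abse_ge0.
  rewrite integral_cst// [leb01 _]leb01T mule1.
  have -> : e%:E = 2%:E * d%:E + 2%:E * d%:E + (2 * d)%:E.
    by rewrite -!EFinM -!EFinD; congr EFin; rewrite /d; lra.
  by rewrite !leeD// lee_pmul2l.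
apply: (@le_trans _ _ (\int[leb01]_t F t)); last first.
  by rewrite ge0_integralD// leeD2l.
rewrite (ge0_integral_part (ltn0Sn n) mF)// !big_seq; apply: lee_sum => k.
rewrite mem_iota add0n => /= kn.
pose x : R := (k%:R / n.+1%:R)%R.
have x01 : x \in `[0%R, 1%R].
  rewrite in_itv/= divr_ge0//= ler_pdivrMr ?ltr0n// mul1r ler_nat.
  exact: ltnW.
have xI t : part n.+1 k t -> (`|t - x| <= n.+1%:R^-1)%R.
  rewrite /part /= in_itv/= => /andP[xt tx]; rewrite ger0_norm ?subr_ge0//.
  by rewrite lerBlDl (le_trans (ltW tx))// -natr1 mulrDl mul1r.
(* The selection depends on [x] alone, hence is constant on the part. *)
pose h := if (c1 x <= c2 x)%R then f else g.
have mh : measurable_fun setT h by rewrite /h; case: ifP.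
have h0 t : 0 <= h t by rewrite /h; case: ifP.
apply: (@le_trans _ _ (\int[leb01]_(t in part n.+1 k) h t)).
  by rewrite /h; case: ifP => _; rewrite ge_min lexx ?orbT.
apply: ge0_le_integral => //.
- exact: measurable_part.
- exact: measurable_funS mh.
- exact: measurable_funS mF.
move=> t /xI It; have := u1 _ x01 _ It; have := u2 _ x01 _ It.
have [Foo|Foo] := eqVneq (F t) +oo; first by rewrite Foo leey.
have [a fa] : exists a, f t = a%:E.
  case E : (f t) (f0 t) => [a| |]// _; first by exists a.
  by exfalso; move/eqP: Foo; apply; apply: yF; rewrite /h1 E.
have [b gb] : exists b, g t = b%:E.
  case E : (g t) (g0 t) => [b| |]// _; first by exists b.
  by exfalso; move/eqP: Foo; apply; apply: yF; rewrite /h2 E orbT.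
rewrite /F /H /h1 /h2 /h (fun_if (@^~ t)) fa gb.
rewrite -(fun_if EFin) -EFin_min -!EFinB/= -!EFinM -!EFinD lee_fin.
by move=> d2 d1'; exact: min_approx.
Unshelve. all: by end_near. Qed.

Lemma mine_integral_part_cvg (f g : RR -> \bar R) :
  measurable_fun setT f -> (forall t, 0 <= f t) -> \int[leb01]_t f t < +oo ->
  measurable_fun setT g -> (forall t, 0 <= g t) -> \int[leb01]_t g t < +oo ->
  \sum_(k <- iota 0 n.+1) mine (\int[leb01]_(t in part n.+1 k) f t)
    (\int[leb01]_(t in part n.+1 k) g t) @[n --> \oo] -->
  \int[leb01]_t mine (f t) (g t).
Proof.
move=> mf f0 foo mg g0 goo.
have mfg : measurable_fun setT (fun t => mine (f t) (g t)) by exact: measurable_mine.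
have fg0 t : 0 <= mine (f t) (g t) by rewrite le_min f0 g0.
have Ifin : \int[leb01]_t mine (f t) (g t) \is a fin_num.
  rewrite ge0_fin_numE; last by apply: integral_ge0.
  apply: le_lt_trans foo; apply: ge0_le_integral => // t _.
  by rewrite ge_min lexx.
pose S n := \sum_(k <- iota 0 n.+1) mine (\int[leb01]_(t in part n.+1 k) f t)
  (\int[leb01]_(t in part n.+1 k) g t).
have lb n : \int[leb01]_t mine (f t) (g t) <= S n.
  exact: mine_integral_part_ge.
have ub e : (0 < e)%R -> \forall n \near \oo, S n <= \int[leb01]_t mine (f t) (g t) + e%:E.
  exact: mine_integral_part_le.
have Sfin n e : S n <= \int[leb01]_t mine (f t) (g t) + e%:E -> S n \is a fin_num.
  move=> Sn; rewrite fin_real// (lt_le_trans _ (lb n)) ?(le_lt_trans Sn)//.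
    by rewrite -(fineK Ifin) -EFinD ltry.
  by rewrite (lt_le_trans ltNy0)// integral_ge0.
rewrite -(fineK Ifin); apply/fine_cvgP; split.
  by apply: filterS (ub 1%R ltr01) => n; exact: Sfin.
apply/cvgrPdist_le => e e0; apply: filterS (ub _ e0) => n Sn /=.
have Snf := Sfin _ _ Sn.
rewrite distrC ger0_norm.
  by rewrite lerBlDl -lee_fin EFinD !fineK.
by rewrite subr_ge0 fine_le//; exact: lb.
Qed.

End partition_limit.

Section upper_gradient_lattice.
Context {R : realType} {X : completeMetricType R}.
Local Notation CX := (borel (curve X)).
Local Notation RR := (measurableTypeR R).
Local Open Scope ereal_scope.
Variables (m : {measure set (borel X) -> \bar R}) (p : R).
Hypothesis p1 : (1 <= p)%R.

Lemma measurable_integral_leb01_in (F : CX * RR -> \bar R) (I : set RR) :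
  measurable I -> measurable_fun setT F -> (forall z, 0 <= F z) ->
  measurable_fun setT (fun g => \int[leb01]_(t in I) F (g, t)).
Proof.
move=> mI mF F0.
have -> : (fun g => \int[leb01]_(t in I) F (g, t)) =
    (fun g => \int[leb01]_t (F (g, t) * (\1_I t)%:E)).
  apply/funext => g; rewrite integral_mkcond; apply: eq_integral => t _.
  by rewrite patchE indicE; case: ifP => _; rewrite ?mule1 ?mule0.
apply: (@measurable_integral_leb01 _ _ (fun z => F z * (\1_I z.2)%:E)).
  apply: emeasurable_funM => //; apply/measurable_EFinP.
  exact: (measurableT_comp (measurable_indic _) measurable_snd).
by move=> z; rewrite mule_ge0// lee_fin.
Qed.

(* On each interval of a partition of [0, 1], every curve uses the gradient with
   the smaller integral over that interval; the curves using the first one form a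
   measurable set, to which the plan may be restricted. Then the mesh tends to 0. *)
Lemma upper_gradient_min (f G1 G2 : borel X -> R) : measurable_fun setT f ->
  upper_gradient m p f G1 -> G1 \in Lfun m p%:E ->
  upper_gradient m p f G2 -> G2 \in Lfun m p%:E ->
  upper_gradient m p f (fun x => Num.min (G1 x) (G2 x)).
Proof.
move=> mf UG1 LG1 UG2 LG2; have [mG1 G10 _] := UG1; have [mG2 G20 _] := UG2.
have G0 x : (0 <= Num.min (G1 x) (G2 x))%R by rewrite le_min G10 G20.
have mG : measurable_fun setT (fun x => Num.min (G1 x) (G2 x)) by exact: measurable_minr.
split => // P HP.
have md1 := measurable_plan_density mG1; have d10 z := plan_density_ge0 z G10.
have md2 := measurable_plan_density mG2; have d20 z := plan_density_ge0 z G20.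
pose a (G : borel X -> R) n k (g : CX) := \int[leb01]_(t in part n k) plan_density G (g, t).
have ma1 n k : measurable_fun setT (a G1 n k).
  by apply: measurable_integral_leb01_in => //; exact: measurable_part.
have ma2 n k : measurable_fun setT (a G2 n k).
  by apply: measurable_integral_leb01_in => //; exact: measurable_part.
have a10 n k g : 0 <= a G1 n k g by exact: integral_ge0.
have a20 n k g : 0 <= a G2 n k g by exact: integral_ge0.
pose s n k g := mine (a G1 n k g) (a G2 n k g).
have ms n k : measurable_fun setT (s n k) by exact: measurable_mine.
have s0 n k g : 0 <= s n k g by rewrite le_min a10 a20.
pose S n g := \sum_(k <- iota 0 n.+1) s n.+1 k g.
have mS n : measurable_fun setT (S n) by exact: emeasurable_sum.
have S0 n g : 0 <= S n g by exact: sume_ge0.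
pose phi n k (g : CX) := f (curve_at (k%:R / n%:R) (g : curve X)).
have mphi n k : measurable_fun setT (fun g => `|phi n k.+1 g - phi n k g|%:E).
  do 2 apply: measurableT_comp => //; apply: measurable_funB;
    exact: measurableT_comp mf (measurable_curve_at _).
have step n k : (k < n)%N ->
    \int[P]_g `|phi n k.+1 g - phi n k g|%:E <= \int[P]_g s n k g.
  move=> kn; have n0 : (0 < n%:R :> R)%R by rewrite ltr0n (leq_ltn_trans _ kn).
  pose B := [set g | a G1 n k g <= a G2 n k g].
  have mB : measurable B.
    by rewrite -[B]setTI; exact: measurable_lee.
  have mBC := measurableC mB.
  have k0 : (0 <= k%:R / n%:R :> R)%R by rewrite divr_ge0// ltW.
  have kk : (k%:R / n%:R <= k.+1%:R / n%:R :> R)%R by rewrite ler_pM2r ?invr_gt0// ler_nat.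
  have k1 : (k.+1%:R / n%:R <= 1 :> R)%R by rewrite ler_pdivrMr// mul1r ler_nat.
  have split (h : CX -> \bar R) : measurable_fun setT h -> (forall g, 0 <= h g) ->
      \int[P]_g h g = \int[P]_(g in ~` B) h g + \int[P]_(g in B) h g.
    move=> mh h0; rewrite -{1}(setvU B); apply: ge0_integral_setU => //.
      by rewrite setvU.
    by rewrite disj_set2E setICl.
  rewrite (split _ (mphi n k))//; rewrite (split _ (ms n k))//.
  apply: leeD.
  - apply: (le_trans (upper_gradient_local p1 mf UG2 HP mBC k0 kk k1)).
    apply: ge0_le_integral => //.
    + by move=> g _; exact: a20.
    + exact: measurable_funS (ma2 n k).
    + exact: measurable_funS (ms n k).
    + move=> g /= /negP; rewrite -ltNge => /ltW ag.
      by rewrite /s min_r.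
  - apply: (le_trans (upper_gradient_local p1 mf UG1 HP mB k0 kk k1)).
    apply: ge0_le_integral => //.
    + by move=> g _; exact: a10.
    + exact: measurable_funS (ma1 n k).
    + exact: measurable_funS (ms n k).
    + by move=> g /= ag; rewrite /s min_l.
have bound n : \int[P]_g `|f (curve_at 1 (g : curve X)) - f (curve_at 0 (g : curve X))|%:E <=
    \int[P]_g S n g.
  apply: (@le_trans _ _ (\int[P]_g \sum_(k <- iota 0 n.+1) `|phi n.+1 k.+1 g - phi n.+1 k g|%:E)).
    apply: ge0_le_integralT => g //; rewrite sumEFin lee_fin.
    apply: le_trans (ler_norm_sum _ _ _).
    rewrite -[iota 0 n.+1]/(index_iota 0 n.+1) telescope_sumr// /phi.
    by rewrite divff ?pnatr_eq0// mul0r.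
  rewrite ge0_integral_sum//; rewrite ge0_integral_sum//.
  rewrite !big_seq; apply: lee_sum => k; rewrite mem_iota add0n => /= kn.
  exact: step.
pose J g := \int[leb01]_t mine (plan_density G1 (g, t)) (plan_density G2 (g, t)).
have mJ : measurable_fun setT J.
  apply: (@measurable_integral_leb01 _ _ (fun z => mine (plan_density G1 z) (plan_density G2 z))).
    exact: measurable_mine.
  by move=> z; rewrite le_min d10 d20.
pose A (G : borel X -> R) (g : CX) := \int[leb01]_t plan_density G (g, t).
have mA1 : measurable_fun setT (A G1) by exact: measurable_integral_leb01.
have mA2 : measurable_fun setT (A G2) by exact: measurable_integral_leb01.
have A10 g : 0 <= A G1 g by exact: integral_ge0.
have A20 g : 0 <= A G2 g by exact: integral_ge0.
(* Membership of the gradients in L^p is used here: it makes both densities integrable in time along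
   almost every curve, as the limit over partitions requires, and [A G1] then dominates all the sums
   [S n]. *)
have iA1 : P.-integrable setT (A G1).
  apply/integrableP; split => //; under eq_integral do rewrite gee0_abs//.
  exact: plan_integral_fin HP.
have iA2 : P.-integrable setT (A G2).
  apply/integrableP; split => //; under eq_integral do rewrite gee0_abs//.
  exact: plan_integral_fin HP.
have SJ : {ae P, forall g, setT g -> S n g @[n --> \oo] --> J g}.
  have := integrable_ae measurableT iA2; apply: filterS2 (integrable_ae measurableT iA1).
  move=> g /(_ I) A1f /(_ I) A2f _; apply: mine_integral_part_cvg => //.
  - exact: (measurableT_comp md1 (pair1_measurable (g : CX))).
  - by move: A1f; rewrite (ge0_fin_numE (A10 g)).
  - exact: (measurableT_comp md2 (pair1_measurable (g : CX))).
  - by move: A2f; rewrite (ge0_fin_numE (A20 g)).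
have SA : {ae P, forall g n, setT g -> `|S n g| <= A G1 g}.
  apply: nearW => g n _; rewrite gee0_abs//.
  rewrite /A (ge0_integral_part (ltn0Sn n))//.
    by apply: lee_sum => k _; rewrite /s ge_min lexx.
  exact: (measurableT_comp md1 (pair1_measurable (g : CX))).
have [_ _ cv] := dominated_convergence measurableT mS mJ SJ iA1 SA.
(* Multiplication by the speed is monotone, even if the speed is infinite, so it commutes with the
   minimum. *)
have -> : \int[P]_g \int[leb01]_t ((Num.min (G1 (curve_at t (g : curve X)))
    (G2 (curve_at t (g : curve X))))%:E * metric_speed (g : curve X) t) = \int[P]_g J g.
  apply: eq_integral => g _; apply: eq_integral => t _; rewrite /plan_density/=.
  have := metric_speed_ge0 (g : curve X) t.
  move: (metric_speed _ _) (G1 _) (G2 _) => v a1 a2 v0.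
  by case: (leP a1 a2) => [|/ltW] a12; [rewrite min_l|rewrite min_r];
    rewrite // lee_wpmul2r// lee_fin.
rewrite -(cvg_lim _ cv)//; apply: lime_ge; first by apply/cvg_ex; eexists; exact: cv.
exact: nearW.
Qed.

End upper_gradient_lattice.

(** * Sums and series of upper gradients *)

Section real_series.
Context {R : realType}.
Implicit Types u v : R^nat.
Local Open Scope ereal_scope.

Lemma nneseries_EFin_cvg u l : (forall n, 0 <= u n)%R ->
  series u @ \oo --> l -> \sum_(n <oo) (u n)%:E = l%:E.
Proof.
move=> u0 ul; apply/cvg_lim => //.
apply: cvg_EFin; first by apply: nearW => n; rewrite sumEFin.
apply: cvg_trans ul; apply: near_eq_cvg; apply: nearW => n.
by rewrite /= sumEFin.
Qed.

Lemma nneseries_dist_le u v a b : series u @ \oo --> a -> series v @ \oo --> b ->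
  `|b - a|%:E <= \sum_(n <oo) `|v n - u n|%:E.
Proof.
move=> ua vb.
have ab : `|series v n - series u n|%:E @[n --> \oo] --> `|b - a|%:E.
  by apply: cvg_EFin; [exact: nearW|apply: cvg_norm; exact: cvgB].
apply: cvge_le ab; apply: nearW => n.
apply: le_trans (nneseries_lim_ge n _); last by [].
rewrite sumEFin lee_fin /series/= -sumrB; exact: ler_norm_sum.
Qed.

End real_series.

Section upper_gradient_calculus.
Context {R : realType} {X : completeMetricType R}.
Local Notation CX := (borel (curve X)).
Local Notation RR := (measurableTypeR R).
Local Open Scope ereal_scope.
Variables (m : {measure set (borel X) -> \bar R}) (p : R).

Lemma upper_gradient0 : upper_gradient m p 0%R 0%R.
Proof.
split => //; first exact: measurable_cst.
move=> P _; under eq_integral do rewrite subrr normr0.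
by rewrite integral0; apply: integral_ge0 => g _; apply: integral_ge0 => t _; rewrite mul0e.
Qed.

Lemma measurable_increment (f : borel X -> R) : measurable_fun setT f ->
  measurable_fun setT
    (fun g : CX => `|f (curve_at 1 (g : curve X)) - f (curve_at 0 (g : curve X))|%:E).
Proof.
move=> mf; do 2 apply: measurableT_comp => //.
by apply: measurable_funB; exact: measurableT_comp mf (measurable_curve_at _).
Qed.

(** Changing [f] on a null set is harmless since almost every curve avoids the set at the times 0
    and 1; for the gradient, [ae_plan_density] applies. *)
Lemma upper_gradient_ae (f f' G G' : borel X -> R) :
  measurable_fun setT f -> measurable_fun setT f' ->
  f = f' %[ae m] -> measurable_fun setT G' -> (forall x, 0 <= G' x)%R ->
  {ae m, forall x, (G x <= G' x)%R} ->
  upper_gradient m p f G -> upper_gradient m p f' G'.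
Proof.
move=> mf mf' ff' mG' G'0 GG' [mG G0 UG].
split; [exact: mG'|exact: G'0|move=> P HP; have [[C C0 PC] _] := HP].
apply: le_trans (ae_plan_density PC mG mG' G0 G'0 GG').
apply: le_trans (UG P HP); apply: ae_ge0_le_integral.
- exact: measurableT.
- by move=> g _; rewrite lee_fin.
- exact: measurable_increment mf'.
- by move=> g _; rewrite lee_fin.
- exact: measurable_increment mf.
have := ae_curve_at PC 1 ff'; apply: filterS2 (ae_curve_at PC 0 ff') => g /=.
by move=> /contrapT f0 /contrapT f1 _; rewrite -f0// -f1.
Qed.

Lemma upper_gradient_lin a (f1 f2 G1 G2 : borel X -> R) :
  measurable_fun setT f1 -> measurable_fun setT f2 ->
  upper_gradient m p f1 G1 -> upper_gradient m p f2 G2 ->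
  upper_gradient m p (a *: f1 + f2)%R (`|a|%R *: G1 + G2)%R.
Proof.
move=> mf1 mf2 [mG1 G10 UG1] [mG2 G20 UG2].
have mG : measurable_fun setT (`|a|%R *: G1 + G2)%R.
  by apply: measurable_funD => //; exact: measurable_funM (measurable_cst _) mG1.
have G0 x : (0 <= (`|a|%R *: G1 + G2) x)%R by rewrite addr_ge0// mulr_ge0.
split; [exact: mG|exact: G0|move=> P HP].
have mD1 := measurable_plan_density mG1; have D10 z := plan_density_ge0 z G10.
have mD2 := measurable_plan_density mG2; have D20 z := plan_density_ge0 z G20.
have a0 : (0 <= `|a|)%R by [].
apply: (@le_trans _ _ (`|a|%:E * \int[P]_g \int[leb01]_t plan_density G1 (g, t) +
    \int[P]_g \int[leb01]_t plan_density G2 (g, t))).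
  apply: le_trans (leeD (lee_wpmul2l _ (UG1 P HP)) (UG2 P HP)); last by rewrite lee_fin.
  rewrite -ge0_integralZl//; last exact: measurable_increment.
  have mZ : measurable_fun setT
    (fun h : CX => `|a|%:E * `|f1 (curve_at 1 (h : curve X)) - f1 (curve_at 0 (h : curve X))|%:E).
    by apply: measurable_funeM; exact: measurable_increment.
  rewrite -ge0_integralD//; last exact: measurable_increment.
  apply: ge0_le_integralT => h //.
  rewrite -EFinM -EFinD lee_fin /= /GRing.scale/= -normrM.
  by apply: le_trans (ler_normD _ _); rewrite mulrBr opprD addrACA.
have mI1 := measurable_integral_leb01 mD1 D10.
have mI2 := measurable_integral_leb01 mD2 D20.
have I10 g : 0 <= \int[leb01]_t plan_density G1 (g, t) by exact: integral_ge0.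
have I20 g : 0 <= \int[leb01]_t plan_density G2 (g, t) by exact: integral_ge0.
have aI10 g : 0 <= `|a|%:E * \int[leb01]_t plan_density G1 (g, t).
  by apply: mule_ge0; [rewrite lee_fin|exact: I10].
have aD10 z : 0 <= `|a|%:E * plan_density G1 z.
  by apply: mule_ge0; [rewrite lee_fin|exact: D10].
have mD1g (g : CX) := measurableT_comp mD1 (pair1_measurable g).
have mD2g (g : CX) := measurableT_comp mD2 (pair1_measurable g).
rewrite -(ge0_integralZl _ measurableT mI1)//; last by move=> g _; exact: I10.
rewrite -ge0_integralD//; last 2 first.
- by move=> g _; exact: aI10.
- exact: measurable_funeM.
apply: ge0_le_integralT => g; first by apply: adde_ge0; [exact: aI10|exact: I20].
rewrite -(ge0_integralZl _ measurableT (mD1g g))//; last by move=> t _; exact: D10.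
rewrite -ge0_integralD//; last 3 first.
- by move=> t _; exact: aD10.
- exact: measurable_funeM.
- exact: mD2g.
apply: ge0_le_integralT => t; first by apply: adde_ge0; [exact: aD10|exact: D20].
rewrite /plan_density /= /GRing.scale/= muleA -EFinM -ge0_muleDl ?lee_fin ?mulr_ge0//.
Qed.

(** Convergence of the functions is needed only at the two ends of almost every curve; there the
    increment of the sum is at most the sum of the increments. *)
Lemma upper_gradient_series (u G : nat -> borel X -> R) (f H : borel X -> R) :
  (forall n, measurable_fun setT (u n)) -> measurable_fun setT f ->
  (forall n, upper_gradient m p (u n) (G n)) ->
  measurable_fun setT H -> (forall x, 0 <= H x)%R ->
  {ae m, forall x, series (u ^~ x) @ \oo --> f x} ->
  {ae m, forall x, series (G ^~ x) @ \oo --> H x} ->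
  upper_gradient m p f H.
Proof.
move=> mu mf UG mH H0 uf GH; split; [exact: mH|exact: H0|move=> P HP]; have [[C C0 PC] _] := HP.
move: GH => [N [mN N0 NGH]].
have mG n : measurable_fun setT (G n) by case: (UG n).
have G0 n x : (0 <= G n x)%R by case: (UG n).
have mE : measurable_fun setT (\1_(~` N) : borel X -> R).
  by apply: measurable_indic; exact: measurableC.
(* Erasing the gradients on the exceptional set makes their sum at most [H] at every point, so that
   it can be evaluated along any curve; the integrals can only be compared up to null sets, which
   [DG] does. *)
pose G' n (x : borel X) := (G n x * \1_(~` N) x)%R.
have mG' n : measurable_fun setT (G' n) by exact: measurable_funM (mG n) mE.
have G'0 n x : (0 <= G' n x)%R by rewrite mulr_ge0.
have mD n := measurable_plan_density (mG' n); have D0 n z := plan_density_ge0 z (G'0 n).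
have DG n : \int[P]_g `|u n (curve_at 1 (g : curve X)) - u n (curve_at 0 (g : curve X))|%:E <=
    \int[P]_g \int[leb01]_t plan_density (G' n) (g, t).
  have [_ _ UGn] := UG n; apply: le_trans (UGn P HP) _.
  apply: (ae_plan_density PC (mG n) (mG' n) (G0 n) (G'0 n)).
  exists N; split => // x /= GG; apply: contrapT => Nx; apply: GG.
  by rewrite /G' indicE mem_set ?mulr1.
have G'H x : \sum_(n <oo) (G' n x)%:E <= (H x)%:E.
  have [Nx|Nx] := pselect (N x).
    rewrite eseries0 ?lee_fin// => n _ _.
    by rewrite /G' indicE memNset ?mulr0//= => /(_ Nx).
  rewrite (nneseries_EFin_cvg _ (_ : series (G' ^~ x) @ \oo --> H x))//.
  have -> : G' ^~ x = G ^~ x by apply/funext => n; rewrite /G' indicE mem_set ?mulr1.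
  by apply: contrapT => xGH; apply: Nx; apply: NGH.
apply: (@le_trans _ _ (\int[P]_g \sum_(n <oo)
    `|u n (curve_at 1 (g : curve X)) - u n (curve_at 0 (g : curve X))|%:E)).
  apply: ae_ge0_le_integral.
  - exact: measurableT.
  - by move=> g _; rewrite lee_fin.
  - exact: measurable_increment.
  - by move=> g _; apply: nneseries_ge0 => n _ _; rewrite lee_fin.
  - apply: ge0_emeasurable_sum => n *; first by rewrite lee_fin.
    exact: measurable_increment.
  have := ae_curve_at PC 1 uf; apply: filterS2 (ae_curve_at PC 0 uf) => g /=.
  by move=> /contrapT u0 /contrapT u1 _; exact: nneseries_dist_le.
rewrite integral_nneseries//; last by move=> n; exact: measurable_increment.
apply: le_trans (lee_nneseries _ (fun n _ => DG n)) _.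
  by move=> n _ _; exact: integral_ge0.
rewrite -integral_nneseries//; last 2 first.
- by move=> n; exact: measurable_integral_leb01.
- by move=> n g _; exact: integral_ge0.
apply: ge0_le_integralT => g.
  by apply: nneseries_ge0 => n _ _; exact: integral_ge0.
have mDg n : measurable_fun setT (fun t : RR => plan_density (G' n) (g, t)).
  exact: (measurableT_comp (mD n) (pair1_measurable (g : CX))).
rewrite -integral_nneseries//.
apply: ge0_le_integralT => t; first by apply: nneseries_ge0 => n _ _.
rewrite /plan_density/=.
have v0 := metric_speed_ge0 (g : curve X) t; have yGH := G'H (curve_at t (g : curve X)).
(* The speed may be infinite, so it is factored out of the finite partial sums only. *)
apply: lime_le.
  by apply: is_cvg_nneseries => n _ _; rewrite mule_ge0// lee_fin.
apply: nearW => k; rewrite -ge0_sume_distrl; last by move=> n _; rewrite lee_fin.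
apply: lee_wpmul2r => //; apply: le_trans yGH; apply: nneseries_lim_ge => n _ _.
by rewrite lee_fin.
Qed.

End upper_gradient_calculus.

(** * Series in L^p *)

Section Lp_series.
Context d (T : measurableType d) (R : realType).
Variables (mu : {measure set T -> \bar R}) (p : R).
Hypothesis p1 : (1 <= p)%R.
Local Open Scope ereal_scope.
Implicit Types f g : T -> R.

Let p0 : (0 < p)%R. Proof. exact: lt_le_trans p1. Qed.

Definition Lp_norm f : R := fine 'N[mu]_(p%:E)[EFin \o f].

Lemma Lfun_measurable f : f \in Lfun mu p%:E -> measurable_fun setT f.
Proof. by rewrite inE => /andP[/[!inE]]. Qed.

Lemma Lp_normE f : f \in Lfun mu p%:E -> 'N[mu]_(p%:E)[EFin \o f] = (Lp_norm f)%:E.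
Proof.
rewrite inE => /andP[_ /[!inE] foo]; rewrite /Lp_norm fineK// ge0_fin_numE//.
exact: Lnorm_ge0.
Qed.

Lemma Lp_norm_ge0 f : (0 <= Lp_norm f)%R.
Proof. by rewrite fine_ge0// Lnorm_ge0. Qed.

Lemma Lfun0 : (0%R : T -> R) \in Lfun mu p%:E.
Proof. by apply: rpred0; rewrite lee_fin. Qed.

Lemma Lp_norm0 : Lp_norm 0%R = 0%R.
Proof. by rewrite /Lp_norm -[X in 'N[mu]_(_)[X]]/(cst 0%E) Lnorm0// eqe gt_eqF. Qed.

Lemma Lfun_ltyP f : f \in Lfun mu p%:E <->
  measurable_fun setT f /\ 'N[mu]_(p%:E)[EFin \o f] < +oo.
Proof.
split; first by rewrite inE => /andP[/[!inE]].
by move=> [mf foo]; rewrite inE; apply/andP; rewrite !inE.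
Qed.

Lemma le_Lnorm (f g : T -> \bar R) : (forall x, `|f x| <= `|g x|) ->
  'N[mu]_(p%:E)[f] <= 'N[mu]_(p%:E)[g].
Proof.
move=> fg; rewrite unlock /Lnorm; apply: gt0_ler_poweR.
- by rewrite invr_ge0 ltW.
- by rewrite in_itv/= leey andbT integral_ge0// => x _; exact: poweR_ge0.
- by rewrite in_itv/= leey andbT integral_ge0// => x _; exact: poweR_ge0.
apply: ge0_le_integralT => x; first exact: poweR_ge0.
by apply: gt0_ler_poweR; rewrite ?in_itv/= ?leey ?andbT ?abse_ge0// ltW.
Qed.

Lemma Lfun_le f g : measurable_fun setT f -> (forall x, `|f x| <= `|g x|)%R ->
  g \in Lfun mu p%:E -> f \in Lfun mu p%:E.
Proof.
move=> mf fg /Lfun_ltyP[_ goo]; apply/Lfun_ltyP; split => //.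
by apply: le_lt_trans goo; apply: le_Lnorm => x; rewrite lee_fin.
Qed.

Lemma Lfun_lin (a : R) f g : f \in Lfun mu p%:E -> g \in Lfun mu p%:E ->
  (a *: f + g)%R \in Lfun mu p%:E.
Proof.
move=> Lf Lg; have p1' : 1%E <= p%:E by rewrite lee_fin.
by have [_] := Lfun_submod_closed mu p1'; apply.
Qed.

Lemma Lp_norm_lin (a : R) f g : f \in Lfun mu p%:E -> g \in Lfun mu p%:E ->
  (Lp_norm (a *: f + g) <= `|a| * Lp_norm f + Lp_norm g)%R.
Proof.
move=> Lf Lg; rewrite -lee_fin EFinD EFinM -!Lp_normE//; last exact: Lfun_lin.
have p1' : 1%E <= p%:E by rewrite lee_fin.
have /= <- := @LnormZ _ _ _ mu p%:E p1' (Lfun_Sub p1' Lf) a.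
apply: minkowski_EFin => //; last exact: Lfun_measurable.
by apply: measurable_funM => //; exact: Lfun_measurable.
Qed.

Lemma ae_eq_Lnorm (f g : T -> \bar R) : measurable_fun setT f -> measurable_fun setT g ->
  f = g %[ae mu] -> 'N[mu]_(p%:E)[f] = 'N[mu]_(p%:E)[g].
Proof.
move=> mf mg fg; rewrite unlock /Lnorm; congr (_ `^ _); apply: ae_eq_integral => //.
- exact: (measurableT_comp (measurable_poweR p) (measurableT_comp _ mf)).
- exact: (measurableT_comp (measurable_poweR p) (measurableT_comp _ mg)).
by apply: filterS fg => x fg _; rewrite fg.
Qed.

Lemma ereal_between (x y : \bar R) : x < y -> exists2 t, x < t & t < y.
Proof.
case: x y => [x| |] [y| |]//; rewrite ?lte_fin ?ltxx// => xy.
- by exists ((x + y) / 2)%:E; rewrite lte_fin ?(midf_lt xy).1 ?(midf_lt xy).2.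
- by exists (x + 1)%:E; rewrite ?ltry// lte_fin ltrDl.
- by exists (y - 1)%:E; rewrite ?ltNyr// lte_fin ltrBlDl ltrDr.
- by exists 0%E; rewrite ?ltNyr ?ltry.
Qed.

Lemma le_liminf (t : \bar R) (v : nat -> \bar R) :
  (\forall n \near \oo, t <= v n) -> t <= limn_einf v.
Proof.
move=> [N _ Nv]; rewrite limn_einf_lim; apply: lime_ge; first exact: is_cvg_einfs.
exists N => // n /= Nn; apply: le_ereal_inf_tmp => _ [k /= nk <-].
by apply: Nv => /=; exact: leq_trans nk.
Qed.

(** Fatou's lemma for the p-th powers. Their lower semicontinuity along [v] is obtained from
    monotonicity of powers and the convergence of the absolute values. *)
Lemma Lnorm_fatou (v : nat -> T -> \bar R) (f : T -> \bar R) (M : R) : (0 <= M)%R ->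
  (forall n, measurable_fun setT (v n)) -> measurable_fun setT f ->
  {ae mu, forall x, v ^~ x @ \oo --> f x} ->
  (forall n, 'N[mu]_(p%:E)[v n] <= M%:E) -> 'N[mu]_(p%:E)[f] <= M%:E.
Proof.
move=> M0 mv mf vf vM.
have mvp n : measurable_fun setT (fun x => `|v n x| `^ p).
  exact: (measurableT_comp (measurable_poweR p) (measurableT_comp _ (mv n))).
have mfp : measurable_fun setT (fun x => `|f x| `^ p).
  exact: (measurableT_comp (measurable_poweR p) (measurableT_comp _ mf)).
have powK (x : \bar R) : 0 <= x -> (x `^ p) `^ p^-1 = x.
  by move=> x0; rewrite -poweRrM mulfV ?gt_eqF// poweRe1.
have le_pow (r : R) (x y : \bar R) : (0 <= r)%R -> 0 <= x -> x <= y -> x `^ r <= y `^ r.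
  move=> r0 x0 xy; apply: gt0_ler_poweR => //; rewrite in_itv/= leey andbT//.
  exact: le_trans xy.
have pV0 : (0 <= p^-1)%R by rewrite invr_ge0 ltW.
have powM x : 0 <= x -> (x <= M%:E) = (x `^ p <= (M `^ p)%:E).
  move=> x0; apply/idP/idP => [xM|]; first by rewrite -poweR_EFin le_pow// ltW.
  by move=> /(le_pow _ _ _ pV0 (poweR_ge0 _ _)); rewrite -poweR_EFin !powK.
rewrite powM ?Lnorm_ge0// powR_Lnorm ?gt_eqF//.
have vMp n : \int[mu]_x `|v n x| `^ p <= (M `^ p)%:E.
  by rewrite -powR_Lnorm ?gt_eqF// -powM ?Lnorm_ge0.
apply: (@le_trans _ _ (\int[mu]_x limn_einf (fun n => `|v n x| `^ p))).
  apply: ae_ge0_le_integral => //.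
  - by move=> x _; exact: poweR_ge0.
  - by move=> x _; apply: le_liminf; apply: nearW => n; exact: poweR_ge0.
  - rewrite /limn_einf; apply: measurableT_comp => //.
    by apply: measurable_fun_limn_esup => n; exact: measurableT_comp.
  apply: filterS vf => x vfx _; rewrite leNgt; apply/negP => lf.
  (* If [t] lies strictly between the limit inferior and the power of the limit, eventually all
     powers are at least [t], a contradiction. *)
  have [t lt tf] := ereal_between lf.
  have t0 : 0 <= t.
    by apply: le_trans (ltW lt); apply: le_liminf; apply: nearW => n; exact: poweR_ge0.
  move: lt; apply/negP; rewrite -leNgt; apply: le_liminf.
  have : t `^ p^-1 < `|f x|.
    rewrite ltNge; apply/negP => ft; move: tf; rewrite ltNge => /negP; apply.
    have := le_pow _ _ _ (ltW p0) (abse_ge0 _) ft.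
    by rewrite -poweRrM mulVf ?gt_eqF// poweRe1.
  move=> tf'; have : \forall n \near \oo, t `^ p^-1 < `|v n x|.
    have vf : `|v n x| @[n --> \oo] --> `|f x| by exact: cvg_abse.
    apply: (vf [set y | t `^ p^-1 < y]).
    by apply: open_nbhs_nbhs; split => //; exact: open_ereal_gt_ereal.
  apply: filterS => n tv; have := le_pow _ _ _ (ltW p0) (poweR_ge0 _ _) (ltW tv).
  by rewrite -poweRrM mulVf ?gt_eqF// poweRe1.
apply: le_trans (fatou mu measurableT mvp _) _.
  by move=> n x _; exact: poweR_ge0.
rewrite limn_einf_lim; apply: lime_le; first exact: is_cvg_einfs.
apply: nearW => n; apply: le_trans (vMp n).
by apply: ereal_inf_lbound; exists n => /=.
Qed.

Lemma geometric_half_le (c : R) n : (0 <= c)%R ->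
  (\sum_(k < n) c * 2^-1 ^+ k <= 2 * c)%R.
Proof.
move=> c0; suff -> : (\sum_(k < n) c * 2^-1 ^+ k = 2 * c * (1 - 2^-1 ^+ n))%R.
  by rewrite ler_piMr ?mulr_ge0// lerBlDr lerDl exprn_ge0// invr_ge0.
elim: n => [|n IH]; first by rewrite big_ord0 expr0 subrr mulr0.
by rewrite big_ord_recr/= IH exprS; field.
Qed.

Section geometric.
Variables (u : nat -> T -> R) (c : R).
Hypotheses (Lu : forall k, u k \in Lfun mu p%:E)
  (uc : forall k, (Lp_norm (u k) <= c * 2^-1 ^+ k)%R).

Let c0 : (0 <= c)%R.
Proof. by have := uc 0; rewrite expr0 mulr1; apply: le_trans; exact: Lp_norm_ge0. Qed.

Let mu_ k : measurable_fun setT (u k). Proof. exact: Lfun_measurable. Qed.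

Lemma Lp_norm_partial_sum n :
  'N[mu]_(p%:E)[EFin \o (fun x => \sum_(k < n) `|u k x|)%R] <= (2 * c)%:E.
Proof.
have Labs k : 'N[mu]_(p%:E)[EFin \o (fun x => `|u k x|)%R] <= (c * 2^-1 ^+ k)%:E.
  apply: (@le_trans _ _ 'N[mu]_(p%:E)[EFin \o u k]).
    by apply: le_Lnorm => x /=; rewrite normr_id.
  by rewrite Lp_normE// lee_fin.
have mS n' : measurable_fun setT (fun x => \sum_(k < n') `|u k x|)%R.
  by apply: measurable_sum => k; exact: measurableT_comp.
apply: le_trans (_ : _ <= (\sum_(k < n) c * 2^-1 ^+ k)%:E) _; last first.
  by rewrite lee_fin geometric_half_le.
elim: n => [|n IH].
  rewrite big_ord0 (_ : (fun x => _) = cst 0%R); last by apply/funext => x; rewrite big_ord0.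
  by rewrite -[X in 'N[mu]_(_)[X]]/(cst 0%E) Lnorm0// eqe gt_eqF.
rewrite big_ord_recr EFinD.
rewrite (_ : (fun x => _) = (fun x => \sum_(k < n) `|u k x|) \+ (fun x => `|u n x|))%R; last first.
  by apply/funext => x; rewrite big_ord_recr.
apply: le_trans (minkowski_EFin _ (mS n) _ p1) (leeD IH (Labs n)).
exact: measurableT_comp.
Qed.

(** The sum is prescribed rather than constructed, so that the bound applies to tails and to a
    function already obtained from another series. The constant 2 is the sum of the geometric
    series. *)
Lemma Lp_series_bound f : measurable_fun setT f ->
  {ae mu, forall x, series (u ^~ x) @ \oo --> f x} ->
  f \in Lfun mu p%:E /\ (Lp_norm f <= 2 * c)%R.
Proof.
move=> mf uf.
have fc : 'N[mu]_(p%:E)[EFin \o f] <= (2 * c)%:E.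
  apply: (@Lnorm_fatou (fun n x => (series (u ^~ x) n)%:E)) => //.
  - by rewrite mulr_ge0.
  - by move=> n; apply/measurable_EFinP; rewrite /series/=; exact: measurable_sum.
  - exact/measurable_EFinP.
  - by apply: filterS uf => x ufx; apply: cvg_EFin; [exact: nearW|exact: ufx].
  move=> n; apply: le_trans (Lp_norm_partial_sum n); apply: le_Lnorm => x /=.
  rewrite lee_fin /series/= big_mkord [leRHS]ger0_norm ?sumr_ge0//.
  exact: ler_norm_sum.
have Lf : f \in Lfun mu p%:E by apply/Lfun_ltyP; split => //; rewrite (le_lt_trans fc)// ltry.
by split => //; rewrite -lee_fin -Lp_normE.
Qed.

(** The Riesz-Fischer argument: the sum [h] of the absolute values has finite L^p norm, hence is
    finite almost everywhere. Nonnegativity is kept at every point because the sum of upper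
    gradients has to be nonnegative everywhere. *)
Lemma Lp_series_cvg : exists f : T -> R, [/\ measurable_fun setT f,
  (forall k x, 0 <= u k x)%R -> (forall x, 0 <= f x)%R &
  {ae mu, forall x, series (u ^~ x) @ \oo --> f x}].
Proof.
pose h x := \sum_(k <oo) `|u k x|%:E.
have mu1 k : measurable_fun setT (fun x => `|u k x|%:E).
  by apply/measurable_EFinP; exact: measurableT_comp.
have mh : measurable_fun setT h by apply: ge0_emeasurable_sum.
have h0 x : 0 <= h x by apply: nneseries_ge0.
have hc : 'N[mu]_(p%:E)[h] <= (2 * c)%:E.
  apply: (@Lnorm_fatou (fun n x => \sum_(0 <= k < n) `|u k x|%:E)) => //.
  - by rewrite mulr_ge0.
  - by move=> n; exact: emeasurable_sum.
  - by apply: nearW => x; apply: is_cvg_nneseries.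
  move=> n; apply: le_trans (Lp_norm_partial_sum n); apply: le_Lnorm => x /=.
  by rewrite big_mkord sumEFin.
pose D : set T := [set x | h x < +oo].
have mD : measurable D by rewrite -[D]setTI; apply: emeasurable_fun_lt.
have hD : {ae mu, forall x, D x}.
  have : mu.-integrable setT (fun x => `|h x| `^ p).
    apply/integrableP; split.
      exact: (measurableT_comp (measurable_poweR p) (measurableT_comp _ mh)).
    under eq_integral do rewrite gee0_abs ?poweR_ge0//.
    by rewrite -powR_Lnorm ?gt_eqF// poweR_lty// (le_lt_trans hc)// ltry.
  move=> /(integrable_ae measurableT); apply: filterS => x /(_ I).
  rewrite ge0_fin_numE ?poweR_ge0// => /lty_poweRy.
  by rewrite gt_eqF// => /(_ isT); rewrite gee0_abs.
(* With the terms erased where [h] is infinite, the series converges at every point and its limit is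
   measurable. *)
pose w k (x : T) := (u k x * \1_D x)%R.
have cw x : cvgn (series (w ^~ x)).
  apply: normed_cvg; apply: nondecreasing_is_cvgn.
    by apply: nondecreasing_series => k _ _; exact: normr_ge0.
  have [Dx|Dx] := pselect (D x); last first.
    exists 0%R => _ [n _ <-]; rewrite /normed_series_of/series/= big1// => k _.
    by rewrite /w indicE memNset// mulr0 normr0.
  exists (fine (h x)) => _ [n _ <-]; rewrite -lee_fin fineK ?ge0_fin_numE//.
  rewrite /normed_series_of/series/= -sumEFin; apply: le_trans (nneseries_lim_ge n _) => //.
  by apply: lee_sum => k _; rewrite lee_fin /w indicE mem_set// mulr1.
exists (fun x => limn (series (w ^~ x))); split.
- apply: (@measurable_fun_cvg _ _ _ _ (fun n x => series (w ^~ x) n)).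
    move=> n; apply: measurable_sum => k.
    by apply: measurable_funM => //; exact: measurable_indic.
  by move=> x _; exact: cw.
- move=> u0 x; apply: limr_ge => //; apply: nearW => n.
  by apply: sumr_ge0 => k _; rewrite mulr_ge0.
apply: filterS hD => x Dx.
have -> : u ^~ x = w ^~ x by apply/funext => k; rewrite /w indicE mem_set// mulr1.
exact: cw.
Qed.

End geometric.

End Lp_series.

(** * Minimal upper gradients *)

Section minimal_upper_gradient.
Context {R : realType} {X : completeMetricType R}.
Local Notation CX := (borel (curve X)).
Local Notation RR := (measurableTypeR R).
Local Open Scope ereal_scope.
Variables (m : {measure set (borel X) -> \bar R}) (p : R).
Hypothesis p1 : (1 <= p)%R.
Implicit Types (f : borel X -> R).

Let p0 : (0 < p)%R. Proof. exact: lt_le_trans p1. Qed.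

(** Dominated convergence on the product of the plan with the unit interval; the density of [G 0]
    dominates. *)
Lemma upper_gradient_lim f (G : nat -> borel X -> R) (H : borel X -> R) :
  (forall n, upper_gradient m p f (G n)) -> G 0%N \in Lfun m p%:E ->
  (forall n x, G n x <= G 0%N x)%R -> (forall x, G ^~ x @ \oo --> H x) ->
  upper_gradient m p f H.
Proof.
move=> UG LG G_le GH.
have mG n : measurable_fun setT (G n) by case: (UG n).
have G0 n x : (0 <= G n x)%R by case: (UG n).
have mH : measurable_fun setT H by exact: (measurable_fun_cvg mG (fun x _ => GH x)).
have H0 x : (0 <= H x)%R 
  by rewrite -(cvg_lim _ (GH x))//; apply: limr_ge; [exact: cvgP (GH x)|exact: nearW].
have H_le x : (H x <= G 0%N x)%R.
  by rewrite -(cvg_lim _ (GH x))//; apply: limr_le; [exact: cvgP (GH x)|exact: nearW].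
split; [exact: mH|exact: H0|move=> P HP].
have mD n := measurable_plan_density (mG n); have D0 n z := plan_density_ge0 z (G0 n).
have mDH := measurable_plan_density mH; have DH0 z := plan_density_ge0 z H0.
pose mu := (P \x @leb01_finite R)%E.
have fub (F : CX * RR -> \bar R) : measurable_fun setT F -> (forall z, 0 <= F z) ->
    \int[mu]_z F z = \int[P]_g \int[leb01]_t F (g, t).
  move=> mF F0; exact: (@fubini_tonelli1 _ _ _ _ _ P (@leb01_finite R)).
have iD : mu.-integrable setT (plan_density (G 0%N)).
  apply/integrableP; split => //; under eq_integral do rewrite gee0_abs//.
  by rewrite fub//; exact: plan_integral_fin HP.
have cD : {ae mu, forall z, setT z -> plan_density (G n) z @[n --> \oo] --> plan_density H z}.
  have := integrable_ae measurableT iD; apply: filterS => -[g t] /(_ I) Dfin _.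
  move: Dfin; rewrite /plan_density/=.
  have := metric_speed_ge0 (g : curve X) t.
  case: (metric_speed _ _) => [v|_|]//=.
    move=> v0 _; rewrite -EFinM; apply: cvg_EFin; first exact: nearW.
    by apply: cvgMl; exact: GH.
  (* At infinite speed, finiteness of the dominating density forces [G 0] to vanish at [y], and with
     it all [G n] and [H]. *)
  move: (curve_at t (g : curve X)) => y; have [G00|G00] := eqVneq (G 0%N y) 0%R; last first.
    by rewrite gt0_muley// lte_fin lt_neqAle eq_sym G00 G0.
  have -> : H y = 0%R by apply/le_anti; rewrite H0 -G00 H_le.
  move=> _; rewrite mul0e; apply: cvg_near_cst; apply: nearW => n.
  by have -> : G n y = 0%R; [apply/le_anti; rewrite G0 -G00 G_le|rewrite mul0e].
have Dle : {ae mu, forall z n, setT z -> `|plan_density (G n) z| <= plan_density (G 0%N) z}.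
  apply: nearW => z n _; rewrite gee0_abs//.
  by rewrite lee_wpmul2r ?metric_speed_ge0// lee_fin.
have [_ _ cv] := dominated_convergence measurableT mD mDH cD iD Dle.
rewrite -[leRHS]/(\int[P]_g \int[leb01]_t plan_density H (g, t)) -fub//.
apply: (cvge_ge _ cv); apply: nearW => n /=; rewrite fub//.
by have [_ _] := UG n; apply.
Qed.

(** The nonnegative difference of the p-th powers has integral zero, because the integral for [K] is
    finite and can be cancelled. *)
Lemma Lp_norm_eq_ae (K G : borel X -> R) : K \in Lfun m p%:E -> G \in Lfun m p%:E ->
  (forall x, 0 <= K x)%R -> (forall x, K x <= G x)%R ->
  (Lp_norm m p G <= Lp_norm m p K)%R -> {ae m, forall x, (G x <= K x)%R}.
Proof.
move=> LK LG K0 KG; rewrite -lee_fin -!Lp_normE// => nGK.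
have G0 x : (0 <= G x)%R by exact: le_trans (KG x).
have mP (F : borel X -> R) : F \in Lfun m p%:E -> measurable_fun setT (fun x => F x `^ p)%R.
  by move=> /Lfun_measurable mF; exact: (measurableT_comp (measurable_powR p) mF).
have iP (F : borel X -> R) : (forall x, 0 <= F x)%R ->
    \int[m]_x (F x `^ p)%:E = 'N[m]_(p%:E)[EFin \o F] `^ p.
  move=> F0; rewrite powR_Lnorm; last by rewrite gt_eqF.
  apply: eq_integral => x _.
  by rewrite /= ger0_norm.
have KGp x : (K x `^ p <= G x `^ p)%R by rewrite ge0_ler_powR ?nnegrE// ltW.
have mB : measurable_fun setT (fun x => (G x `^ p - K x `^ p)%:E).
  by apply/measurable_EFinP; apply: measurable_funB; exact: mP.
have B0 x : 0 <= (G x `^ p - K x `^ p)%:E by rewrite lee_fin subr_ge0.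
have : \int[m]_x `|(G x `^ p - K x `^ p)%:E| = 0.
  under eq_integral do rewrite gee0_abs//.
  have : \int[m]_x (G x `^ p)%:E = \int[m]_x (K x `^ p)%:E + \int[m]_x (G x `^ p - K x `^ p)%:E.
    rewrite -ge0_integralD//; last 2 first.
    - by move=> x _; rewrite lee_fin powR_ge0.
    - by apply/measurable_EFinP; exact: mP LK.
    by apply: eq_integral => x _; rewrite -EFinD addrC subrK.
  have : \int[m]_x (G x `^ p)%:E <= \int[m]_x (K x `^ p)%:E.
    rewrite !iP//; apply: gt0_ler_poweR => //; rewrite ?ltW//;
    by rewrite in_itv/= leey Lnorm_ge0.
  have : \int[m]_x (K x `^ p)%:E \is a fin_num.
    by rewrite iP// fin_num_poweR// Lp_normE.
  have : 0 <= \int[m]_x (G x `^ p - K x `^ p)%:E by exact: integral_ge0.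
  move: (\int[m]_x _) (\int[m]_x _) (\int[m]_x _) => a b c + /fineK <-.
  move: (fine b) => {}b; case: a => [a||]//; case: c => [c||]//=.
  by rewrite !lee_fin => a0 cb [cab]; congr EFin; lra.
move/ae_eq_integral_abs => /(_ measurableT mB); apply: filterS => x /(_ I) [].
move=> /eqP; rewrite subr_eq0 => /eqP GKp.
have pK y : (0 <= y)%R -> ((y `^ p) `^ p^-1 = y)%R.
  by move=> y0; rewrite -powRrM mulfV ?gt_eqF// powRr1.
by rewrite -(pK (G x))// GKp pK.
Qed.

Lemma Lp_upper_gradient_min f G1 G2 : measurable_fun setT f ->
  Lp_upper_gradient m p f G1 -> Lp_upper_gradient m p f G2 ->
  Lp_upper_gradient m p f (fun x => Num.min (G1 x) (G2 x)).
Proof.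
move=> mf [UG1 LG1] [UG2 LG2]; split; first exact: upper_gradient_min.
have [mG1 G10 _] := UG1; have [mG2 G20 _] := UG2.
apply: Lfun_le LG1 => //; first exact: measurable_minr.
by move=> x; rewrite !ger0_norm ?le_min ?G10 ?G20// ge_min lexx.
Qed.

(** Running minima [G] of a sequence minimizing the L^p norm decrease to [I], whose norm is the
    infimum. For any competitor [K], the minimum of [I] and [K] is again a competitor, so its norm
    is not smaller than that of [I], which forces [I <= K] almost everywhere. *)
Lemma min_upper_gradientP f : Sp m p f ->
  Lp_upper_gradient m p f (min_upper_gradient m p f) /\
  forall H, Lp_upper_gradient m p f H ->
    {ae m, forall x, (min_upper_gradient m p f x <= H x)%R}.
Proof.
move=> [mf [G1 LG1]].
set Q := [set G | Lp_upper_gradient m p f G /\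
    forall H, Lp_upper_gradient m p f H -> {ae m, forall x, (G x <= H x)%R}].
suff /(xgetPex (cst 0%R)) : exists G, Q G by [].
pose N := [set Lp_norm m p G | G in Lp_upper_gradient m p f].
have hN : has_inf N.
  split; first by exists (Lp_norm m p G1), G1.
  by exists 0%R => _ [G _ <-]; exact: Lp_norm_ge0.
have /choice[H HP] n : exists G, Lp_upper_gradient m p f G /\
    (Lp_norm m p G < inf N + n.+1%:R^-1)%R.
  have n0 : (0 < n.+1%:R^-1 :> R)%R by rewrite invr_gt0.
  by have [_ [G LG <-] Gn] := inf_adherent n0 hN; exists G.
pose G := fix G n := if n is k.+1 then (fun x => Num.min (G k x) (H n x)) else H 0%N.
have LG n : Lp_upper_gradient m p f (G n).
  elim: n => [|n IH]; first exact: (HP 0%N).1.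
  exact: (Lp_upper_gradient_min mf IH (HP n.+1).1).
have G0 n x : (0 <= G n x)%R by have [[_ + _] _] := LG n; exact.
have GH n x : (G n x <= H n x)%R by case: n => //= n; rewrite ge_min lexx orbT.
have ndG x : nonincreasing_seq (G ^~ x).
  by apply/nonincreasing_seqP => n /=; rewrite ge_min lexx.
have lG x : has_lbound (range (G ^~ x)) by exists 0%R => _ [n _ <-].
pose I x := inf (range (G ^~ x)).
have cG x : G ^~ x @ \oo --> I x by exact: nonincreasing_cvgn.
have IG n x : (I x <= G n x)%R by apply: ge_inf => //; exists n.
have I0 x : (0 <= I x)%R.
  by apply: lb_le_inf; [exists (G 0%N x), 0%N|move=> _ [n _ <-]].
have UI : upper_gradient m p f I.
  apply: (@upper_gradient_lim _ G) => //.
  - by move=> n; have [] := LG n.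
  - by have [] := LG 0%N.
  - by move=> n x; exact: ndG.
have LI : Lp_upper_gradient m p f I.
  split => //; have [mI _ _] := UI; have [_ LG0] := LG 0%N.
  by apply: Lfun_le LG0 => // x; rewrite !ger0_norm.
have NI : (Lp_norm m p I <= inf N)%R.
  apply/ler_addgt0Pr => e e0.
  have [n _ /(_ n (leqnn n)) ne] := near_infty_natSinv_lt (PosNum e0).
  have [[_ LHn] Hn] := HP n.
  apply: le_trans (ltW (lt_trans Hn _)); last by rewrite ltrD2l.
  rewrite -lee_fin -!Lp_normE//; last by case: LI.
  apply: le_Lnorm => // x; rewrite lee_fin !ger0_norm//.
    exact: le_trans (IG n x) (GH n x).
  exact: le_trans (G0 n x) (GH n x).
exists I; split => // K LK.
have LIK := Lp_upper_gradient_min mf LI LK.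
have [[_ IK0 _] LIK'] := LIK.
have : {ae m, forall x, I x <= Num.min (I x) (K x)}%R.
  apply: (Lp_norm_eq_ae LIK' LI.2 IK0) => [x|]; first by rewrite ge_min lexx.
  by apply: le_trans NI _; apply: ge_inf; [exact: hN.2|eexists; first exact: LIK].
by apply: filterS => x; rewrite le_min => /andP[].
Qed.

End minimal_upper_gradient.

(** * Sobolev norms *)

Section lp2.
Context {R : realType}.
Variable p : R.
Hypothesis p1 : 1 <= p.
Implicit Types a b c d k M : R.

Let p0 : 0 < p. Proof. exact: lt_le_trans p1. Qed.

(** The l^p norm of the plane on nonnegative entries. Both Sobolev norms have this form, so its
    triangle inequality yields theirs. *)
Definition lp2 a b := (a `^ p + b `^ p) `^ p^-1.

Lemma powRVK a : 0 <= a -> (a `^ p^-1) `^ p = a.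
Proof. by move=> a0; rewrite -powRrM mulVf ?gt_eqF// powRr1. Qed.

Lemma powRKV a : 0 <= a -> (a `^ p) `^ p^-1 = a.
Proof. by move=> a0; rewrite -powRrM mulfV ?gt_eqF// powRr1. Qed.

Let le_pow a b : 0 <= a -> a <= b -> a `^ p <= b `^ p.
Proof.
by move=> a0 ab; apply: ge0_ler_powR; rewrite ?nnegrE ?(ltW p0) ?(le_trans a0 ab).
Qed.

Lemma lp2_ge0 a b : 0 <= lp2 a b.
Proof. exact: powR_ge0. Qed.

Lemma lp2X a b : lp2 a b `^ p = a `^ p + b `^ p.
Proof. by rewrite powRVK// addr_ge0// powR_ge0. Qed.

Lemma lp2_leP a b M : 0 <= M -> (lp2 a b <= M) = (a `^ p + b `^ p <= M `^ p).
Proof.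
move=> M0; apply/idP/idP => [abM|]; first by rewrite -lp2X le_pow// lp2_ge0.
move=> abM; rewrite -[leRHS](powRKV M0).
by rewrite ge0_ler_powR ?nnegrE ?invr_ge0 ?addr_ge0 ?powR_ge0// ltW.
Qed.

Lemma lp2r0 a : 0 <= a -> lp2 a 0 = a.
Proof. by move=> a0; rewrite /lp2 powR0 ?gt_eqF// addr0 powRKV. Qed.

Lemma lp20r a : 0 <= a -> lp2 0 a = a.
Proof. by move=> a0; rewrite /lp2 powR0 ?gt_eqF// add0r powRKV. Qed.

Lemma le_lp2 a b c d : 0 <= a -> a <= c -> 0 <= b -> b <= d -> lp2 a b <= lp2 c d.
Proof. by move=> a0 ac b0 bd; rewrite lp2_leP ?lp2_ge0// lp2X lerD// le_pow. Qed.

Lemma ler_lp2 a b : 0 <= a -> a <= lp2 a b.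
Proof.
by move=> a0; rewrite -[leLHS]powRKV// ge0_ler_powR ?nnegrE ?invr_ge0 ?addr_ge0
  ?powR_ge0 ?lerDl ?powR_ge0// ltW.
Qed.

Lemma lp2Z k a b : 0 <= k -> 0 <= a -> 0 <= b -> lp2 (k * a) (k * b) = k * lp2 a b.
Proof.
move=> k0 a0 b0; rewrite /lp2 !powRM// -mulrDr powRM ?powR_ge0 ?addr_ge0 ?powR_ge0//.
by rewrite powRKV.
Qed.

(* Convexity of the p-th power at a + b = A (a / A) + B (b / B), with weights
   A / (A + B) and B / (A + B) for the norms A and B. *)
Lemma ler_lp2D a b c d : 0 <= a -> 0 <= b -> 0 <= c -> 0 <= d ->
  lp2 (a + b) (c + d) <= lp2 a c + lp2 b d.
Proof.
move=> a0 b0 c0 d0; have [A0 B0] := (lp2_ge0 a c, lp2_ge0 b d).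
have [AE BE] := (lp2X a c, lp2X b d).
move: (lp2 a c) (lp2 b d) A0 B0 AE BE => A B A0 B0 AE BE.
have zero x y : 0 <= x -> 0 `^ p = x `^ p + y `^ p -> x = 0.
  move=> x0; rewrite powR0 ?gt_eqF// => /esym/eqP.
  by rewrite paddr_eq0 ?powR_ge0// => /andP[/eqP/powR_eq0_eq0].
have [A00|A00] := eqVneq A 0.
  rewrite A00 in AE *; rewrite (zero _ _ a0 AE) (zero c a)//; last by rewrite addrC.
  by rewrite !add0r lp2_leP// BE.
have [B00|B00] := eqVneq B 0.
  rewrite B00 in BE *; rewrite (zero _ _ b0 BE) (zero d b)//; last by rewrite addrC.
  by rewrite !addr0 lp2_leP// AE.
have {A00}A0 : 0 < A by rewrite lt_neqAle eq_sym A00.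
have {B00}B0 : 0 < B by rewrite lt_neqAle eq_sym B00.
have AB0 : 0 < A + B by rewrite addr_gt0.
have w0 : 0 <= A / (A + B) by rewrite divr_ge0 ?ltW.
have w1 : A / (A + B) <= 1 by rewrite ler_pdivrMr// mul1r lerDl ltW.
pose w := Itv01 w0 w1.
have cvx x y : 0 <= x -> 0 <= y ->
    (x + y) `^ p <= (A + B) `^ p * ((A / (A + B)) * (x / A) `^ p + (B / (A + B)) * (y / B) `^ p).
  move=> x0 y0.
  have := @convex_powR R p p1 w (x / A) (y / B).
  have xA : 0 <= x / A by rewrite divr_ge0// ltW.
  have yB : 0 <= y / B by rewrite divr_ge0// ltW.
  rewrite !inE/= !in_itv/= !andbT => /(_ xA yB).
  rewrite [X in X `^ p <= _ -> _]convRE convRE/= /unstable.onem.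
  have -> : 1 - A / (A + B) = B / (A + B) by field; rewrite gt_eqF.
  have -> : A / (A + B) * (x / A) + B / (A + B) * (y / B) = (x + y) / (A + B).
    by field; rewrite !gt_eqF.
  move=> h; apply: le_trans (ler_wpM2l (powR_ge0 (A + B) p) h).
  rewrite -powRM; first by rewrite mulrC divfK// gt_eqF.
    exact: ltW.
  by rewrite divr_ge0 ?addr_ge0// ltW.
rewrite lp2_leP; last by rewrite ltW.
apply: le_trans (lerD (cvx _ _ a0 b0) (cvx _ _ c0 d0)) _.
have inv x y : 0 <= x -> 0 < y -> (x / y) `^ p = x `^ p / y `^ p.
  move=> x0 y0; have y0' := ltW y0; apply: (canRL (mulfK _)).
    by rewrite gt_eqF// powR_gt0.
  by rewrite -powRM ?divr_ge0// divfK// gt_eqF.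
rewrite !inv// -mulrDr.
have [Ap Bp] := (powR_gt0 p A0, powR_gt0 p B0).
set q := (X in _ * X); suff -> : q = 1 by rewrite mulr1.
have -> : q = A / (A + B) * ((a `^ p + c `^ p) / A `^ p) +
              B / (A + B) * ((b `^ p + d `^ p) / B `^ p) by rewrite /q; ring.
by rewrite -AE -BE !divff ?gt_eqF// !mulr1 -mulrDl divff ?gt_eqF.
Qed.

Lemma lp2_le_add a b : 0 <= a -> 0 <= b -> lp2 a b <= a + b.
Proof.
move=> a0 b0; have := @ler_lp2D a 0 0 b a0 (lexx 0) (lexx 0) b0.
by rewrite !addr0 !add0r lp2r0// lp20r.
Qed.

End lp2.

(** * The first order norm *)

Section first_order.
Context {R : realType} {X : completeMetricType R}.
Variables (m : {measure set (borel X) -> \bar R}) (p : R).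
Hypothesis p1 : 1 <= p.
Implicit Types (f g G : borel X -> R).
Local Notation n := (Lp_norm m p).
Local Notation D := (min_upper_gradient m p).

Let p0 : 0 < p. Proof. exact: lt_le_trans p1. Qed.

Definition W1_rnorm f := lp2 p (n f) (n (D f)).

Lemma W1_min f : W1 m p f -> Lp_upper_gradient m p f (D f).
Proof. by move=> [_ Sf]; have [] := min_upper_gradientP p1 Sf. Qed.

Lemma W1_normE f : W1 m p f -> W1_norm m p f = (W1_rnorm f)%:E.
Proof.
move=> Wf; have [Lf _] := Wf; have [_ LD] := W1_min Wf.
by rewrite /W1_norm !Lp_normE// !poweR_EFin -EFinD poweR_EFin.
Qed.

Lemma W1_rnorm_ge0 f : 0 <= W1_rnorm f.
Proof. exact: lp2_ge0. Qed.

Lemma W1_intro f G : f \in Lfun m p%:E -> Lp_upper_gradient m p f G -> W1 m p f.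
Proof.
by move=> Lf UG; split => //; split; [exact: Lfun_measurable Lf|exists G].
Qed.

(** By minimality of [D f]. Later bounds on the first order norm only have to exhibit some upper
    gradient. *)
Lemma W1_rnorm_le f G : f \in Lfun m p%:E -> Lp_upper_gradient m p f G ->
  W1_rnorm f <= lp2 p (n f) (n G).
Proof.
move=> Lf UG; have Wf := W1_intro Lf UG; have [_ LD] := W1_min Wf.
have [_ /(_ _ UG) DG] := min_upper_gradientP p1 Wf.2.
have [[mD D0 _] _] := W1_min Wf; have [[mG G0 _] LG] := UG.
apply: le_lp2 => //; rewrite ?Lp_norm_ge0//.
(* [le_Lnorm] compares functions at every point; the minimum with [G] is below [G] everywhere and
   equal to the minimal gradient almost everywhere. *)
have mM : measurable_fun setT (fun x => Num.min (D f x) (G x)) by exact: measurable_minr.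
rewrite -lee_fin -!Lp_normE//.
rewrite (@ae_eq_Lnorm _ _ _ m p _ (EFin \o (fun x => Num.min (D f x) (G x)))) //.
- apply: le_Lnorm => // x; rewrite lee_fin !ger0_norm ?le_min ?D0 ?G0//.
  by rewrite ge_min lexx orbT.
- exact/measurable_EFinP.
- exact/measurable_EFinP.
by apply: filterS DG => x DG _ /=; rewrite min_l.
Qed.

Lemma le_W1_rnorm f : n f <= W1_rnorm f.
Proof. by rewrite ler_lp2// Lp_norm_ge0. Qed.

Lemma Lp_upper_gradient0 : Lp_upper_gradient m p 0 0.
Proof. by split; [exact: upper_gradient0|exact: Lfun0]. Qed.

Lemma W1_0 : W1 m p 0.
Proof. by apply: W1_intro Lp_upper_gradient0; exact: Lfun0. Qed.

Lemma W1_rnorm0 : W1_rnorm 0 = 0.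
Proof.
apply/le_anti; rewrite W1_rnorm_ge0 andbT.
apply: le_trans (W1_rnorm_le (Lfun0 m p1) Lp_upper_gradient0) _.
by rewrite Lp_norm0// lp2r0.
Qed.

Lemma Lp_upper_gradient_lin a f g G1 G2 : measurable_fun setT f -> measurable_fun setT g ->
  Lp_upper_gradient m p f G1 -> Lp_upper_gradient m p g G2 ->
  Lp_upper_gradient m p (a *: f + g) (`|a| *: G1 + G2).
Proof.
move=> mf mg [UG1 LG1] [UG2 LG2]; split; first exact: upper_gradient_lin.
exact: Lfun_lin.
Qed.

Lemma lp2_lin (a b c d e : R) : 0 <= b -> 0 <= c -> 0 <= d -> 0 <= e ->
  lp2 p (`|a| * b + d) (`|a| * c + e) <= `|a| * lp2 p b c + lp2 p d e.
Proof.
move=> b0 c0 d0 e0; apply: le_trans (ler_lp2D p1 _ d0 _ e0) _; rewrite ?mulr_ge0//.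
by rewrite lp2Z.
Qed.

Lemma W1_lin a f g : W1 m p f -> W1 m p g ->
  W1 m p (a *: f + g) /\ W1_rnorm (a *: f + g) <= `|a| * W1_rnorm f + W1_rnorm g.
Proof.
move=> Wf Wg; have [Lf _] := Wf; have [Lg _] := Wg.
have Lfg : (a *: f + g) \in Lfun m p%:E by exact: Lfun_lin.
have [mf mg] := (Lfun_measurable Lf, Lfun_measurable Lg).
have U := Lp_upper_gradient_lin a mf mg (W1_min Wf) (W1_min Wg).
split; first exact: W1_intro Lfg U.
apply: le_trans (W1_rnorm_le Lfg U) _.
have n0 h := Lp_norm_ge0 m p h.
apply: le_trans (lp2_lin a (n0 f) (n0 (D f)) (n0 g) (n0 (D g))).
have [_ LDf] := W1_min Wf; have [_ LDg] := W1_min Wg.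
apply: (le_lp2 p1 (n0 _) _ (n0 _)); first exact: Lp_norm_lin.
by rewrite -{2}(normr_id a); exact: Lp_norm_lin.
Qed.

(** The constant 4 is 2 for [f] plus 2 for the sum of the minimal gradients. The rate need not be
    strict because the minimal gradients attain the norms. *)
Lemma W1_series (u : nat -> borel X -> R) (c : R) f :
  (forall k, W1 m p (u k)) -> (forall k, W1_rnorm (u k) <= c * 2^-1 ^+ k) ->
  measurable_fun setT f -> {ae m, forall x, series (u ^~ x) @ \oo --> f x} ->
  W1 m p f /\ W1_rnorm f <= 4 * c.
Proof.
move=> Wu uc mf uf.
have Lu k : u k \in Lfun m p%:E by case: (Wu k).
have UD k := W1_min (Wu k).
have LD k : D (u k) \in Lfun m p%:E by case: (UD k).
have nu k : n (u k) <= c * 2^-1 ^+ k by exact: le_trans (le_W1_rnorm _) (uc k).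
have nD k : n (D (u k)) <= c * 2^-1 ^+ k.
  apply: le_trans (uc k); rewrite /W1_rnorm /lp2 addrC; apply: ler_lp2 => //.
  exact: Lp_norm_ge0.
have [Lf fc] := Lp_series_bound p1 Lu nu mf uf.
have [H [mH H0 DH]] := Lp_series_cvg p1 LD nD.
have {}H0 x : 0 <= H x by apply: H0 => k y; have [[_ + _] _] := UD k; exact.
have [LH Hc] := Lp_series_bound p1 LD nD mH DH.
have UH : Lp_upper_gradient m p f H.
  split => //; apply: (upper_gradient_series _ mf _ mH H0 uf DH).
    by move=> k; exact: Lfun_measurable (Lu k).
  by move=> k; have [] := UD k.
split; first exact: W1_intro Lf UH.
apply: le_trans (W1_rnorm_le Lf UH) _.
apply: le_trans (lp2_le_add p1 (Lp_norm_ge0 _ _ _) (Lp_norm_ge0 _ _ _)) _.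
by apply: le_trans (lerD fc Hc) _; rewrite -mulrDl -natrD.
Qed.

End first_order.

(** * The second order norm *)

Section second_order.
Context {R : realType} {X : completeMetricType R}.
Variables (m : {measure set (borel X) -> \bar R}) (p : R).
Hypothesis p1 : 1 <= p.
Implicit Types (f g G : borel X -> R).
Local Notation n := (Lp_norm m p).
Local Notation N1 := (W1_rnorm m p).

Let p0 : 0 < p. Proof. exact: lt_le_trans p1. Qed.

Definition W1_upper_gradient f := upper_gradient m p f `&` W1 m p.

(** An infimum of norms rather than of their p-th powers, which makes [W2_rnorm] an [lp2];
    [W2_normE] shows that the two agree. *)
Definition W1_upper_gradient_inf f : R :=
  inf [set N1 G | G in W1_upper_gradient f].

Definition W2_rnorm f := lp2 p (n f) (W1_upper_gradient_inf f).
Local Notation I := W1_upper_gradient_inf.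

Lemma has_inf_W1_upper_gradient f : W2 m p f -> has_inf [set N1 G | G in W1_upper_gradient f].
Proof.
move=> [_ [G UG]]; split; first by exists (N1 G), G.
by exists 0 => _ [H _ <-]; exact: W1_rnorm_ge0.
Qed.

Lemma W1_upper_gradient_inf_ge0 f : 0 <= I f.
Proof.
rewrite /W1_upper_gradient_inf.
have [->|ne] := eqVneq [set N1 G | G in W1_upper_gradient f] set0; first by rewrite inf0.
apply: lb_le_inf; first exact/set0P.
by move=> _ [G _ <-]; exact: W1_rnorm_ge0.
Qed.

Lemma W1_upper_gradient_inf_le f G : W1_upper_gradient f G -> I f <= N1 G.
Proof.
move=> UG; apply: ge_inf; last by exists G.
by exists 0 => _ [H _ <-]; exact: W1_rnorm_ge0.
Qed.

Lemma W2_normE f : W2 m p f -> W2_norm m p f = (W2_rnorm f)%:E.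
Proof.
move=> Wf; have [[Lf _] _] := Wf; have hI := has_inf_W1_upper_gradient Wf.
have I0 := W1_upper_gradient_inf_ge0 f.
rewrite /W2_norm Lp_normE// poweR_EFin.
suff -> : ereal_inf [set (W1_norm m p G `^ p)%E | G in W1_upper_gradient f] =
    (I f `^ p)%:E by rewrite -EFinD poweR_EFin.
apply/le_anti/andP; split; last first.
  apply: le_ereal_inf_tmp => _ [G UG <-].
  rewrite (W1_normE p1 UG.2) poweR_EFin lee_fin.
  rewrite ge0_ler_powR ?nnegrE ?W1_rnorm_ge0 ?W1_upper_gradient_inf_le//.
  exact: ltW.
apply/lee_addgt0Pr => e e0.
have Ie0 : 0 <= I f `^ p + e by rewrite addr_ge0 ?powR_ge0// ltW.
(* The root turns the slack [e] between p-th powers into a strict one between norms, which some [G]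
   realizes. *)
have IIe : I f < (I f `^ p + e) `^ p^-1.
  rewrite -[ltLHS](powRKV p1 I0) gt0_ltr_powR ?invr_gt0 ?nnegrE ?powR_ge0//.
  by rewrite ltrDl.
have [_ [G UG <-] Ge] := inf_lt hI.1 IIe.
apply: le_trans (ereal_inf_lbound _) _; first by exists G; [exact: UG|reflexivity].
rewrite (W1_normE p1 UG.2) poweR_EFin -EFinD lee_fin -[leRHS](powRVK p1 Ie0).
rewrite ge0_ler_powR ?nnegrE ?W1_rnorm_ge0 ?powR_ge0// ltW//.
Qed.

Lemma W2_rnorm_le f G : W1_upper_gradient f G -> W2_rnorm f <= lp2 p (n f) (N1 G).
Proof.
move=> UG; apply: le_lp2 => //; rewrite ?Lp_norm_ge0 ?W1_upper_gradient_inf_ge0//.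
exact: W1_upper_gradient_inf_le.
Qed.

(** A slack [e / 2] in the second entry costs at most [e / 2] in the norm, by the triangle
    inequality of [lp2]. *)
Lemma W2_rnorm_approx f e : W2 m p f -> 0 < e ->
  exists2 G, W1_upper_gradient f G & lp2 p (n f) (N1 G) < W2_rnorm f + e.
Proof.
move=> Wf e0; have e20 : 0 < e / 2 by rewrite divr_gt0.
have [_ [G UG <-] Ge] := inf_adherent e20 (has_inf_W1_upper_gradient Wf).
exists G => //.
have nf := Lp_norm_ge0 m p f; have I0 := W1_upper_gradient_inf_ge0 f.
apply: (@le_lt_trans _ _ (lp2 p (n f + 0) (I f + e / 2))).
  by apply: le_lp2; rewrite ?addr0 ?W1_rnorm_ge0// ltW.
apply: le_lt_trans (ler_lp2D p1 nf (lexx 0) I0 (ltW e20)) _.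
by rewrite (lp20r p1 (ltW e20)) ltrD2l ltr_pdivrMr// ltr_pMr// ltr1n.
Qed.

Lemma le_W2_rnorm f : n f <= W2_rnorm f.
Proof. by rewrite ler_lp2// Lp_norm_ge0. Qed.

Lemma W2_intro f G : f \in Lfun m p%:E -> W1_upper_gradient f G -> W2 m p f.
Proof.
move=> Lf UG; have [UGf [LG _]] := UG; split; last by exists G.
exact: (W1_intro Lf (conj UGf LG)).
Qed.

(** The zero function is an upper gradient of any measurable function vanishing almost everywhere.
    This makes the norm well defined on classes. *)
Lemma W2_ae0 f : measurable_fun setT f -> f = 0 %[ae m] -> W2_rnorm f = 0.
Proof.
move=> mf f0; have Nf0 : n f = 0.
  rewrite /Lp_norm (@ae_eq_Lnorm _ _ _ m p _ (EFin \o 0)) //; first exact: Lp_norm0.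
  - exact/measurable_EFinP.
  - by apply/measurable_EFinP; exact: measurable_cst.
  - by apply: filterS f0 => x fx xT /=; rewrite fx.
have U0 : W1_upper_gradient f 0.
  split; last exact: W1_0.
  apply: (upper_gradient_ae (measurable_cst _) mf _ _ _ _ (upper_gradient0 m p)) => //.
  - by apply: filterS f0 => x fx xT; rewrite fx.
  - exact: measurable_cst.
  - exact: nearW.
apply/le_anti; rewrite lp2_ge0 andbT; apply: le_trans (W2_rnorm_le U0) _.
by rewrite Nf0 W1_rnorm0// lp2r0.
Qed.

Lemma W2_0 : W2 m p 0.
Proof.
apply: (@W2_intro _ 0); first exact: Lfun0.
by split; [exact: upper_gradient0|exact: W1_0].
Qed.

Lemma W2_lin a f g : W2 m p f -> W2 m p g ->
  W2 m p (a *: f + g) /\ W2_rnorm (a *: f + g) <= `|a| * W2_rnorm f + W2_rnorm g.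
Proof.
move=> Wf Wg; have [[Lf _] _] := Wf; have [[Lg _] _] := Wg.
have Lfg : (a *: f + g) \in Lfun m p%:E by exact: Lfun_lin.
have [mf mg] := (Lfun_measurable Lf, Lfun_measurable Lg).
have U G H : W1_upper_gradient f G -> W1_upper_gradient g H ->
    W1_upper_gradient (a *: f + g) (`|a| *: G + H).
  move=> [UG WG] [UH WH]; split; first exact: upper_gradient_lin.
  by have [] := W1_lin p1 `|a| WG WH.
split.
  by have [_ [G UG]] := Wf; have [_ [H UH]] := Wg; exact: W2_intro Lfg (U _ _ UG UH).
(* The gradients of [f] and [g] are optimal up to [k] each, and the first one is multiplied by the
   absolute value of [a]. *)
apply/ler_addgt0Pr => e e0; have [k k0 ke] : exists2 k, 0 < k & `|a| * k + k = e.
  exists (e / (`|a| + 1)); first by rewrite divr_gt0// ltr_wpDl.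
  by rewrite -{2}[e / _]mul1r -mulrDl mulrC divfK// gt_eqF// ltr_wpDl.
have [G UG Ge] := W2_rnorm_approx Wf k0; have [H UH He] := W2_rnorm_approx Wg k0.
apply: le_trans (W2_rnorm_le (U _ _ UG UH)) _.
have n0 h := Lp_norm_ge0 m p h; have N0 h := W1_rnorm_ge0 m p h.
apply: (@le_trans _ _ (`|a| * lp2 p (n f) (N1 G) + lp2 p (n g) (N1 H))).
  apply: le_trans (lp2_lin p1 a (n0 f) (N0 G) (n0 g) (N0 H)).
  apply: (le_lp2 p1 (n0 _) _ (N0 _)); first exact: Lp_norm_lin.
  have [_] := W1_lin p1 `|a| UG.2 UH.2; by rewrite normr_id.
move: (lp2 p _ _) (lp2 p _ _) (W2_rnorm f) (W2_rnorm g) Ge He => x y z w xz yw.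
by rewrite -ke addrACA -mulrDr lerD ?ler_wpM2l// ltW.
Qed.

(** The strict rate leaves room for gradients [G] obeying the same rate. The constant 6 is 2 for [f]
    plus 4 for their sum, which [W1_series] places in the first order space. *)
Lemma W2_series (u : nat -> borel X -> R) (c : R) f :
  (forall k, W2 m p (u k)) -> (forall k, W2_rnorm (u k) < c * 2^-1 ^+ k) ->
  measurable_fun setT f -> {ae m, forall x, series (u ^~ x) @ \oo --> f x} ->
  W2 m p f /\ W2_rnorm f <= 6 * c.
Proof.
move=> Wu uc mf uf.
have Lu k : u k \in Lfun m p%:E by have [[]] := Wu k.
have /choice[G GP] k : exists G, W1_upper_gradient (u k) G /\
    lp2 p (n (u k)) (N1 G) < c * 2^-1 ^+ k.
  have e0 : 0 < c * 2^-1 ^+ k - W2_rnorm (u k) by rewrite subr_gt0.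
  have [G UG] := W2_rnorm_approx (Wu k) e0; rewrite addrC subrK => Gc.
  by exists G.
have UG k := (GP k).1; have WG k := (UG k).2.
have nu k : n (u k) <= c * 2^-1 ^+ k.
  by apply: le_trans (ltW (uc k)); exact: le_W2_rnorm.
have NG k : N1 (G k) <= c * 2^-1 ^+ k.
  apply: le_trans (ltW (GP k).2); rewrite /lp2 addrC; apply: ler_lp2 => //.
  exact: W1_rnorm_ge0.
have nG k : n (G k) <= c * 2^-1 ^+ k by apply: le_trans (NG k); exact: le_W1_rnorm.
have LG k : G k \in Lfun m p%:E by case: (WG k).
have [Lf fc] := Lp_series_bound p1 Lu nu mf uf.
have [H [mH H0 GH]] := Lp_series_cvg p1 LG nG.
have {}H0 x : 0 <= H x by apply: H0 => k y; have [[_ + _] _] := UG k; exact.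
have [WH Hc] := W1_series p1 WG NG mH GH.
have UH : W1_upper_gradient f H.
  split => //; apply: (upper_gradient_series _ mf _ mH H0 uf GH).
    by move=> k; exact: Lfun_measurable (Lu k).
  by move=> k; have [] := UG k.
split; first exact: W2_intro Lf UH.
apply: le_trans (W2_rnorm_le UH) _.
apply: le_trans (lp2_le_add p1 (Lp_norm_ge0 _ _ _) (W1_rnorm_ge0 _ _ _)) _.
by apply: le_trans (lerD fc Hc) _; rewrite -mulrDl -natrD.
Qed.

End second_order.

(** * Completeness of the modified second order space *)

Section modified_sobolev_space.
Context {R : realType} {X : completeMetricType R}.
Variables (m : {measure set (borel X) -> \bar R}) (p : R).
Hypothesis p1 : 1 <= p.

(** One inequality is a case of [W2_lin]; the other one is the same inequality for the inverse of
    [a]. *)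
Lemma W2_normZ a (f : borel X -> R) : W2 m p f -> W2_rnorm m p (a *: f) = `|a| * W2_rnorm m p f.
Proof.
move=> Wf; have W0 := W2_0 m p1.
have N0 : W2_rnorm m p 0 = 0.
  by apply: W2_ae0 => //; [exact: measurable_cst|exact: nearW].
have le b g : W2 m p g -> W2_rnorm m p (b *: g) <= `|b| * W2_rnorm m p g.
  by move=> Wg; have [_] := W2_lin p1 b Wg W0; rewrite addr0 N0 addr0.
have [->|a0] := eqVneq a 0; first by rewrite scale0r N0 normr0 mul0r.
apply/le_anti; rewrite le//=.
have Waf : W2 m p (a *: f) by have [+ _] := W2_lin p1 a Wf W0; rewrite addr0.
have := le a^-1 _ Waf; rewrite scalerA mulVf// scale1r normfV.
by rewrite ler_pdivlMl ?normr_gt0.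
Qed.

(** The sum [f] is first obtained in L^p alone. Each remainder is the sum of a tail, and the tail
    starting at 0 shows that [f] belongs to the space. *)
Lemma W2_complete (u : nat -> borel X -> R) :
  (forall k, W2 m p (u k) /\ W2_rnorm m p (u k) < 2^-1 ^+ k) ->
  exists2 f, W2 m p f & forall k, W2_rnorm m p (f - \sum_(i < k) u i) <= 6 * 2^-1 ^+ k.
Proof.
move=> uP; have Wu k := (uP k).1.
have Lu k : u k \in Lfun m p%:E by have [[]] := Wu k.
have mu k : measurable_fun setT (u k) by exact: Lfun_measurable (Lu k).
have nu k : Lp_norm m p (u k) <= 1 * 2^-1 ^+ k.
  by rewrite mul1r; apply: le_trans (ltW (uP k).2); exact: le_W2_rnorm.
have [f [mf _ uf]] := Lp_series_cvg p1 Lu nu.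
have tail k : W2 m p (f - \sum_(i < k) u i) /\
    W2_rnorm m p (f - \sum_(i < k) u i) <= 6 * 2^-1 ^+ k.
  have sumE x : (\sum_(i < k) u i) x = series (u ^~ x) k.
    by rewrite /series/= big_mkord fct_sumE.
  (* The tail starting at [k] has the rate of [W2_series] with [c] equal to [2^-1 ^+ k]. *)
  apply: (W2_series p1 (u := fun i => u (k + i)%N)) => //.
  - by move=> i; rewrite -exprD; exact: (uP _).2.
  - apply: measurable_funB => //.
    rewrite (_ : \sum_(i < k) u i = fun x => \sum_(i < k) u i x).
      exact: measurable_sum.
    by apply/funext => x; rewrite fct_sumE.
  apply: filterS uf => x ufx.
  rewrite -[X in _ --> X]/(f x - (\sum_(i < k) u i) x) sumE.
  have -> : series (fun i => u (k + i)%N x) = (fun j => series (u ^~ x) (j + k)%N - series (u ^~ x) k).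
    apply/funext => j; rewrite sub_series_geq ?leq_addl// -[X in \sum_(X <= _ < _) _]add0n big_addn addnK.
    by apply: eq_bigr => i _; rewrite addnC.
  apply: cvgB; last exact: cvg_cst.
  by rewrite cvg_shiftn.
exists f; last by move=> k; exact: (tail k).2.
by have [+ _] := tail 0%N; rewrite big_ord0 subr0.
Qed.

(** Transparent, so that its projections reduce to [W2] and [W2_rnorm]. *)
Definition W2_seminormed : seminormed_space (borel X -> R).
Proof.
apply: (@SeminormedSpace R _ (W2 m p) (W2_rnorm m p)).
- exact: W2_0.
- by move=> a f g Wf Wg; have [] := W2_lin p1 a Wf Wg.
- by move=> f g Wf Wg; have [_] := W2_lin p1 1 Wf Wg; rewrite scale1r normr1 mul1r.
- exact: W2_normZ.
- by exists 6 => // u; exact: W2_complete.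
Defined.

End modified_sobolev_space.

Theorem proposition4p6 (R : realType) (X : completeMetricType R)
    (m : {measure set (borel X) -> \bar R}) (K N p : R) :
  metric_measure_space m -> 1 <= N -> RCD m K N -> 1 <= p ->
  banach_mod_ae m (W2 m p) (W2_norm m p).
Proof.
move=> _ _ _ p1; split; first exact: W2_0.
  by move=> a f g Wf Wg; have [] := W2_lin p1 a Wf Wg.
have [B [cl [cl_lin cl_eq cl_surj cl_norm]]] := seminorm_quotient_complete (W2_seminormed m p1).
exists B, cl; split => //; last by move=> f Wf; rewrite W2_normE// cl_norm.
move=> f g Wf Wg; rewrite cl_eq//=.
have [[[Lf _] _] [[Lg _] _]] := (Wf, Wg).
have mfg : measurable_fun setT (f - g).
  by apply: measurable_funB; apply: Lfun_measurable; [exact: Lf|exact: Lg].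
(* Functions equal almost everywhere are at distance zero by [W2_ae0]; conversely the norm dominates
   the L^p norm, which separates classes. *)
split => [fg0|fg]; last first.
  by apply: W2_ae0 => //; apply: filterS fg => x fg xT; rewrite -[LHS]/(f x - g x) fg// subrr.
have Wfg : W2 m p (f - g).
  by have [+ _] := W2_lin p1 (-1) Wg Wf; rewrite scaleN1r addrC.
have [[Lfg _] _] := Wfg.
have nfg : Lp_norm m p (f - g) = 0.
  by apply/le_anti; rewrite Lp_norm_ge0 andbT -fg0 le_W2_rnorm.
have p0 : (0 < p%:E)%E by rewrite lte_fin (lt_le_trans ltr01).
have := Lp_normE Lfg; rewrite nfg => /(Lnorm_eq0_eq0 _ p0).
move=> /(_ _)/wrap[]; first exact/measurable_EFinP.
by apply: filterS => x fgx xT; apply/eqP; rewrite -subr_eq0; have [] := fgx xT => /eqP.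
Qed.
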